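(* Fix $r>0$. (i) Let $\theta>0$ and $\rho_\theta(x)=\theta e^{-x}/x$, $x>0$. Suppose $\mathbf{W}$ is distributed as $\mathbf{PK}^{(r)}(\rho_\theta)$, constructed from $\mathbb{B}^{(r)}\sim\mathcal{BN}(r,\rho_\theta)$, and let ${}^{(r)}U_i={}^{(r)}T_i/{}^{(r)}T_{i-1}$, $i\in\mathbb{N}$, be the residual fractions, so that the size-biased permutation $(\tilde W_n)$ of $\mathbf{W}$ satisfies $\tilde W_n=(1-{}^{(r)}U_n)\prod_{i=1}^{n-1}{}^{(r)}U_i$, $n\in\mathbb{N}$. Then $$\big({}^{(r)}U_i\big)_{i\in\mathbb{N}}\stackrel{D}{=}\big(B_i(\Gamma_r\theta,1)\big)_{i\in\mathbb{N}},$$ where, for each $v>0$, $(B_i(v\theta,1))_{i\in\mathbb{N}}$ are i.i.d. Beta$(v\theta,1)$ random variables, and $\Gamma_r$ is a Gamma$(r,1)$ random variable independent of the $(B_i)$. (That is, conditionally on $\Gamma_r=v$, the sequence on the right is i.i.d. Beta$(v\theta,1)$.) (ii) Let $0<\alpha<1$, $C>0$ and $\rho_\alpha(x)=C\alpha x^{-\alpha-1}$, $x>0$. Suppose $\mathbf{W}$ is distributed as $\mathbf{PK}^{(r)}(\rho_\alpha)$, constructed from $\mathbb{B}^{(r)}\sim\mathcal{BN}(r,\rho_\alpha)$, with residual fractions ${}^{(r)}U_i={}^{(r)}T_i/{}^{(r)}T_{i-1}$ as its stick-breaking factors. Then the ${}^{(r)}U_i$ are distributed as Beta$(i\alpha,1-\alpha)$,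 $i\ge1$, not depending on $r$.
   Context: Negative binomial point process: let $\rho$ be a density on $(0,\infty)$ such that $\Pi(dx)=\rho(x)dx$ satisfies $\Pi\{(0,\infty)\}=\infty$, $\Pi\{(x,\infty)\}<\infty$ for $x>0$ and $\int_0^1x\,\Pi(dx)<\infty$ (all densities here do). For $r>0$, $\mathbb{B}^{(r)}\sim\mathcal{BN}(r,\rho)$ means that $\mathbb{B}^{(r)}$ is a point process on $(0,\infty)$ with Laplace functional $\mathbb{E}(e^{-\mathbb{B}^{(r)}(f)})=\big(1+\int_0^\infty(1-e^{-f(x)})\Pi(dx)\big)^{-r}$ for all nonnegative measurable $f$; equivalently, it is a Poisson point process with randomised intensity measure $\Gamma_r\Pi$, $\Gamma_r$ an independent Gamma$(r,1)$ variable. Its points in decreasing order are $J_{(1)}\ge J_{(2)}\ge\cdots$, with sum $T(\mathbb{B}^{(r)})=\sum_iJ_{(i)}\in(0,\infty)$ almost surely. $\mathbf{PK}^{(r)}(\rho)$ is the law of $\mathbf{W}=(W_1,W_2,\ldots)=\big(J_{(1)}/T(\mathbb{B}^{(r)}),J_{(2)}/T(\mathbb{B}^{(r)}),\ldots\big)$. Size-biased picks: conditional on $\mathcal{J}=(J_{(i)})$, $\tilde J_1$ takes the value $J_{(i)}$ with probability $J_{(i)}/T(\mathbb{B}^{(r)})$; for $n\ge1$, conditional on $\mathcal{J}$ and $\tilde J_1,\ldots,\tilde J_n$, $\tilde J_{n+1}$ takes the value $J_{(j)}\in\mathcal{J}\setminus\{\tilde J_1,\ldots,\tilde J_n\}$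 with probability $J_{(j)}/(T(\mathbb{B}^{(r)})-\sum_{i=1}^n\tilde J_i)$. The remaining sums are ${}^{(r)}T_0=T(\mathbb{B}^{(r)})$ and ${}^{(r)}T_n={}^{(r)}T_{n-1}-\tilde J_n$, $n\ge1$. The size-biased permutation of $\mathbf{W}$ is $\tilde W_n=\tilde J_n/T(\mathbb{B}^{(r)})$. Beta$(a,b)$ has density proportional to $u^{a-1}(1-u)^{b-1}$ on $(0,1)$; Gamma$(r,1)$ has density $x^{r-1}e^{-x}/\Gamma(r)$ on $(0,\infty)$. *)

(* Defs.v *)
From HB Require Import structures.
From mathcomp Require Import all_boot all_order all_algebra.
From mathcomp Require Import all_classical all_reals all_analysis.
From mathcomp Require Import measurable_realfun.

Set Implicit Arguments.
Unset Strict Implicit.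
Unset Printing Implicit Defensive.
Import Order.TTheory GRing.Theory Num.Theory.
Import numFieldNormedType.Exports.

Local Open Scope classical_set_scope.
Local Open Scope ring_scope.

(** Sequences indexed from 1 in the mathematics are indexed from 0 here:
    [J i] is J_(i+1), [Jt n] is the (n+1)-st size-biased pick and
    [residual_fraction J Jt n] is U_(n+1) = T_(n+1) / T_n. *)

Section Laws.
Context {R : realType}.

Definition gamma_norm (r : R) : R :=
  \int[lebesgue_measure]_(x in `]0, +oo[) (x `^ (r - 1) * expR (- x)).

Definition gamma_law (r : R) (A : set R) : \bar R :=
  (\int[lebesgue_measure]_(x in A `&` `]0%R, +oo[)
    (x `^ (r - 1) * expR (- x) / gamma_norm r)%:E)%E.

Definition beta_norm (a b : R) : R :=
  \int[lebesgue_measure]_(u in `]0, 1[) (u `^ (a - 1) * (1 - u) `^ (b - 1)).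

(* The library's [beta_prob] only has natural-number parameters. *)
Definition beta_law (a b : R) (A : set R) : \bar R :=
  (\int[lebesgue_measure]_(u in A `&` `]0%R, 1%R[)
    (u `^ (a - 1) * (1 - u) `^ (b - 1) / beta_norm a b)%:E)%E.

End Laws.

Section Conditioning.
Context {R : realType}.

Definition sigma_generated {T I : Type} (X : I -> T -> R) : set (set T) :=
  <<s \bigcup_i preimage_set_system setT (X i) measurable >>.

Context {d : measure_display} {Omega : measurableType d}.
Variable P : probability Omega R.

Definition has_law (X : Omega -> R) (mu : set R -> \bar R) : Prop :=
  forall A, measurable A -> P (X @^-1` A) = mu A.

(* [q] is a version of the conditional probability of the event [E] given the
   sub-sigma-algebra [G]. *)
Definition is_cond_prob (G : set (set Omega)) (E : set Omega)
    (q : Omega -> \bar R) : Prop :=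
  (forall C : set (\bar R), measurable C -> G (q @^-1` C)) /\
  (forall A, G A -> P (A `&` E) = \int[P]_(w in A) q w)%E.

(* Conditionally on [V = v], the variables [Y 0], [Y 1], ... are i.i.d. with
   law [mu v]. *)
Definition cond_iid (V : {RV P >-> R}) (Y : nat -> {RV P >-> R})
    (mu : R -> set R -> \bar R) : Prop :=
  forall (n : nat) (A : 'I_n -> set R), (forall i, measurable (A i)) ->
    is_cond_prob (sigma_generated (fun _ : unit => V))
      [set w | forall i : 'I_n, A i (Y i w)]
      (fun w => \prod_(i < n) mu (V w) (A i))%E.

End Conditioning.

(* Equality of the laws of two sequences on the product sigma-algebra of R^N;
   the two sequences may live on different probability spaces. *)
Definition seq_eq_in_law {R : realType}
    {d : measure_display} {Omega : measurableType d} (P : probability Omega R)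
    {d' : measure_display} {Omega' : measurableType d'}
    (P' : probability Omega' R)
    (X : nat -> Omega -> R) (Y : nat -> Omega' -> R) : Prop :=
  forall A : set (nat -> R),
    sigma_generated (fun (i : nat) (x : nat -> R) => x i) A ->
    P [set w | A (fun i => X i w)] = P' [set w | A (fun i => Y i w)].

Section PointProcess.
Context {R : realType} {d : measure_display} {Omega : measurableType d}.
Variable P : probability Omega R.

(* A point process on (0, oo) is a locally finite, integer-valued random
   measure; it is seen as a random measure on R that does not charge
   (-oo, 0]. *)
Definition is_point_process (B : R.-ker Omega ~> R) : Prop :=
  forall w, [/\ B w `]-oo, 0%R]%classic = 0%E,
    forall a b : R, 0 < a -> (B w `[a, b]%classic < +oo)%E
  & forall A, measurable A ->
      B w A = +oo%E \/ exists k : nat, B w A = k%:R%:E].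

(* In [\bar R], [+oo `^ r] is [+oo] for [r > 0] and [+oo^-1] is [0]. *)
Definition is_BN (r : R) (rho : R -> R)
    (B : R.-ker Omega ~> R) : Prop :=
  is_point_process B /\
  forall f : R -> R, measurable_fun setT f -> (forall x, 0 <= f x) ->
    (\int[P]_w expeR (- \int[B w]_(x in `]0%R, +oo[) (f x)%:E) =
     ((1 + \int[lebesgue_measure]_(x in `]0%R, +oo[)
             ((1 - expR (- f x)) * rho x)%:E) `^ r)^-1)%E.

(* The enumeration is only almost sure, because [B w] may have finitely many
   points for [w] in a null set; [J] is nonnegative everywhere so that the sum
   below is always meaningful. *)
Definition is_decreasing_enumeration
    (B : R.-ker Omega ~> R) (J : nat -> {RV P >-> R}) : Prop :=
  (forall i w, 0 <= J i w) /\
  {ae P, forall w,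
     [/\ forall i, 0 < J i w,
         forall i, J i.+1 w <= J i w
       & forall A, measurable A ->
           B w A = (\sum_(0 <= i <oo) \d_(J i w) A)%E]}.

Definition total_sum (J : nat -> Omega -> R) (w : Omega) : R :=
  fine (\sum_(0 <= i <oo) (J i w)%:E)%E.

(* [W] is the sequence with law PK^(r)(rho) constructed from [B]. *)
Record PK_construction (r : R) (rho : R -> R)
    (B : R.-ker Omega ~> R) (J : nat -> {RV P >-> R})
    (W : nat -> Omega -> R) : Prop := {
  PK_process : is_BN r rho B ;
  PK_points : is_decreasing_enumeration B J ;
  PK_weights : forall i w, W i w = J i w / total_sum J w }.

(* Conditionally on [J] and [Jt 0], ..., [Jt n.-1], the pick [Jt n] equals
   [J j] with the prescribed probability if [J j] has not been picked yet, and
   with probability 0 otherwise. *)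
Definition is_size_biased_picks (J Jt : nat -> {RV P >-> R}) : Prop :=
  forall n j : nat,
    is_cond_prob P
      <<s (\bigcup_i preimage_set_system setT (J i) measurable) `|`
          (\bigcup_(k in `I_n) preimage_set_system setT (Jt k) measurable) >>
      [set w | Jt n w = J j w]
      (fun w =>
         (if [exists k : 'I_n, Jt k w == J j w] then 0
          else J j w / (total_sum J w - \sum_(k < n) Jt k w))%:E).

Fixpoint remaining (J Jt : nat -> Omega -> R) (n : nat) (w : Omega) : R :=
  if n is m.+1 then remaining J Jt m w - Jt m w else total_sum J w.

Definition residual_fraction (J Jt : nat -> Omega -> R) (n : nat)
    (w : Omega) : R := remaining J Jt n.+1 w / remaining J Jt n w.

Definition size_biased_weight (J Jt : nat -> Omega -> R) (n : nat)
    (w : Omega) : R := Jt n w / total_sum J w.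

(* W~_n = (1 - U_n) U_1 ... U_(n-1) for all n, almost surely. *)
Definition stick_breaking (J Jt : nat -> Omega -> R) : Prop :=
  {ae P, forall w, forall n,
     size_biased_weight J Jt n w =
     (1 - residual_fraction J Jt n w) *
       \prod_(i < n) residual_fraction J Jt i w}.

End PointProcess.

(* Main.v *)
(** Write psi(f) = int (1 - e^-f) rho. If, under some weight, the points not yet
    picked have Laplace functional C (1 + psi)^-q, then differentiating in the
    direction of f gives a Campbell-Palm formula: removing one point with a
    probability proportional to its size leaves a point process whose Laplace
    functional is proportional to (1 + psi)^-(q+1). By induction on n, the
    weight prod_(k<n) a_k(U_k) / h_n(T_n) turns the Laplace functional of the
    points left after n picks into r(r+1)...(r+n-1) (1 + psi)^-(r+n), where
    h_0 = 1 and
      h_(n+1)(t) = int x rho(x) a_n(t/(t+x)) h_n(t+x)/(t+x) dx.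
    The right-hand side does not depend on the test functions a_k, so by
    uniqueness of Laplace transforms neither does the law of T_n under that
    weight, and E prod a_k(U_k) is the integral of h_n against a fixed measure.
    For the stable density h_n is a multiple of t^(-n alpha), and the constant
    is a product of Beta integrals. For the gamma density, psi(l x) = theta
    ln (1 + l), and representing (1 + psi)^-q as a Gamma mixture gives the mixed
    product of Beta(v theta, 1) integrals. *)

Require Import Defs.
From HB Require Import structures.
From mathcomp Require Import all_boot all_order all_algebra.
From mathcomp Require Import all_classical all_reals all_analysis.
From mathcomp Require Import measurable_realfun.
From mathcomp Require Import ring lra.
Import Order.TTheory GRing.Theory Num.Theory.
Import numFieldNormedType.Exports.
Local Open Scope classical_set_scope.
Local Open Scope ring_scope.
Set Implicit Arguments.
Unset Strict Implicit.
Unset Printing Implicit Defensive.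

(** * Image measures, Tonelli and changes of variables *)

(** The law of the process on the space of configurations never appears. The Palm formula is used
    only for the pair formed by a removed point and the sum of the other points, with the test
    function [f] carried along as an exponential tilt; this is all that the induction on the picks
    requires. The pair has a product form because the Laplace transform of the second coordinate,
    restricted to a set of values of the first, depends on that set only through a constant factor.
    Two obstacles shape the rest. The weights are divided by h_n, so the functions a_k must be
    positive: indicators are replaced by 1 + 1_A, and probabilities are recovered by subtraction at
    the end. And picks are identified by their values, so the points must be shown almost surely
    summable and pairwise distinct from the Laplace functional alone; absence of ties is where
    boundedness of the density away from 0 enters. *)

Section weighted_image.
Local Open Scope ereal_scope.
Context d (T : measurableType d) d' (T' : measurableType d') (R : realType).
Variables (mu : {measure set T -> \bar R}) (D : set T) (w : T -> R) (phi : T -> T').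

(** The proofs are arguments of the term so that the term determines its own measure structure.
    Restrictions, densities and image measures are all instances, and [ge0_integral_weighted_image]
    integrates against each of them. *)
Definition weighted_image (mD : measurable D) (w0 : forall x, (0 <= w x)%R)
    (mw : measurable_fun setT w) (mphi : measurable_fun setT phi)
    (A : set T') : \bar R :=
  \int[mu]_(x in D `&` phi @^-1` A) (w x)%:E.

Hypothesis mD : measurable D.
Hypothesis w0 : forall x, (0 <= w x)%R.
Hypothesis mw : measurable_fun setT w.
Hypothesis mphi : measurable_fun setT phi.

Let mEw : measurable_fun setT (EFin \o w).
Proof. exact/measurable_EFinP. Qed.

Local Notation nu := (weighted_image mD w0 mw mphi).

Let nu0 : nu set0 = 0.
Proof. by rewrite /weighted_image preimage_set0 setI0 integral_set0. Qed.

Let nu_ge0 A : 0 <= nu A.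
Proof. by apply: integral_ge0 => x _; rewrite lee_fin. Qed.

Let nu_sigma_additive : semi_sigma_additive nu.
Proof.
move=> /= F mF tF mUF; rewrite /weighted_image; apply: cvg_toP.
  apply: ereal_nondecreasing_is_cvgn => m n mn.
  by apply: lee_sum_nneg_natr => // k _ _; apply: integral_ge0 => x _; rewrite lee_fin.
rewrite preimage_bigcup setI_bigcupr ge0_integral_bigcup//.
- by move=> k; apply: measurableI => //; rewrite -[_ @^-1` _]setTI; exact: mphi.
- exact: measurable_funTS mEw.
- by move=> x _; rewrite lee_fin.
- move=> i j _ _ [x [[_ Fi] [_ Fj]]]; apply: tF => //.
  by exists (phi x).
Qed.

HB.instance Definition _ := isMeasure.Build _ _ _ nu nu0 nu_ge0 nu_sigma_additive.

Import HBNNSimple.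

Lemma ge0_integral_weighted_image (f : T' -> \bar R) :
  measurable_fun setT f -> (forall x, 0 <= f x) ->
  \int[nu]_x f x = \int[mu]_(x in D) ((w x)%:E * f (phi x)).
Proof.
move=> mf f0; pose f_ := nnsfun_approx measurableT mf.
have f_f x : (f_ n x)%:E @[n --> \oo] --> f x by exact: cvg_nnsfun_approx.
have f_nd x : {homo (fun n => (f_ n x)%:E) : m n / (m <= n)%N >-> m <= n}.
  by move=> m n mn; rewrite lee_fin; exact/lefP/nd_nnsfun_approx.
have mf_ n : measurable_fun setT (EFin \o f_ n) by exact/measurable_EFinP.
have mfphi n : measurable_fun setT (fun x => (f_ n (phi x))%:E).
  exact: (measurableT_comp (mf_ n) mphi).
transitivity (limn (fun n => \int[nu]_x (f_ n x)%:E)).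
  rewrite -monotone_convergence//.
  - by apply: eq_integral => x Dx; apply/esym/cvg_lim.
  - by move=> *; rewrite lee_fin.
transitivity (limn (fun n => \int[mu]_(x in D) ((w x)%:E * (f_ n (phi x))%:E))); last first.
  rewrite -monotone_convergence//.
  - apply: eq_integral => x Dx; apply/cvg_lim => //.
    by apply: cvgeZl.
  - by move=> n; exact: (measurable_funTS (emeasurable_funM mEw (mfphi n))).
  - by move=> *; rewrite mule_ge0// lee_fin.
  - by move=> x _ m n mn; rewrite lee_pmul ?lee_fin//; exact: f_nd.
congr (limn _); apply/funext => n.
under [in LHS]eq_integral do rewrite fimfunE// -fsumEFin//.
rewrite ge0_integral_fsum//; last 2 first.
- by move=> r; exact/measurable_EFinP/measurableT_comp.
- by move=> r x _; rewrite nnfun_muleindic_ge0.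
under eq_fsbigr do rewrite integralZl_indic_nnsfun//.
under [in RHS]eq_integral => x _.
  rewrite fimfunE -fsumEFin// ge0_mule_fsumr; last first.
    by move=> i; rewrite nnfun_muleindic_ge0.
  over.
rewrite [RHS]ge0_integral_fsum//; last 2 first.
- move=> r; apply: measurable_funTS; apply: emeasurable_funM => //.
  apply/measurable_EFinP/measurableT_comp => //.
  exact: measurableT_comp.
- by move=> r x _; apply: mule_ge0; [rewrite lee_fin|exact: nnfun_muleindic_ge0].
apply: eq_fsbigr => r _.
have [r0|r0] := ltP r 0%R.
  rewrite preimage_nnfun0//=; under [in RHS]eq_integral do rewrite indic0 mulr0 mule0.
  by rewrite integral_indic// set0I measure0 mule0 integral0.
rewrite integral_indic// setIT /= /weighted_image integral_mkcondr -ge0_integralZl//; last 2 first.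
- apply/measurable_restrict => //; last exact: measurable_funTS mEw.
  rewrite -[_ @^-1` _]setTI; exact: mphi.
- by move=> x _; rewrite patchE; case: ifP => _; rewrite ?lee_fin.
apply: eq_integral => x _; rewrite patchE indicE.
have -> : (x \in phi @^-1` (f_ n @^-1` [set r])) = (phi x \in f_ n @^-1` [set r]).
  by apply/idP/idP; rewrite !inE.
by case: (_ \in _); rewrite /= ?mulr1 ?mulr0 ?mule0 // muleC.
Qed.
End weighted_image.

Lemma measurable_patch d (T : measurableType d) (R : realType) (D : set T)
    (f : T -> \bar R) :
  measurable D -> measurable_fun setT f -> measurable_fun setT (f \_ D).
Proof.
move=> mD mf; apply/(measurable_restrict f mD measurableT).1.
exact: measurable_funTS mf.
Qed.

Lemma measurable_indic_comp d1 d2 (T1 : measurableType d1) (T2 : measurableType d2)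
    (R : realType) (A : set T2) (phi : T1 -> T2) :
  measurable A -> measurable_fun setT phi ->
  measurable_fun setT (fun x => \1_A (phi x) : R).
Proof. by move=> mA mphi; exact: (measurableT_comp (measurable_indic mA) mphi). Qed.

Lemma integral_gt0 d (T : measurableType d) (R : realType)
    (mu : {measure set T -> \bar R}) (D : set T) (f : T -> \bar R) :
  measurable D -> measurable_fun D f -> (forall x, D x -> (0 < f x)%E) ->
  (0 < mu D)%E -> (0 < \int[mu]_(x in D) f x)%E.
Proof.
move=> mD mf f0 muD; rewrite lt_def integral_ge0 ?andbT; last first.
  by move=> x /f0 /ltW.
apply/negP => /eqP I0.
have /(ae_eq_integral_abs mu mD mf) [N [mN N0 DN]] : (\int[mu]_(x in D) `|f x| = 0)%E.
  by rewrite -[RHS]I0; apply: eq_integral => x /set_mem /f0 /ltW f0x; rewrite gee0_abs.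
suff : (mu D <= mu N)%E by rewrite N0 leNgt muD.
apply: le_measure; rewrite ?inE// => x Dx; apply: DN => /= /(_ Dx) fx0.
by have := f0 _ Dx; rewrite fx0 ltxx.
Qed.

Section tonelli.
Local Open Scope ereal_scope.
Context d1 d2 (T1 : measurableType d1) (T2 : measurableType d2) (R : realType).
Variables (m1 : {sigma_finite_measure set T1 -> \bar R})
  (m2 : {sigma_finite_measure set T2 -> \bar R}).

Lemma tonelli_in (D1 : set T1) (D2 : set T2) (f : T1 -> T2 -> \bar R) :
  measurable D1 -> measurable D2 ->
  measurable_fun setT (fun z : T1 * T2 => f z.1 z.2) ->
  (forall x y, D1 x -> D2 y -> 0 <= f x y) ->
  \int[m1]_(x in D1) \int[m2]_(y in D2) f x y =
  \int[m2]_(y in D2) \int[m1]_(x in D1) f x y.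
Proof.
move=> mD1 mD2 mf f0.
pose g := (fun z : T1 * T2 => f z.1 z.2) \_ (D1 `*` D2).
have mg : measurable_fun setT g.
  by apply: measurable_patch => //; exact: measurableX.
have g0 z : 0 <= g z.
  rewrite /g patchE; case: ifPn => // /[!inE] -[? ?]; exact: f0.
transitivity (\int[m1]_x \int[m2]_y g (x, y)).
  rewrite integral_mkcond; apply: eq_integral => x _.
  rewrite patchE; case: ifPn => [/set_mem xD|xD].
    rewrite integral_mkcond; apply: eq_integral => y _.
    by rewrite /g !patchE in_setX /= (mem_set xD).
  by rewrite integral0_eq// => y _; rewrite /g patchE in_setX /= (negbTE xD).
rewrite (fubini_tonelli g mg g0).
rewrite [RHS]integral_mkcond; apply: eq_integral => x _.
rewrite patchE; case: ifPn => [/set_mem xD|xD].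
  rewrite [RHS]integral_mkcond; apply: eq_integral => y _.
  by rewrite /g !patchE in_setX /= [x \in D2]mem_set// andbT.
by rewrite integral0_eq// => y _; rewrite /g patchE in_setX /= (negbTE xD) andbF.
Qed.

Lemma measurable_integral_in (D2 : set T2) (f : T1 -> T2 -> \bar R) :
  measurable D2 ->
  measurable_fun setT (fun z : T1 * T2 => f z.1 z.2) ->
  (forall x y, D2 y -> 0 <= f x y) ->
  measurable_fun setT (fun x => \int[m2]_(y in D2) f x y).
Proof.
move=> mD2 mf f0.
pose g := (fun z : T1 * T2 => f z.1 z.2) \_ (setT `*` D2).
have mg : measurable_fun setT g.
  by apply: measurable_patch => //; exact: measurableX.
have g0 z : 0 <= g z.
  rewrite /g patchE; case: ifPn => // /[!inE] -[? ?]; exact: f0.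
have := measurable_fun_fubini_tonelli_F (m2 := m2) g mg g0.
apply: eq_measurable_fun => x _.
rewrite /fubini_F [RHS]integral_mkcond; apply: eq_integral => y _.
by rewrite /g !patchE in_setX /= mem_set.
Qed.
End tonelli.

Section substitution.
Local Open Scope ereal_scope.
Context (R : realType).
Local Notation mu := (@lebesgue_measure R).
Variables (D : set R) (phi w : R -> R).
Hypotheses (mD : measurable D) (mphi : measurable_fun setT phi)
  (w0 : forall x, (0 <= w x)%R) (mw : measurable_fun setT w).
Hypothesis phi_gt0 : forall u, D u -> (0 < phi u)%R.
Hypothesis phiE : forall a b, (0 <= a)%R -> (a < b)%R ->
  \int[mu]_(u in D `&` phi @^-1` `]a, b]) (w u)%:E = (b - a)%:E.

Local Notation RT := (measurableTypeR R).
Local Notation m2 := (@weighted_image _ RT _ RT R mu D w phi mD w0 mw mphi).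
Let w1 (x : R) : (0 <= (fun=> 1 : R) x)%R. Proof. exact: ler01. Qed.

Let m1 := @weighted_image _ RT _ RT R mu _ _ _ (measurable_itv `]-oo, 0%R]) w1
  (@measurable_cst _ _ RT R setT 1%R) (@measurable_id _ RT setT).
Local Notation m3 := (measure_add m2 m1).

Let m1E A : measurable A -> m1 A = mu (`]-oo, 0%R] `&` A).
Proof.
by move=> mA; rewrite /m1 /weighted_image integral_cst ?mul1e//; exact: measurableI.
Qed.

(** The image under [phi] of the density [w] on [D] agrees with Lebesgue measure on half-open
    intervals of the positive axis. Adding [m1], Lebesgue measure on the nonpositive axis, gives a
    measure that agrees with it on all half-open intervals, hence everywhere. Only [phiE] has to be
    checked, without any change of variables for general integrands. *)
Lemma ge0_substitution (F : R -> \bar R) :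
  measurable_fun setT F -> (forall x, 0 <= F x) ->
  \int[mu]_(x in `]0%R, +oo[) F x = \int[mu]_(u in D) ((w u)%:E * F (phi u)).
Proof.
move=> mF F0.
have m3E A : measurable A -> mu A = m3 A.
  apply: lebesgue_measure_unique => X [[a b]] _ <- /=.
  rewrite /measure_add/= /msum !big_ord_recl big_ord0 /= adde0.
  rewrite [X in _ + X](_ : _ = mu (`]-oo, 0%R] `&` `]a, b])); last first.
    by apply: m1E; exact: measurable_itv.
  rewrite /weighted_image/= lebesgue_measure_itv/= lte_fin.
  case: ifPn => [ab|]; last first.
    rewrite -leNgt => ba.
    have -> : `]a, b]%classic = set0 :> set R.
      by apply/set_itv_ge; rewrite bnd_simp -leNgt.
    by rewrite preimage_set0 !setI0 integral_set0 measure0 adde0.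
  have [b0|b0] := leP b 0%R.
    have -> : D `&` phi @^-1` `]a, b] = set0.
      rewrite -subset0 => u [/phi_gt0 + /=].
      by rewrite in_itv/= => p0 /andP[_ /(lt_le_trans p0)]; rewrite ltNge b0.
    rewrite integral_set0 add0e setIidr; first by rewrite lebesgue_measure_itv/= lte_fin ab.
    by move=> x/=; rewrite !in_itv/= => /andP[_ xb]; exact: le_trans b0.
  have [a0|a0] := leP 0%R a.
    rewrite phiE//.
    have -> : `]-oo, 0%R] `&` `]a, b] = set0 :> set R.
      rewrite -subset0 => u /= []; rewrite !in_itv/= => u0 /andP[au _].
      by move: (le_lt_trans u0 (le_lt_trans a0 au)); rewrite ltxx.
    by rewrite measure0 adde0 EFinB.
  have -> : D `&` phi @^-1` `]a, b] = D `&` phi @^-1` `]0%R, b].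
    apply/seteqP; split => u [Du] /=; rewrite !in_itv/= => /andP[au ->]; split => //.
      by rewrite phi_gt0.
    by rewrite (lt_trans a0 au).
  rewrite phiE//.
  have -> : `]-oo, 0%R] `&` `]a, b] = `]a, 0%R]%classic :> set R.
    apply/seteqP; split => u /=; rewrite !in_itv/=.
      by move=> [-> /andP[->]].
    by move=> /andP[-> u0]; split => //; rewrite (le_trans u0 (ltW b0)).
  by rewrite lebesgue_measure_itv/= lte_fin a0 -EFinB -!EFinD !(subr0,sub0r).
set P := `]0%R, +oo[%classic.
have mFP : measurable_fun setT (F \_ P).
  by apply: measurable_patch => //; exact: measurable_itv.
have FP0 x : 0 <= (F \_ P) x by rewrite patchE; case: ifP.
rewrite integral_mkcond.
transitivity (\int[m3]_x (F \_ P) x).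
  by apply: eq_measure_integral => A mA _; exact: m3E.
rewrite ge0_integral_measure_add// !ge0_integral_weighted_image//.
rewrite [X in _ + X]integral0_eq ?adde0; last first.
  move=> x /=; rewrite in_itv/= => x0; rewrite patchE /P mem_setE in_itv/= andbT ltNge x0.
  by rewrite mule0.
apply: eq_integral => u /set_mem Du; congr (_ * _).
by rewrite patchE ifT// /P mem_setE in_itv/= andbT phi_gt0.
Qed.
End substitution.

(** Inversion is discontinuous at 0, so it is written as [x] times a real power of [x ^+ 2]; both
    sides are 0 at 0. *)
Lemma measurable_inv (R : realType) : measurable_fun setT (@GRing.inv R).
Proof.
apply: (@eq_measurable_fun _ _ _ _ _ (fun x : R => x * (x ^+ 2) `^ (-1))).
  move=> x _; rewrite powR_inv1 ?sqr_ge0//.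
  have [->|x0] := eqVneq x 0; first by rewrite invr0 mul0r.
  by rewrite expr2 invfM mulrA mulfV// mul1r.
apply: measurable_funM => //.
apply: (@measurableT_comp _ _ _ _ _ _ (fun y : R => y `^ (-1)) _ (fun x : R => x ^+ 2)).
  exact: measurable_powR.
exact: exprn_measurable.
Qed.

Lemma integral_derive_itvcc (R : realType) (f F : R -> R) (a b : R) : a < b ->
  (forall x, a <= x <= b -> is_derive x 1 F (f x)) ->
  (forall x, a <= x <= b -> {for x, continuous f}) ->
  (\int[lebesgue_measure]_(x in `[a, b]) (f x)%:E = (F b - F a)%:E)%E.
Proof.
move=> ab dF cf.
have dF' x : a <= x <= b -> derivable F x 1 by move=> /dF [].
have cF x : a <= x <= b -> {for x, continuous F}.
  by move=> /dF' /derivable1_diffP /differentiable_continuous.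
rewrite (@continuous_FTC2 _ _ F)//.
- apply: continuous_in_subspaceT => x /set_mem /=; rewrite in_itv/=; exact: cf.
- split.
  + by move=> x; rewrite in_itv/= => /andP[ax xb]; apply: dF'; rewrite !ltW.
  + by apply: cvg_at_right_filter; apply: cF; rewrite lexx ltW.
  + by apply: cvg_at_left_filter; apply: cF; rewrite lexx ltW.
- move=> x; rewrite in_itv/= => /andP[ax xb]; rewrite derive1E.
  by have [] := dF x; rewrite ?ltW.
Qed.

Lemma ge0_integral_scale (R : realType) (c : R) (F : R -> \bar R) : 0 < c ->
  measurable_fun setT F -> (forall x, 0 <= F x)%E ->
  (\int[lebesgue_measure]_(x in `]0%R, +oo[) F x =
   c%:E * \int[lebesgue_measure]_(x in `]0%R, +oo[) F (c * x)%R)%E.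
Proof.
move=> c0 mF F0.
have mc : measurable_fun setT (fun x : R => c * x) by exact: measurable_funM.
rewrite (@ge0_substitution R `]0, +oo[ (fun x => c * x) (fun=> c))//.
- rewrite ge0_integralZl//; first by apply: measurable_funTS; exact: measurableT_comp mF mc.
  by rewrite lee_fin ltW.
- by move=> x; exact: ltW.
- by move=> u /=; rewrite !in_itv/= !andbT => u0; exact: mulr_gt0.
- move=> a b a0 ab.
  have -> : `]0%R, +oo[ `&` (fun x => c * x) @^-1` `]a, b] = `]a / c, b / c]%classic.
    apply/seteqP; split => u /=; rewrite !in_itv/= !andbT ?ltr_pdivrMr// ler_pdivlMr//.
      by move=> [_]; rewrite ![c * _]mulrC.
    rewrite ![c * _]mulrC => /andP[h ->]; rewrite h; split => //.
    by rewrite -(pmulr_lgt0 _ c0) (le_lt_trans _ h).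
  rewrite integral_cst//= lebesgue_measure_itv/= lte_fin ltr_pM2r ?invr_gt0// ab.
  by rewrite -EFinB -EFinM -mulrBl mulrCA divff ?mulr1// gt_eqF.
Qed.

(* The substitution [x = t / u - t], that is [u = t / (t + x)]. *)
Lemma ge0_integral_fraction (R : realType) (t : R) (F : R -> \bar R) : 0 < t ->
  measurable_fun setT F -> (forall x, 0 <= F x)%E ->
  (\int[lebesgue_measure]_(x in `]0%R, +oo[) F x =
   \int[lebesgue_measure]_(u in `]0%R, 1%R[) ((t / u ^+ 2)%:E * F (t / u - t)%R))%E.
Proof.
move=> t0 mF F0.
have mphi : measurable_fun setT (fun u : R => t / u - t).
  by apply: measurable_funB => //; apply: measurable_funM => //; exact: measurable_inv.
apply: (@ge0_substitution R `]0, 1[ (fun u => t / u - t) (fun u => t / u ^+ 2)) => //.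
- by move=> x; rewrite divr_ge0 ?sqr_ge0// ltW.
- apply: measurable_funM => //; apply: (measurableT_comp (@measurable_inv _)).
  exact: exprn_measurable.
- move=> u /=; rewrite in_itv/= => /andP[u0 u1].
  by rewrite subr_gt0 ltr_pdivlMr// gtr_pMr.
- move=> a b a0 ab.
  have b0 : 0 < b by exact: le_lt_trans ab.
  have ta : 0 < t + a by exact: ltr_wpDr.
  have tb : 0 < t + b by exact: addr_gt0.
  have -> : `]0%R, 1%R[ `&` (fun u => t / u - t) @^-1` `]a, b] = `[t / (t + b), t / (t + a)[%classic.
    apply/seteqP; split => u /=; rewrite !in_itv/=.
      move=> [/andP[u0 u1]]; rewrite ltrBrDr ltr_pdivlMr// lerBlDr ler_pdivrMr// => /andP[h1 h2].
      by rewrite ler_pdivrMr// ltr_pdivlMr// ![u * _]mulrC ![t + _]addrC h1 h2.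
    move=> /andP[h1 h2].
    have u0 : 0 < u by apply: lt_le_trans h1; exact: divr_gt0.
    rewrite u0; split.
      by rewrite (lt_le_trans h2)// ler_pdivrMr// mul1r lerDl.
    move: h1 h2; rewrite ltrBrDr ltr_pdivlMr// lerBlDr ler_pdivrMr// ler_pdivrMr// ltr_pdivlMr//.
    by rewrite ![u * _]mulrC ![t + _]addrC => -> ->.
  set c := t / (t + b); set e := t / (t + a).
  have c0 : 0 < c by exact: divr_gt0.
  have ce : c < e by rewrite /c /e ltr_pM2l// ltf_pV2// ltrD2l.
  have D (x : R) : 0 < x -> is_derive x 1 (fun u : R => - (t / u)) (t / x ^+ 2).
    move=> x0.
    have xn0 : x != 0 by rewrite gt_eqF.
    have H : is_derive x 1 (fun u : R => u^-1) (- x ^- 2 *: 1) by exact: is_deriveV.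
    apply: is_derive_eq.
    by rewrite /GRing.scale/= mulr1 !mulrN opprK.
  rewrite integral_itv_bndo_bndc; last first.
    apply/measurable_EFinP/measurable_funTS/measurable_funM => //.
    apply: (measurableT_comp (@measurable_inv _)).
    exact: exprn_measurable.
  have D' x : c <= x <= e -> is_derive x 1 (fun u : R => - (t / u)) (t / x ^+ 2).
    by move=> /andP[cx _]; apply: D; exact: lt_le_trans cx.
  rewrite (integral_derive_itvcc ce D').
  - congr EFin; rewrite /c /e; field; rewrite !gt_eqF//.
  - move=> x /andP[cx _]; have x0 : 0 < x by exact: lt_le_trans cx.
    apply: (@continuousM _ _ (fun=> t)); first exact: cvg_cst.
    apply: continuousV; first by rewrite gt_eqF// exprn_gt0.
    exact: exprn_continuous.
Qed.

(** * Uniqueness of Laplace transforms *)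

Lemma bernoulli_ge (R : realType) (v : R) (k : nat) : 0 <= v <= 1 ->
  1 - k%:R * v <= (1 - v) ^+ k.
Proof.
move=> /andP[v0 v1]; elim: k => [|k IH]; first by rewrite mul0r subr0 expr0.
rewrite exprS; apply: le_trans (ler_wpM2l _ IH); last by rewrite subr_ge0.
have : 0 <= k%:R * v * v by rewrite !mulr_ge0.
rewrite -natr1; nra.
Qed.

Lemma bernoulli_ge1 (R : realType) (v : R) (k : nat) : 0 <= v ->
  1 + k%:R * v <= (1 + v) ^+ k.
Proof.
move=> v0; elim: k => [|k IH]; first by rewrite mul0r addr0 expr0.
rewrite exprS; apply: le_trans (ler_wpM2l _ IH); last by rewrite addr_ge0.
have : 0 <= k%:R * v * v by rewrite !mulr_ge0.
rewrite -natr1; nra.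
Qed.

Lemma cvg_natM_exp (R : realType) (x : R) : 0 <= x < 1 ->
  m%:R * x ^+ (2 * m) @[m --> \oo] --> (0 : R).
Proof.
move=> /andP[x0 x1].
have [->|xn0] := eqVneq x 0.
  apply: cvg_near_cst; near=> m.
  by rewrite expr0n muln_eq0/= gtn_eqF ?mulr0//; near: m; exact: nbhs_infty_gt.
have xp : 0 < x by rewrite lt_def xn0.
(* With [1 + e = x^-1], Bernoulli's inequality bounds [m%:R * e] by the m-th power of [x^-1]. One of
   the two factors [x ^+ m] absorbs [m], the other one tends to 0. *)
pose e := x^-1 - 1.
have e0 : 0 < e by rewrite subr_gt0 invf_gt1.
have bnd m : 0 <= m%:R * x ^+ (2 * m) <= e^-1 * x ^+ m.
  rewrite mulr_ge0 ?exprn_ge0//= mul2n -addnn exprD mulrA ler_wpM2r ?exprn_ge0//.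
  have e1 : 1 + e = x^-1 by rewrite /e addrC subrK.
  have := @bernoulli_ge1 R e m (ltW e0); rewrite e1 => h.
  rewrite -[leRHS]mul1r ler_pdivlMr// mulrAC -ler_pdivlMr ?exprn_gt0// mul1r -exprVn.
  by apply: le_trans h; rewrite lerDr.
have c0 : e^-1 * x ^+ m @[m --> \oo] --> (0 : R).
  by rewrite -(mulr0 e^-1); apply: cvgMr; apply: cvg_expr; rewrite ger0_norm.
apply: (squeeze_cvgr _ (cvg_cst 0) c0).
by apply: nearW => m; exact: bnd.
Unshelve. all: by end_near. Qed.

(* Evaluated at [u], this is [(1 - u ^ 2m) ^ k] with [k] about [m y ^ (- 2m)]: the
   power is close to 1 for [u < y] and to 0 for [u > y]. *)
Definition step_poly (R : realType) (y : R) (m : nat) : {poly R} :=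
  (1 - 'X^(2 * m)) ^+ (Num.truncn (m%:R * y ^- (2 * m))).+1.

Lemma step_poly_bound (R : realType) (y u : R) m : 0 <= u <= 1 ->
  0 <= (step_poly y m).[u] <= 1.
Proof.
move=> /andP[u0 u1]; rewrite /step_poly !hornerE.
have h : 0 <= 1 - u ^+ (2 * m) <= 1.
  by rewrite subr_ge0 exprn_ile1//= gerBl exprn_ge0.
by move: h => /andP[h1 h2]; rewrite exprn_ge0//= exprn_ile1.
Qed.

Lemma step_poly_cvg (R : realType) (y u : R) : 0 < y <= 1 -> 0 <= u <= 1 ->
  (step_poly y m).[u] @[m --> \oo] --> ((u < y)%R%:R : R).
Proof.
move=> /andP[y0 y1] /andP[u0 u1].
pose k m := (Num.truncn (m%:R * y ^- (2 * m))).+1.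
have kge m : m%:R * y ^- (2 * m) <= (k m)%:R by exact/ltW/truncnS_gt.
have kle m : (k m)%:R <= m%:R * y ^- (2 * m) + 1.
  by rewrite -natr1 lerD2r truncn_le mulr_ge0// invr_ge0 exprn_ge0// ltW.
have E m : (step_poly y m).[u] = (1 - u ^+ (2 * m)) ^+ k m.
  by rewrite /step_poly !hornerE.
under eq_fun do rewrite E.
have um m : 0 <= u ^+ (2 * m) <= 1 by rewrite exprn_ge0//= exprn_ile1.
(* Bernoulli: the power is at least 1 - k u^(2m), and k is at most m y^(-2m) + 1. *)
have H1 : u < y -> (1 - u ^+ (2 * m)) ^+ k m @[m --> \oo] --> (1 : R).
  move=> uy; have c : 1 - (m%:R * (u / y) ^+ (2 * m) + u ^+ (2 * m)) @[m --> \oo] --> (1 : R).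
    rewrite -[X in _ --> X]subr0 -[X in _ - X]addr0.
    apply: cvgB; first exact: cvg_cst.
    apply: cvgD.
      by apply: cvg_natM_exp; rewrite divr_ge0//= ?ltr_pdivrMr ?mul1r// ltW.
    apply: (@squeeze_cvgr _ _ _ _ (fun=> 0) (fun m => m%:R * u ^+ (2 * m) )).
    - near=> m; rewrite exprn_ge0//= ler_peMl ?exprn_ge0// ler1n.
      by near: m; exact: nbhs_infty_gt.
    - exact: cvg_cst.
    - by apply: cvg_natM_exp; rewrite u0/= (lt_le_trans uy).
  apply: (squeeze_cvgr _ c); last exact: cvg_cst.
  apply: nearW => m.
  have /andP[h1 h2] := um m.
  apply/andP; split; last by rewrite exprn_ile1// ?subr_ge0// gerBl.
  apply: le_trans (bernoulli_ge _ (um m)); rewrite lerD2l lerN2.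
  apply: le_trans (ler_wpM2r h1 (kle m)) _.
  by rewrite mulrDl mul1r lerD2r exprMn exprVn -mulrA [_ / _]mulrC.
(* Here k u^(2m) >= m, so the power is at most e^(-k u^(2m)) and hence at most 1/(m + 1). The case
   [u = y] is included, which makes the limiting inequality strict. *)
have H2 : y <= u -> (1 - u ^+ (2 * m)) ^+ k m @[m --> \oo] --> (0 : R).
  move=> yu; have c : (m.+1%:R)^-1 @[m --> \oo] --> (0 : R) by exact: cvg_harmonic.
  apply: (squeeze_cvgr _ (cvg_cst 0) c); apply: nearW => m.
  have /andP[h1 h2] := um m.
  rewrite exprn_ge0 ?subr_ge0//=.
  have h3 : 1 - u ^+ (2 * m) <= expR (- u ^+ (2 * m)) by exact: expR_ge1Dx.
  apply: le_trans (@lerXn2r _ (k m) _ _ _ _ h3) _; rewrite ?nnegrE ?subr_ge0 ?expR_ge0//.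
  rewrite -expRM_natl mulrN expRN lef_pV2 ?posrE ?expR_gt0//.
  apply: le_trans (expR_ge1Dx _); rewrite -nat1r lerD2l.
  apply: le_trans (ler_wpM2r h1 (kge m)).
  rewrite -mulrA ler_peMr// mulrC -ler_pdivrMr ?invr_gt0 ?exprn_gt0//.
  by rewrite invrK mul1r lerXn2r// nnegrE ltW.
by have [/H1|/H2] := ltP u y.
Unshelve. all: by end_near. Qed.

Section laplace.
Context (R : realType) (m1 m2 : {measure set R -> \bar R}) (c : R).
Hypothesis c0 : 0 <= c.
Let D : set R := `[0, +oo[%classic.
Hypotheses (fin1 : (m1 D < +oo)%E) (fin2 : (m2 D < +oo)%E).
Hypothesis lap : forall k : nat,
  (\int[m1]_(t in D) (expR (- (k%:R * t)))%:E =
   c%:E * \int[m2]_(t in D) (expR (- (k%:R * t)))%:E)%E.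

Let mD : measurable D. Proof. exact: measurable_itv. Qed.

Let mexp k : measurable_fun setT (fun t : R => expR (- t) ^+ k).
Proof.
apply: measurable_funX; apply: measurableT_comp; first exact: measurable_expR.
exact: measurable_funN.
Qed.

Let exp01 t : D t -> 0 <= expR (- t) <= 1.
Proof. by rewrite /D/= in_itv/= andbT => t0; rewrite expR_ge0/= -expR0 ler_expR oppr_le0. Qed.

(** The extra power of e^(-t) absorbs the factor ['X] of [p * 'X + a%:P], so that the induction on
    polynomials closes; the same device is used in [lap_poly]. *)
Let int_poly (m : {measure set R -> \bar R}) (p : {poly R}) k : (m D < +oo)%E ->
  m.-integrable D (fun t => (p.[expR (- t)] * expR (- t) ^+ k)%:E).
Proof.
move=> fin; elim/poly_ind: p k => [|p a IH] k.
  apply: (eq_integrable mD (cst 0%E)); last exact: integrable0.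
  by move=> x _; rewrite hornerC mul0r.
have mono : m.-integrable D (fun t => (expR (- t) ^+ k)%:E).
  apply: (@measurable_bounded_integrable _ _ _ m (fun t => expR (- t) ^+ k)) => //.
    exact: measurable_funTS.
  exists 1; split; first exact: num_real.
  move=> M M1 t /exp01 /andP[h1 h2].
  by rewrite /= ger0_norm ?exprn_ge0// (le_trans _ (ltW M1))// exprn_ile1.
apply: (eq_integrable mD (fun t => ((p.[expR (- t)] * expR (- t) ^+ k.+1)%:E
   + a%:E * (expR (- t) ^+ k)%:E)%E)).
  by move=> t _; rewrite !hornerE -EFinM -EFinD; congr EFin; rewrite exprS; ring.
by apply: integrableD => //; exact: integrableZl.
Qed.

Let lap_poly (p : {poly R}) k :
  (\int[m1]_(t in D) (p.[expR (- t)] * expR (- t) ^+ k)%:E =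
   c%:E * \int[m2]_(t in D) (p.[expR (- t)] * expR (- t) ^+ k)%:E)%E.
Proof.
elim/poly_ind: p k => [|p a IH] k.
  by under eq_integral do rewrite hornerC mul0r;
     under [in RHS]eq_integral do rewrite hornerC mul0r; rewrite !integral0 mule0.
have E t : ((p * 'X + a%:P).[expR (- t)] * expR (- t) ^+ k)%:E =
   ((p.[expR (- t)] * expR (- t) ^+ k.+1)%:E + (a%:P.[expR (- t)] * expR (- t) ^+ k)%:E)%E.
  by rewrite !hornerE -EFinD; congr EFin; rewrite exprS; ring.
under eq_integral do rewrite E; under [in RHS]eq_integral do rewrite E.
rewrite !integralD//; try exact: int_poly.
rewrite muleDr//; last by apply: fin_num_adde_defl; apply: integrable_fin_num => //; exact: int_poly.
congr (_ + _)%E; first exact: IH.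
under eq_integral do rewrite hornerC EFinM.
under [in RHS]eq_integral do rewrite hornerC EFinM.
have I (m : {measure set R -> \bar R}) : (m D < +oo)%E -> m.-integrable D (fun t => (expR (- t) ^+ k)%:E).
  move=> fin; have := @int_poly m 1 k fin.
  by apply: eq_integrable => // t _; rewrite hornerC mul1r.
rewrite !integralZl//; try exact: I.
rewrite muleCA; congr (_ * _)%E.
have := lap k.
rewrite (_ : (fun t => (expR (- (k%:R * t)))%:E) = (fun t => (expR (- t) ^+ k)%:E))//.
by apply/funext => t; rewrite -mulrN expRM_natl.
Qed.

(** Knowing the transform at the integers amounts to knowing the integrals of all polynomials in
    e^(-t). The step polynomials are bounded by 1 and converge to the indicator of a ray, so
    dominated convergence gives the mass of every ray, and rays form a generating system stable
    under intersection. The factor [c] allows the comparison of proportional measures, as needed for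
    the sections of a Campbell measure. *)
Lemma laplace_unique (A : set R) : measurable A ->
  (m1 (A `&` D) = c%:E * m2 (A `&` D))%E.
Proof.
have ray y : 0 < y <= 1 ->
  (m1 (D `&` [set t | expR (- t) < y]%R) = c%:E * m2 (D `&` [set t | expR (- t) < y]%R))%E.
  move=> y01.
  have mA : measurable [set t : R | expR (- t) < y].
    have := mexp 1 measurableT (measurable_itv `]-oo, y[); rewrite setTI.
    by rewrite (_ : _ @^-1` _ = [set t : R | expR (- t) < y]).
  have C (m : {measure set R -> \bar R}) : (m D < +oo)%E ->
     (\int[m]_(t in D) ((step_poly y n).[expR (- t)] * expR (- t) ^+ 0)%:E)%E @[n --> \oo]
       --> m (D `&` [set t | expR (- t) < y]%R).
    move=> fin.
    rewrite setIC -integral_indic//.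
    have [] := @dominated_convergence _ _ _ m D mD
      (fun n t => ((step_poly y n).[expR (- t)] * expR (- t) ^+ 0)%:E)
      (fun t => (\1_[set t : R | expR (- t) < y] t)%:E) (cst 1%E).
    - by move=> n; have /measurable_int := @int_poly m (step_poly y n) 0 fin.
    - by apply/measurable_EFinP/measurable_funTS/measurable_indic.
    - apply: aeW => t Dt; apply: cvg_EFin; first exact: nearW.
      rewrite /comp/=; under eq_cvg do rewrite expr0 mulr1.
      rewrite indicE mem_setE /=.
      by apply: step_poly_cvg => //; exact: exp01.
    - apply: (@measurable_bounded_integrable _ _ _ m (cst 1)) => //.
      exists 1; split; first exact: num_real.
      by move=> M M1 t _; rewrite /= normr1 ltW.
    - apply: aeW => t n Dt; rewrite expr0 mulr1/= lee_fin.
      by have /andP[h1 h2] := @step_poly_bound R y _ n (exp01 Dt); rewrite ger0_norm.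
    by move=> _ _ //.
  have C1 := C _ fin1; have C2 := C _ fin2.
  have C3 := cvgeZl (isT : c%:E \is a fin_num) C2.
  apply: (cvg_unique _ C1) => //.
  apply: cvg_trans C3; apply: near_eq_cvg; apply: nearW => n.
  by rewrite lap_poly.
move=> mA.
pose cn := NngNum c0.
have w1 (x : R) : 0 <= (fun=> 1 : R) x by exact: ler01.
pose n1 : {measure set R -> \bar R} := weighted_image m1 mD w1 (@measurable_cst _ _ R R setT 1) (@measurable_id _ R setT).
pose n2 : {measure set R -> \bar R} := mscale cn (weighted_image m2 mD w1 (@measurable_cst _ _ R R setT 1) (@measurable_id _ R setT)).
have n1E B : measurable B -> n1 B = m1 (B `&` D).
  by move=> mB; rewrite /n1/= /weighted_image integral_cst ?mul1e setIC//; exact: measurableI.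
have n2E B : measurable B -> n2 B = (c%:E * m2 (B `&` D))%E.
  move=> mB; rewrite /n2/= /mscale/= /weighted_image integral_cst ?mul1e setIC//.
  exact: measurableI.
rewrite -n1E// -n2E//.
have fin_n1 B : measurable B -> (n1 B < +oo)%E.
  move=> mB; rewrite n1E//; apply: le_lt_trans fin1; apply: le_measure; rewrite ?inE//.
    exact: measurableI.
have mray x : measurable (`]x, +oo[%classic : set R) by exact: measurable_itv.
apply: (measure_unique (@RGenOInfty.G R) (fun k => `](- k%:R), +oo[%classic)) => //.
- exact: RGenOInfty.measurableE.
- move=> _ _ [x ->] [y ->]; exists (Num.max x y).
  by apply/seteqP; split=> z /=; rewrite !in_itv/= !andbT gt_max => /andP.
- by move=> k; exists (- k%:R).
- rewrite -subTset => x _ /=; exists (Num.truncn (- x)).+1 => //=.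
  by rewrite in_itv/= andbT ltrNl truncnS_gt.
- move=> _ [x ->]; rewrite n1E// n2E//.
  have [x0|x0] := ltP x 0.
    have -> : `]x, +oo[ `&` D = D.
      apply/setIidr => z; rewrite /D/= !in_itv/= !andbT; exact: lt_le_trans.
    have := lap 0.
    rewrite (_ : (fun t => (expR (- (0%:R * t)))%:E) = cst 1%E); last first.
      by apply/funext => t; rewrite mul0r oppr0 expR0.
    by rewrite !integral_cst// !mul1e.
  have := ray (expR (- x)).
  have -> : D `&` [set t | expR (- t) < expR (- x)]%R = `]x, +oo[ `&` D.
    rewrite setIC; congr (_ `&` _); apply/seteqP; split => z /=;
    by rewrite in_itv/= ltr_expR ltrN2 andbT.
  by apply; rewrite expR_gt0/= -expR0 ler_expR oppr_le0.
- by move=> k; exact: fin_n1.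
Qed.
End laplace.

Section mfinite.
Local Open Scope ereal_scope.
Context d (T : measurableType d) (R : realType) (m : {measure set T -> \bar R}).

(** A copy of [m] that carries its finiteness proof, so that product measures and Tonelli's theorem
    apply to measures whose finiteness is only known from a hypothesis. *)
Definition mfinite (fm : m setT < +oo) : set T -> \bar R := m.

Hypothesis fm : m setT < +oo.

HB.instance Definition _ := isMeasure.Build _ _ _ (mfinite fm)
  (measure0 m) (@measure_ge0 _ _ _ m) (@measure_semi_sigma_additive _ _ _ m).

Let mfinite_fin : fin_num_fun (mfinite fm).
Proof.
move=> A mA; rewrite ge0_fin_numE; last exact: (measure_ge0 m).
by apply: le_lt_trans fm; apply: le_measure; rewrite ?inE.
Qed.

HB.instance Definition _ := Measure_isFinite.Build _ _ _ (mfinite fm) mfinite_fin.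
End mfinite.

(** * Test functions and the Levy exponent *)

(** The linear bound makes the sum over a summable sequence and the Levy exponent finite. It also
    forces [f 0 = 0], so that a removed point can be replaced by 0 without reindexing. The class is
    stable under sums and nonnegative multiples and contains the absolute value, which measures the
    total sum. *)
Definition testfun (R : realType) (f : R -> R) : Prop :=
  [/\ measurable_fun setT f, forall x, 0 <= f x &
      exists2 c, 0 <= c & forall x, 0 <= x -> f x <= c * x].

Section testfun.
Context (R : realType).
Implicit Types f g : R -> R.

Lemma testfunD f g : testfun f -> testfun g -> testfun (fun x => f x + g x).
Proof.
move=> [mf f0 [c c0 fc]] [mg g0 [e e0 ge]]; split.
- exact: measurable_funD.
- by move=> x; rewrite addr_ge0.
- exists (c + e); first by rewrite addr_ge0.
  by move=> x x0; rewrite mulrDl lerD ?fc ?ge.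
Qed.

Lemma testfunZ (k : R) f : 0 <= k -> testfun f -> testfun (fun x => k * f x).
Proof.
move=> k0 [mf f0 [c c0 fc]]; split.
- exact: measurable_funM.
- by move=> x; rewrite mulr_ge0.
- exists (k * c); first by rewrite mulr_ge0.
  by move=> x x0; rewrite -mulrA ler_wpM2l ?fc.
Qed.

Lemma testfun_norm : testfun (fun x : R => `|x|).
Proof.
split.
- exact: normr_measurable.
- by [].
- by exists 1 => // x x0; rewrite mul1r ger0_norm.
Qed.

Lemma testfun_ge0 f x : testfun f -> 0 <= f x. Proof. by case. Qed.

Lemma testfun0 f : testfun f -> f 0 = 0.
Proof.
by move=> [_ f0 [c _ /(_ 0 (lexx _))]]; rewrite mulr0 => h; apply/eqP; rewrite eq_le h f0.
Qed.
End testfun.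

(* 0 when the series diverges. *)
HB.lock Definition psum (R : realType) (T : Type) (y : nat -> T -> R) (f : R -> R)
    (w : T) : R :=
  fine (\sum_(0 <= j <oo) (f (y j w))%:E)%E.

Section point_sums.
Context (R : realType) (T : Type) (y : nat -> T -> R).
Hypothesis y0 : forall j w, 0 <= y j w.

Definition summable_at (w : T) := (\sum_(0 <= j <oo) (y j w)%:E < +oo)%E.

Lemma psumE f w : testfun f -> summable_at w ->
  ((psum y f w)%:E = \sum_(0 <= j <oo) (f (y j w))%:E)%E.
Proof.
move=> [mf f0 [c c0 fc]] sw; rewrite psum.unlock fineK// ge0_fin_numE; last first.
  by apply: nneseries_ge0 => j _ _; rewrite lee_fin.
apply: le_lt_trans (_ : c%:E * \sum_(0 <= j <oo) (y j w)%:E < +oo)%E.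
  rewrite -nneseriesZl//; last by move=> j _; rewrite lee_fin.
  apply: lee_nneseries => [j _ _|j _]; first by rewrite lee_fin.
  by rewrite -EFinM lee_fin fc.
rewrite lte_mul_pinfty ?lee_fin//.
Qed.

Lemma psum_ge0 f w : (forall x, 0 <= f x) -> 0 <= psum y f w.
Proof.
by move=> f0; rewrite psum.unlock; apply: fine_ge0; apply: nneseries_ge0 => j _ _; rewrite lee_fin.
Qed.

Lemma psumD f g w : testfun f -> testfun g -> summable_at w ->
  psum y (fun x => f x + g x) w = psum y f w + psum y g w.
Proof.
move=> tf tg sw; apply: EFin_inj; rewrite EFinD !psumE//; last exact: testfunD.
rewrite -nneseriesD//; by move=> j _; rewrite lee_fin testfun_ge0.
Qed.

Lemma psumZ k f w : 0 <= k -> testfun f -> summable_at w ->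
  psum y (fun x => k * f x) w = k * psum y f w.
Proof.
move=> k0 tf sw; apply: EFin_inj; rewrite EFinM !psumE//; last exact: testfunZ.
by rewrite -nneseriesZl// => j _; rewrite lee_fin testfun_ge0.
Qed.

Lemma psum_ge f w j : testfun f -> summable_at w -> f (y j w) <= psum y f w.
Proof.
move=> tf sw; rewrite -lee_fin psumE//.
apply: le_trans (nneseries_lim_ge j.+1 _); last first.
  by move=> k _ _; rewrite lee_fin testfun_ge0.
rewrite big_nat_recr//= leeDr// sume_ge0// => k _.
by rewrite lee_fin testfun_ge0.
Qed.

End point_sums.

Section measurable_psum.
Context (R : realType) d (T : measurableType d) (y : nat -> T -> R).
Hypothesis my : forall j, measurable_fun setT (y j).

Lemma measurable_psum (f : R -> R) : measurable_fun setT f -> (forall x, 0 <= f x) ->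
  measurable_fun setT (psum y f).
Proof.
move=> mf f0; rewrite psum.unlock.
apply: (@measurableT_comp _ _ _ _ _ _ (@fine R)) => //.
apply: ge0_emeasurable_sum => [k w _ _|k _]; first by rewrite lee_fin.
by apply/measurable_EFinP; exact: (measurableT_comp mf (my k)).
Qed.
End measurable_psum.

Lemma measurable_expN d (T : measurableType d) (R : realType) (f : T -> R) :
  measurable_fun setT f -> measurable_fun setT (fun x => expR (- f x)).
Proof.
by move=> mf; apply: measurableT_comp; [exact: measurable_expR|exact: measurable_funN].
Qed.

(** Convexity of s^(-q) bounds its increment by the slopes at the two ends. In logarithms this is
    e/(a+e) <= ln((a+e)/a) <= e/a combined with e^x >= 1 + x. These explicit bounds take the place
    of derivatives wherever (1 + psi)^(-q) is expanded. *)
Lemma powRN_tangent (R : realType) (a e q : R) : 0 < a -> 0 <= e -> 0 <= q ->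
  q * e * (a + e) `^ (- q - 1) <= a `^ (- q) - (a + e) `^ (- q) <=
  q * e * a `^ (- q - 1).
Proof.
move=> a0 e0 q0.
have ae : 0 < a + e by rewrite ltr_wpDr.
have E b : 0 < b -> b `^ (- q - 1) = b `^ (- q) / b.
  move=> b0; rewrite powRD; last by rewrite (gt_eqF b0) implybT.
  by rewrite powR_inv1// ltW.
rewrite !E//.
pose l := ln ((a + e) / a).
have lE : ln (a + e) = l + ln a by rewrite /l ln_div ?posrE// subrK.
have l1 : l <= e / a.
  have := @le_ln1Dx R (e / a); rewrite /l mulrDl divff ?gt_eqF//; apply.
  by rewrite (lt_le_trans (ltrN10 _))// divr_ge0// ltW.
have l2 : e / (a + e) <= l.
  have := @le_ln1Dx R (- (e / (a + e))).
  have -> : 1 + - (e / (a + e)) = ((a + e) / a)^-1 by field; rewrite !gt_eqF.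
  rewrite lnV ?posrE ?divr_gt0// -/l lerN2; apply.
  by rewrite ltrN2 ltr_pdivrMr// mul1r ltrDr.
have P : (a + e) `^ (- q) = a `^ (- q) * expR (- (q * l)).
  by rewrite /powR (gt_eqF ae) (gt_eqF a0) lE -expRD; congr expR; ring.
have P' : a `^ (- q) = (a + e) `^ (- q) * expR (q * l).
  by rewrite P -mulrA -expRD addNr expR0 mulr1.
apply/andP; split.
  have -> : a `^ (- q) - (a + e) `^ (- q) = (a + e) `^ (- q) * (expR (q * l) - 1).
    by rewrite mulrBr mulr1 -P'.
  rewrite [leLHS](_ : _ = (a + e) `^ (- q) * (q * (e / (a + e)))); last by ring.
  rewrite ler_wpM2l ?powR_ge0// lerBrDl (le_trans _ (expR_ge1Dx _))// lerD2l.
  by rewrite ler_wpM2l.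
rewrite P -{1}[a `^ (- q)]mulr1 -mulrBr.
rewrite [leRHS](_ : _ = a `^ (- q) * (q * (e / a))); last by ring.
rewrite ler_wpM2l ?powR_ge0// lerBlDl -lerBlDr (le_trans _ (expR_ge1Dx _))// lerD2l lerN2.
by rewrite ler_wpM2l.
Qed.

HB.lock Definition levy_exponent (R : realType) (rho f : R -> R) : R :=
  fine (\int[lebesgue_measure]_(x in `]0%R, +oo[) ((1 - expR (- f x)) * rho x)%:E)%E.

Section exponent.
Context (R : realType) (rho : R -> R).
Local Notation mu := (@lebesgue_measure R).
Hypotheses (mrho : measurable_fun setT rho) (rho0 : forall x, 0 <= rho x).
Hypothesis levy : (\int[mu]_(x in `]0%R, +oo[) (Num.min x 1 * rho x)%:E < +oo)%E.
Let P : set R := `]0, +oo[%classic.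
Let mP : measurable P. Proof. exact: measurable_itv. Qed.

Lemma integral_lty_levy (g : R -> R) (c : R) : measurable_fun setT g ->
  (forall x, 0 < x -> 0 <= g x) -> 0 <= c -> (forall x, 0 < x -> g x <= c * Num.min x 1) ->
  (\int[mu]_(x in `]0%R, +oo[) (g x * rho x)%:E < +oo)%E.
Proof.
move=> mg g0 c0 gc.
apply: (@le_lt_trans _ _ (\int[mu]_(x in P) (c%:E * (Num.min x 1 * rho x)%:E))%E).
  have mm : measurable_fun setT (fun x : R => Num.min x 1 * rho x).
    by apply: measurable_funM => //; exact: measurable_minr.
  apply: ge0_le_integral => //.
  - move=> x; rewrite /P/= in_itv/= andbT => x0; by rewrite lee_fin mulr_ge0 ?g0.
  - by apply/measurable_EFinP/measurable_funTS; exact: measurable_funM.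
  - by apply: measurable_funTS; apply: emeasurable_funM => //; exact/measurable_EFinP.
  - move=> x; rewrite /P/= in_itv/= andbT => x0; rewrite -EFinM lee_fin mulrA.
    by rewrite ler_wpM2r ?gc.
rewrite ge0_integralZl//; first by rewrite lte_mul_pinfty ?lee_fin.
- apply/measurable_EFinP/measurable_funTS/measurable_funM => //.
  exact: measurable_minr.
- move=> x; rewrite /P/= in_itv/= andbT => x0.
  by rewrite lee_fin mulr_ge0// le_min ler01 (ltW x0).
Qed.

Lemma onem_expN_bound (x z c : R) : 0 < x -> 0 <= c -> z <= c * x -> 0 <= z ->
  1 - expR (- z) <= (1 + c) * Num.min x 1.
Proof.
move=> x0 c0 zc z0.
have h1 : 1 - expR (- z) <= 1 by rewrite gerBl expR_ge0.
have h2 : 1 - expR (- z) <= z by have := expR_ge1Dx (- z); lra.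
rewrite /Num.min; case: ifPn => [x1|]; last by rewrite -leNgt => x1; lra.
by rewrite (le_trans h2)// (le_trans zc)// ler_wpM2r ?lerDr// ltW.
Qed.

Lemma levy_exponentE f : testfun f ->
  (\int[mu]_(x in `]0%R, +oo[) ((1 - expR (- f x)) * rho x)%:E =
   (levy_exponent rho f)%:E)%E.
Proof.
move=> [mf f0 [c c0 fc]]; rewrite levy_exponent.unlock fineK// ge0_fin_numE; last first.
  by apply: integral_ge0 => x _; rewrite lee_fin mulr_ge0// subr_ge0 -expR0 ler_expR oppr_le0.
apply: (@integral_lty_levy _ (1 + c)).
- by apply: measurable_funB => //; exact: measurable_expN.
- by move=> x _; rewrite subr_ge0 -expR0 ler_expR oppr_le0.
- by rewrite addr_ge0.
- by move=> x x0; apply: onem_expN_bound => //; apply: fc; exact: ltW.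
Qed.

Lemma levy_exponent_ge0 f : testfun f -> 0 <= levy_exponent rho f.
Proof.
move=> [mf f0 _]; rewrite levy_exponent.unlock.
apply: fine_ge0; apply: integral_ge0 => x _.
by rewrite lee_fin mulr_ge0// subr_ge0 -expR0 ler_expR oppr_le0.
Qed.

(** Integrates 1 - e^(-f-g) = (1 - e^(-f)) + (1 - e^(-g)) e^(-f); it provides the increment of the
    exponent for the differentiation in [palm_derivative]. *)
Lemma levy_exponentD f g : testfun f -> testfun g ->
  ((levy_exponent rho (fun x => f x + g x))%:E = (levy_exponent rho f)%:E +
    \int[mu]_(x in `]0%R, +oo[) ((1 - expR (- g x)) * expR (- f x) * rho x)%:E)%E.
Proof.
move=> tf tg; have tfg := testfunD tf tg.
have [mf f0 _] := tf; have [mg g0 _] := tg.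
rewrite -(levy_exponentE tfg) -(levy_exponentE tf).
rewrite -(@ge0_integralD _ _ _ mu _ mP)//.
- by apply: eq_integral => x _; rewrite -EFinD; congr EFin; rewrite opprD expRD; ring.
- by move=> x _; rewrite lee_fin mulr_ge0// subr_ge0 -expR0 ler_expR oppr_le0.
- apply/measurable_EFinP/measurable_funTS/measurable_funM => //.
  by apply: measurable_funB => //; exact: measurable_expN.
- move=> x _; rewrite lee_fin mulr_ge0// mulr_ge0 ?expR_ge0//.
  by rewrite subr_ge0 -expR0 ler_expR oppr_le0.
- apply/measurable_EFinP/measurable_funTS/measurable_funM => //.
  apply: measurable_funM; last exact: measurable_expN.
  by apply: measurable_funB => //; exact: measurable_expN.
Qed.
End exponent.

Lemma cvg_integral_nd d (T : measurableType d) (R : realType)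
    (mu : {measure set T -> \bar R}) (D : set T) (G : nat -> T -> \bar R) (F : T -> \bar R) :
  measurable D -> (forall m, measurable_fun setT (G m)) ->
  (forall m x, D x -> (0 <= G m x)%E) ->
  (forall x, D x -> {homo G ^~ x : m n / (m <= n)%N >-> (m <= n)%E}) ->
  (forall x, D x -> G m x @[m --> \oo] --> F x) ->
  (\int[mu]_(x in D) G m x)%E @[m --> \oo] --> (\int[mu]_(x in D) F x)%E.
Proof.
move=> mD mG G0 ndG GF.
have -> : (\int[mu]_(x in D) F x = \int[mu]_(x in D) limn (G ^~ x))%E.
  by apply: eq_integral => x /set_mem Dx; apply/esym/cvg_lim => //; exact: GF.
by apply: cvg_monotone_convergence => // m; exact: measurable_funTS.
Qed.

(* Increases to [s] as [m] tends to infinity. *)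
HB.lock Definition dyadic_quotient (R : realType) (m : nat) (s : R) : R :=
  2 ^+ m * (1 - expR (- (2 ^- m * s))).

Section dyadic_quotient.
Context (R : realType).
Implicit Types s : R.

Let e_gt0 m : 0 < 2 ^- m :> R. Proof. by rewrite invr_gt0 exprn_gt0. Qed.

Lemma dyadic_quotient_ge0 m s : 0 <= s -> 0 <= dyadic_quotient m s.
Proof.
move=> s0; rewrite dyadic_quotient.unlock mulr_ge0 ?exprn_ge0// subr_ge0 -expR0 ler_expR oppr_le0.
by rewrite mulr_ge0// ltW.
Qed.

Lemma dyadic_quotient_le m s : dyadic_quotient m s <= s.
Proof.
rewrite dyadic_quotient.unlock mulrC -ler_pdivlMr ?exprn_gt0//.
by have := expR_ge1Dx (- (2 ^- m * s)); lra.
Qed.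

Lemma dyadic_quotient_nd s : 0 <= s ->
  {homo (@dyadic_quotient R)^~ s : m n / (m <= n)%N >-> m <= n}.
Proof.
move=> s0; apply/nondecreasing_seqP => m; rewrite dyadic_quotient.unlock.
(* Halving the step replaces 1 - u^2 by 2 (1 - u), and the difference is (1 - u)^2. *)
set u := expR (- (2 ^- m.+1 * s)).
have -> : expR (- (2 ^- m * s)) = u * u.
  rewrite -expRD; congr expR; rewrite exprS invfM; field.
  by rewrite expf_neq0.
rewrite exprS -mulrA mulrCA ler_wpM2l ?exprn_ge0//.
have : 0 <= (1 - u) ^+ 2 by rewrite sqr_ge0.
rewrite expr2; lra.
Qed.

Lemma cvg_dyadic_quotient s : 0 <= s -> dyadic_quotient m s @[m --> \oo] --> s.
Proof.
move=> s0.
have c0 : 2 ^- m * s @[m --> \oo] --> (0 : R).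
  rewrite -(mul0r s); apply: cvgMl.
  under eq_fun do rewrite -exprVn.
  by apply: cvg_expr; rewrite ger0_norm// invf_lt1// ltr1n.
have c1 : s * expR (- (2 ^- m * s)) @[m --> \oo] --> s.
  have c2 : expR (- (2 ^- m * s)) @[m --> \oo] --> expR (- 0 : R).
    by apply: continuous_cvg; [exact: continuous_expR|exact: cvgN].
  by rewrite oppr0 expR0 in c2; rewrite -[X in _ --> X]mulr1; apply: cvgMr.
apply: (squeeze_cvgr _ c1 (cvg_cst s)); apply: nearW => m.
rewrite dyadic_quotient_le andbT dyadic_quotient.unlock.
have := expR_ge1Dx (2 ^- m * s); set z := 2 ^- m * s => h.
have -> : s = 2 ^+ m * z by rewrite /z mulrA mulfV ?mul1r// expf_neq0.
rewrite -mulrA ler_wpM2l ?exprn_ge0// lerBrDr.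
have -> : z * expR (- z) + expR (- z) = (1 + z) * expR (- z) by ring.
by rewrite expRN ler_pdivrMr ?expR_gt0// mul1r.
Qed.

Lemma measurable_dyadic_quotient d (T : measurableType d) m (f : T -> R) :
  measurable_fun setT f -> measurable_fun setT (fun x => dyadic_quotient m (f x)).
Proof.
move=> mf; rewrite dyadic_quotient.unlock.
apply: measurable_funM => //; apply: measurable_funB => //.
by apply: measurable_expN; exact: measurable_funM.
Qed.

End dyadic_quotient.

(** * The Palm formula *)

Section palm.
Context (R : realType) (rho : R -> R).
Local Notation mu := (@lebesgue_measure R).
Hypotheses (mrho : measurable_fun setT rho) (rho0 : forall x, 0 <= rho x).
Hypothesis levy : (\int[mu]_(x in `]0%R, +oo[) (Num.min x 1 * rho x)%:E < +oo)%E.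
Context d (Omega : measurableType d) (P : {measure set Omega -> \bar R}).
Variables (Z : Omega -> R) (y : nat -> Omega -> R) (C q : R).
Hypotheses (Z0 : forall w, 0 <= Z w) (mZ : measurable_fun setT Z).
Hypotheses (y0 : forall j w, 0 <= y j w) (my : forall j, measurable_fun setT (y j)).
Hypothesis sumy : forall w, Z w != 0 -> summable_at y w.
Hypotheses (C0 : 0 <= C) (q0 : 0 <= q).
Local Notation psi := (levy_exponent rho).
Hypothesis laplace_functional : forall f, testfun f ->
  (\int[P]_w (Z w * expR (- psum y f w))%:E = (C * (1 + psi f) `^ (- q))%:E)%E.

Let mexpsum f : testfun f -> measurable_fun setT (fun w => expR (- psum y f w)).
Proof. by move=> [mf f0 _]; apply: measurable_expN; exact: measurable_psum. Qed.

(** The Laplace functional is differentiated at [f] in the direction [g] along the steps 2^(-m). On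
    the process side the difference quotient increases with m, so monotone convergence applies
    without any moment assumption; on the analytic side the chain rule is a squeeze. *)
Lemma palm_derivative (f g : R -> R) (b : R) : testfun f -> testfun g ->
  0 <= b -> (forall x, g x <= b) ->
  (\int[P]_w (Z w * expR (- psum y f w) * psum y g w)%:E =
   (C * q * (1 + psi f) `^ (- q - 1))%:E *
   \int[mu]_(x in `]0%R, +oo[) (g x * expR (- f x) * rho x)%:E)%E.
Proof.
move=> tf tg b0 gb.
have [mf f0 _] := tf; have [mg g0 [c c0 gc]] := tg.
have e0 m : 0 <= 2 ^- m :> R by rewrite invr_ge0 exprn_ge0.
have teg m := testfunZ (e0 m) tg.
have tfg m := testfunD tf (teg m).
have mP : measurable (`]0, +oo[%classic : set R) by exact: measurable_itv.
pose I := (\int[mu]_(x in `]0%R, +oo[) (g x * expR (- f x) * rho x)%:E)%E.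
have I0 : (0 <= I)%E.
  by apply: integral_ge0 => x _; rewrite lee_fin !mulr_ge0 ?expR_ge0.
(* The linear bound controls [g] near 0 and the bound [b] controls it at infinity: together they
   give [g x <= (c + b) * min x 1]. *)
have Ifin : (I < +oo)%E.
  apply: (@integral_lty_levy _ rho mrho rho0 levy _ (c + b)).
  - by apply: measurable_funM => //; exact: measurable_expN.
  - by move=> x _; rewrite mulr_ge0 ?expR_ge0.
  - by rewrite addr_ge0.
  - move=> x x0; apply: (@le_trans _ _ (g x)).
      by rewrite ler_piMr// -expR0 ler_expR oppr_le0.
    rewrite /Num.min; case: ifPn => _.
      by rewrite (le_trans (gc _ (ltW x0)))// ler_wpM2r ?lerDl// ltW.
    by rewrite mulr1 (le_trans (gb x))// lerDr.
have IE : I = (fine I)%:E by rewrite fineK// ge0_fin_numE.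
pose delta m := psi (fun x => f x + 2 ^- m * g x) - psi f.
have deltaE m : (delta m)%:E =
    (\int[mu]_(x in `]0%R, +oo[) ((1 - expR (- (2 ^- m * g x))) * expR (- f x) * rho x)%:E)%E.
  have := levy_exponentD mrho rho0 levy tf (teg m).
  have sub_eq (u v : R) (z : \bar R) : (u%:E = v%:E + z -> (u - v)%:E = z)%E.
    by move=> e; rewrite EFinB e addeAC subee// add0e.
  exact: sub_eq.
have pdE m : psi (fun x => f x + 2 ^- m * g x) = psi f + delta m.
  have subK (u v : R) : u = v + (u - v) by rewrite addrC subrK.
  exact: subK.
have delta_ge0 m : 0 <= delta m.
  rewrite -lee_fin deltaE; apply: integral_ge0 => x _.
  rewrite lee_fin !mulr_ge0 ?expR_ge0// subr_ge0 -expR0 ler_expR oppr_le0.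
  by rewrite mulr_ge0.
have cI : 2 ^+ m * delta m @[m --> \oo] --> fine I.
  pose G m x := (dyadic_quotient m (g x) * expR (- f x) * rho x)%:E.
  have mG m : measurable_fun setT (G m).
    apply/measurable_EFinP; apply: measurable_funM => //; apply: measurable_funM.
      exact: measurable_dyadic_quotient.
    exact: measurable_expN.
  have G0 m x : (0 <= G m x)%E.
    rewrite lee_fin; apply: mulr_ge0 => //; apply: mulr_ge0; last exact: expR_ge0.
    exact: dyadic_quotient_ge0.
  have : (\int[mu]_(x in `]0%R, +oo[) G m x)%E @[m --> \oo] --> (fine I)%:E.
    rewrite -IE; apply: cvg_integral_nd => //.
      move=> x _ m n mn; rewrite lee_fin; apply: ler_wpM2r => //.
      by apply: ler_wpM2r; [exact: expR_ge0|exact: dyadic_quotient_nd].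
    move=> x _; apply: cvg_EFin; first exact: nearW.
    by apply: cvgMl; apply: cvgMl; exact: cvg_dyadic_quotient.
  move=> /fine_cvg; apply: cvg_trans; apply: near_eq_cvg; apply: nearW => m /=.
  rewrite -[RHS]/(fine (2 ^+ m * delta m)%:E); congr fine.
  rewrite EFinM deltaE -ge0_integralZl//.
  - by apply: eq_integral => x _; rewrite -EFinM /G dyadic_quotient.unlock !mulrA.
  - apply/measurable_EFinP/measurable_funTS/measurable_funM => //.
    apply: measurable_funM; last exact: measurable_expN.
    apply: measurable_funB => //; apply: measurable_expN; exact: measurable_funM.
  - move=> x _; rewrite lee_fin !mulr_ge0 ?expR_ge0//.
    by rewrite subr_ge0 -expR0 ler_expR oppr_le0 mulr_ge0.
have cd : delta m @[m --> \oo] --> (0 : R).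
  rewrite -(mul0r (fine I)).
  have -> : delta = (fun m => 2 ^- m * (2 ^+ m * delta m)).
    by apply/funext => m; rewrite mulrA mulVf ?mul1r// expf_neq0.
  apply: cvgM => //.
  under eq_fun do rewrite -exprVn.
  by apply: cvg_expr; rewrite ger0_norm// invf_lt1// ltr1n.
pose a := 1 + psi f.
have a0 : 0 < a by rewrite ltr_pwDl ?levy_exponent_ge0.
pose r m := 2 ^+ m * (C * (a `^ (- q) - (a + delta m) `^ (- q))).
(* The upper bound is the tangent at [a]. The lower bound involves the slope at [a + delta m], which
   is estimated from below by the tangent inequality for the exponent [q + 1]; the error is of order
   [delta m] and vanishes. *)
have cr : r m @[m --> \oo] --> C * q * a `^ (- q - 1) * fine I.
  pose k := C * q.
  have c2 : k * a `^ (- q - 1) * (2 ^+ m * delta m) @[m --> \oo] -->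
      k * a `^ (- q - 1) * fine I by exact: cvgMr.
  have c1 : k * (a `^ (- q - 1) - (q + 1) * delta m * a `^ (- (q + 1) - 1)) *
      (2 ^+ m * delta m) @[m --> \oo] --> k * a `^ (- q - 1) * fine I.
    apply: cvgM => //; apply: cvgMr; rewrite -[X in _ --> X]subr0; apply: cvgB.
      exact: cvg_cst.
    rewrite -(mul0r (a `^ (- (q + 1) - 1))); apply: cvgMl.
    by rewrite -(mulr0 (q + 1)); apply: cvgMr.
  apply: (squeeze_cvgr _ c1 c2); apply: nearW => m.
  have /andP[t1 t2] := powRN_tangent a0 (delta_ge0 m) q0.
  have q10 : 0 <= q + 1 by rewrite addr_ge0.
  have /andP[_ t3] := powRN_tangent a0 (delta_ge0 m) q10.
  have qE : - (q + 1) = - q - 1 by rewrite opprD.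
  rewrite qE in t3 *.
  have e2 : 0 <= 2 ^+ m :> R by rewrite exprn_ge0.
  have k0 : 0 <= C * 2 ^+ m * q * delta m by rewrite !mulr_ge0.
  rewrite /r /k; apply/andP; split.
    apply: (@le_trans _ _ (C * 2 ^+ m * (q * delta m * (a + delta m) `^ (- q - 1)))).
      rewrite [leLHS](_ : _ = C * 2 ^+ m * q * delta m *
        (a `^ (- q - 1) - (q + 1) * delta m * a `^ (- q - 1 - 1))); last by ring.
      rewrite [leRHS](_ : _ = C * 2 ^+ m * q * delta m * (a + delta m) `^ (- q - 1)); last by ring.
      by rewrite ler_wpM2l// lerBlDr -lerBlDl.
    rewrite [leRHS](_ : _ = C * 2 ^+ m * (a `^ (- q) - (a + delta m) `^ (- q))); last by ring.
    by rewrite ler_wpM2l// mulr_ge0.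
  rewrite [leLHS](_ : _ = C * 2 ^+ m * (a `^ (- q) - (a + delta m) `^ (- q))); last by ring.
  rewrite [leRHS](_ : _ = C * 2 ^+ m * (q * delta m * a `^ (- q - 1))); last by ring.
  by rewrite ler_wpM2l// mulr_ge0.
rewrite -/I IE -EFinM -/a.
have c1 : (\int[P]_w (Z w * expR (- psum y f w) * dyadic_quotient m (psum y g w))%:E)%E
    @[m --> \oo] --> (\int[P]_w (Z w * expR (- psum y f w) * psum y g w)%:E)%E.
  pose A m w := (Z w * expR (- psum y f w) * dyadic_quotient m (psum y g w))%:E.
  have mA m : measurable_fun setT (A m).
    apply/measurable_EFinP; apply: measurable_funM.
      by apply: measurable_funM => //; exact: mexpsum.
    by apply: measurable_dyadic_quotient; exact: measurable_psum.
  have A0 m w : (0 <= A m w)%E.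
    rewrite lee_fin; apply: mulr_ge0; first by rewrite mulr_ge0 ?expR_ge0.
    by apply: dyadic_quotient_ge0; exact: psum_ge0.
  apply: (@cvg_integral_nd _ _ _ P setT A) => //.
    move=> w _ m n mn; rewrite lee_fin; apply: ler_wpM2l; first by rewrite mulr_ge0 ?expR_ge0.
    by apply: dyadic_quotient_nd => //; exact: psum_ge0.
  move=> w _; apply: cvg_EFin; first exact: nearW.
  by apply: cvgMr; apply: cvg_dyadic_quotient; exact: psum_ge0.
apply: (cvg_unique _ c1) => //.
have -> : (fun m => \int[P]_w (Z w * expR (- psum y f w) * dyadic_quotient m (psum y g w))%:E)%E
   = (fun m => (r m)%:E).
  apply/funext => m.
  have e2 : 0 <= 2 ^+ m :> R by rewrite exprn_ge0.
  have mZf h : testfun h -> measurable_fun setT (fun w => (Z w * expR (- psum y h w))%:E).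
    by move=> th; apply/measurable_EFinP; apply: measurable_funM => //; exact: mexpsum.
  have E2 h : testfun h ->
      ((2 ^+ m)%:E * \int[P]_w (Z w * expR (- psum y h w))%:E =
       \int[P]_w ((2 ^+ m)%:E * (Z w * expR (- psum y h w))%:E))%E.
    move=> th; rewrite ge0_integralZl//.
    - exact: mZf.
    - by move=> w _; rewrite lee_fin mulr_ge0 ?expR_ge0.
  have S : (\int[P]_w (Z w * expR (- psum y f w) * dyadic_quotient m (psum y g w))%:E +
      (2 ^+ m)%:E * \int[P]_w (Z w * expR (- psum y (fun x => f x + 2 ^- m * g x) w))%:E =
      (2 ^+ m)%:E * \int[P]_w (Z w * expR (- psum y f w))%:E)%E.
    rewrite (E2 _ (tfg m)) (E2 _ tf) -ge0_integralD//.
    - apply: eq_integral => w _; rewrite -!EFinM -EFinD; congr EFin.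
      have [->|/sumy sw] := eqVneq (Z w) 0; first by rewrite !mul0r !mulr0 addr0.
      rewrite psumD// psumZ// opprD expRD dyadic_quotient.unlock; ring.
    - move=> w _; rewrite lee_fin; apply: mulr_ge0; first by rewrite mulr_ge0 ?expR_ge0.
      by apply: dyadic_quotient_ge0; exact: psum_ge0.
    - apply/measurable_EFinP; apply: measurable_funM.
        by apply: measurable_funM => //; exact: mexpsum.
      by apply: measurable_dyadic_quotient; exact: measurable_psum.
    - by move=> w _; rewrite -EFinM lee_fin !mulr_ge0 ?expR_ge0.
    - by apply: emeasurable_funM => //; exact: mZf.
  move: S; rewrite !laplace_functional// pdE addrA -/a -!EFinM => S.
  have add_eq (X : \bar R) (u v : R) : (X + u%:E = v%:E -> X = (v - u)%:E)%E.
    by move=> e; rewrite EFinB -e addeK.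
  by rewrite (add_eq _ _ _ S) /r mulrBr mulrBr.
by apply: cvg_EFin => //; exact: nearW.
Qed.

Variables (f : R -> R).
Hypothesis tf : testfun f.

Let tot w := psum y (fun x => `|x|) w.
Let wgt j w := Z w * y j w * expR (- (psum y f w - f (y j w))).
Let pos j w := (y j w, tot w - y j w).

Let mf : measurable_fun setT f. Proof. by case: tf. Qed.
Let f0 x : 0 <= f x. Proof. by case: tf. Qed.
Let wgt0 j w : 0 <= wgt j w. Proof. by rewrite /wgt !mulr_ge0 ?expR_ge0. Qed.

Let mtot : measurable_fun setT tot.
Proof. by apply: measurable_psum => //; exact: normr_measurable. Qed.

Let mwgt j : measurable_fun setT (wgt j).
Proof.
apply: measurable_funM; first exact: measurable_funM.
apply: measurable_expN; apply: measurable_funB; first exact: measurable_psum.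
exact: measurableT_comp.
Qed.

Let mpos j : measurable_fun setT (pos j).
Proof. by apply: measurable_fun_pair => //; exact: measurable_funB. Qed.

(* The Campbell measure of the pairs (point, sum of the other points). *)
Let kappa := mseries (fun j => weighted_image P measurableT (wgt0 j) (mwgt j) (mpos j)) 0.

Let kappaE (F : R * R -> \bar R) : measurable_fun setT F -> (forall z, 0 <= F z)%E ->
  (\int[kappa]_z F z = \sum_(0 <= j <oo) \int[P]_w ((wgt j w)%:E * F (pos j w)))%E.
Proof.
move=> mF F0; rewrite ge0_integral_measure_series//.
by apply: eq_eseriesr => j _; rewrite ge0_integral_weighted_image.
Qed.

Let kappa_int (F : R * R -> \bar R) : measurable_fun setT F -> (forall z, 0 <= F z)%E ->
  (\int[kappa]_z F z = \int[P]_w \sum_(0 <= j <oo) ((wgt j w)%:E * F (pos j w)))%E.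
Proof.
move=> mF F0; rewrite kappaE// integral_nneseries// => [j|j w _].
  apply: emeasurable_funM; first exact/measurable_EFinP.
  exact: measurableT_comp mF (mpos j).
by rewrite mule_ge0// lee_fin.
Qed.

Let tnorm k : testfun (fun x : R => k%:R * `|x|).
Proof. by apply: testfunZ => //; exact: testfun_norm. Qed.

Let size_mass (D : set R) := (\int[mu]_(x in `]0%R, +oo[) (\1_D x * `|x| * rho x)%:E)%E.

(** The set [D] of values of the removed point enters only through its size-biased mass
    [size_mass D]. This factorisation is what makes the point and the sum of the others separate. *)
Let kappa_laplace (D : set R) (b : R) (k : nat) : measurable D ->
  D `<=` `]0, b] -> 0 <= b ->
  (\int[kappa]_z (\1_D z.1 * \1_(`[0, +oo[) z.2 * expR (- (k%:R * z.2)))%:E =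
   (C * q * (1 + psi (fun x => (f x + k%:R * `|x|)%R)) `^ (- q - 1))%:E * size_mass D)%E.
Proof.
move=> mD Db b0.
have [c c0 fc] : exists2 c, 0 <= c & forall x, 0 <= x -> f x <= c * x by case: tf.
(* The exponential cancels the contribution of the removed point to the sum of [f + k * norm],
   leaving the tilt by the other points and the transform of their sum. Boundedness of [D] keeps
   this [g] a bounded test function. *)
pose g x := \1_D x * (`|x| * expR (f x + k%:R * `|x|)).
have mg : measurable_fun setT g.
  apply: measurable_funM; first exact: measurable_indic.
  apply: measurable_funM; first exact: normr_measurable.
  apply: measurableT_comp; first exact: measurable_expR.
  apply: measurable_funD => //; apply: measurable_funM => //; exact: normr_measurable.
have g0 x : 0 <= g x by rewrite !mulr_ge0 ?expR_ge0.
pose e := expR (c * b + k%:R * b).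
have ge x : g x <= e * \1_D x * `|x|.
  rewrite /g indicE; case: (boolP (x \in D)) => [/set_mem /Db /=|_]; last by rewrite !(mul0r, mulr0).
  rewrite in_itv/= => /andP[x0 xb]; rewrite mul1r mulr1 mulrC ler_wpM2r//.
  rewrite ler_expR (ger0_norm (ltW x0)) lerD ?ler_wpM2l//.
  by rewrite (le_trans (fc _ (ltW x0)))// ler_wpM2l.
have tg : testfun g.
  split => //; exists e; first exact: expR_ge0.
  move=> x x0; apply: le_trans (ge x) _; rewrite (ger0_norm x0) ler_wpM2r//.
  by rewrite ler_piMr ?expR_ge0// indicE lern1 leq_b1.
have gb x : g x <= e * b.
  apply: le_trans (ge x) _; rewrite -mulrA ler_wpM2l ?expR_ge0// indicE.
  case: (boolP (x \in D)) => [/set_mem /Db /=|_]; last by rewrite mul0r.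
  by rewrite in_itv/= => /andP[x0 xb]; rewrite mul1r ger0_norm// ltW.
have := palm_derivative (testfunD tf (tnorm k)) tg (mulr_ge0 (expR_ge0 _) b0) gb.
have -> : (\int[mu]_(x in `]0%R, +oo[) (g x * expR (- (f x + k%:R * `|x|)) * rho x)%:E =
   size_mass D)%E.
  apply: eq_integral => x _; congr EFin.
  have E0 : expR (f x + k%:R * `|x|) != 0 by rewrite gt_eqF ?expR_gt0.
  by rewrite /g expRN; field.
move=> <-.
rewrite kappa_int.
- apply: eq_integral => w _.
  have [Zw|Zw] := eqVneq (Z w) 0.
    rewrite Zw !mul0r eseries0// => j _ _.
    by rewrite /wgt Zw !mul0r mul0e.
  have sw := sumy Zw.
  rewrite EFinM psumE// -nneseriesZl//; last by move=> j _; rewrite lee_fin.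
  apply: eq_eseriesr => j _; rewrite -!EFinM /wgt /pos/= /g; congr EFin.
  pose S := tot w; pose N := psum y f w.
  have -> : psum y (fun x => f x + k%:R * `|x|) w = N + k%:R * S.
    by rewrite psumD//; congr (_ + _); apply: psumZ => //; exact: testfun_norm.
  have yS : y j w <= S by have := psum_ge y0 j (@testfun_norm R) sw; rewrite ger0_norm.
  rewrite (ger0_norm (y0 _ _)) -/S -/N.
  have h : expR (- (N - f (y j w))) * expR (- (k%:R * (S - y j w))) =
      expR (- (N + k%:R * S)) * expR (f (y j w) + k%:R * y j w).
    by rewrite -!expRD; congr expR; ring.
  rewrite [\1_(`[0, +oo[) _]indicE mem_set ?mulr1; last first.
    by rewrite /= in_itv/= andbT subr_ge0.
  rewrite [LHS](_ : _ = Z w * y j w * \1_D (y j w) *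
    (expR (- (N - f (y j w))) * expR (- (k%:R * (S - y j w))))); last by ring.
  by rewrite h; ring.
- apply/measurable_EFinP; apply: measurable_funM.
    apply: measurable_funM.
      by apply: measurable_indic_comp.
    by apply: measurable_indic_comp => //; exact: measurable_itv.
  by apply: measurable_expN; exact: measurable_funM.
- by move=> z; rewrite lee_fin !mulr_ge0 ?expR_ge0.
Qed.

Let one0 (T : Type) (x : T) : 0 <= (fun=> 1 : R) x. Proof. exact: ler01. Qed.

Let mD1 (D : set R) : measurable D -> measurable (D `*` [set: R]).
Proof. by move=> mD; exact: measurableX. Qed.

Let section_measure (D : set R) (mD : measurable D) : {measure set R -> \bar R} :=
  weighted_image kappa (mD1 mD) (@one0 (R * R)) (@measurable_cst _ _ (R * R)%type R setT 1)
    (@measurable_snd _ _ R R).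

Let section_measureE (D : set R) (mD : measurable D) A : measurable A ->
  section_measure mD A = kappa (D `*` A).
Proof.
move=> mA; have E : D `*` [set: R] `&` snd @^-1` A = D `*` A.
  by apply/seteqP; split => [[u v] [[? _] ?]|[u v] [? ?]].
rewrite /section_measure /= /weighted_image E integral_cst ?mul1e//.
exact: measurableX.
Qed.

Let section_laplace (D : set R) (mD : measurable D) (b : R) (k : nat) :
  D `<=` `]0, b] -> 0 <= b ->
  (\int[section_measure mD]_(t in `[0%R, +oo[) (expR (- (k%:R * t)))%:E =
   (C * q * (1 + psi (fun x => (f x + k%:R * `|x|)%R)) `^ (- q - 1))%:E * size_mass D)%E.
Proof.
move=> Db b0; rewrite -(kappa_laplace k mD Db b0).
have mP0 : measurable (`[0, +oo[%classic : set R) by exact: measurable_itv.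
have me : measurable_fun setT (fun t : R => (expR (- (k%:R * t)))%:E).
  by apply/measurable_EFinP/measurable_expN; exact: measurable_funM.
rewrite integral_mkcond ge0_integral_weighted_image//.
- rewrite [LHS]integral_mkcond; apply: eq_integral => -[u v] _.
  rewrite !patchE !indicE /= in_setX in_setT andbT.
  case: (u \in D); last by rewrite !mul0r.
  by rewrite mul1e; case: ifP => _; rewrite !mul1r ?mul0r.
- exact: measurable_patch.
- by move=> t; rewrite patchE; case: ifP => //; rewrite lee_fin expR_ge0.
Qed.

Let size_mass_lty (D : set R) (b : R) : measurable D -> D `<=` `]0, b] -> 0 <= b ->
  (size_mass D < +oo)%E.
Proof.
move=> mD Db b0; apply: (@integral_lty_levy _ rho mrho rho0 levy _ (1 + b)).
- by apply: measurable_funM; [exact: measurable_indic|exact: normr_measurable].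
- by move=> x _; rewrite mulr_ge0.
- by rewrite addr_ge0.
- move=> x x0; rewrite indicE (ger0_norm (ltW x0)).
  have m0 : 0 <= Num.min x 1 by rewrite le_min ler01 ltW.
  case: (boolP (x \in D)) => [/set_mem /Db /=|_]; last by rewrite mul0r mulr_ge0// addr_ge0.
  rewrite in_itv/= => /andP[_ xb]; rewrite mul1r /Num.min; case: ifPn => [_|].
    by rewrite mulrDl mul1r lerDl mulr_ge0// ltW.
  by move=> _; rewrite mulr1 (le_trans xb)// lerDr.
Qed.


Hypothesis rho_gt0 : forall x, 0 < x -> 0 < rho x.

(** A reference set of finite positive size-biased mass. By uniqueness of Laplace transforms the
    section of [kappa] over any other bounded set is a multiple of the section over this one. *)
Let D0 : set R := `]0, 1]%classic.
Let mD0 : measurable D0. Proof. exact: measurable_itv. Qed.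

Let size_massE (D : set R) (b : R) : measurable D -> D `<=` `]0, b] -> 0 <= b ->
  size_mass D = (fine (size_mass D))%:E.
Proof.
move=> mD Db b0; rewrite fineK// ge0_fin_numE; first exact: (size_mass_lty mD Db b0).
by apply: integral_ge0 => x _; rewrite lee_fin !mulr_ge0.
Qed.

Let a0 := fine (size_mass D0).

Let a0_gt0 : 0 < a0.
Proof.
rewrite -lte_fin -(size_massE mD0 (@subset_refl _ _) ler01) /size_mass.
have mP : measurable (`]0, +oo[%classic : set R) by exact: measurable_itv.
rewrite (_ : (\int[mu]_(x in _) _)%E = (\int[mu]_(x in D0) (`|x| * rho x)%:E)%E); last first.
  rewrite integral_mkcond [RHS]integral_mkcond; apply: eq_integral => x _.
  rewrite !patchE indicE; have [xD|xD] := boolP (x \in D0).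
    rewrite mul1r ifT//; move/set_mem : xD => /=.
    by rewrite inE/= !in_itv/= andbT => /andP[].
  by rewrite !mul0r; case: ifP.
apply: integral_gt0 => //.
- by apply/measurable_EFinP/measurable_funTS/measurable_funM.
- move=> x; rewrite /D0/= in_itv/= => /andP[x0 _].
  by rewrite lte_fin mulr_gt0 ?rho_gt0// normr_gt0 gt_eqF.
- suff : (0 < lebesgue_measure D0)%E by [].
  by rewrite /D0 lebesgue_measure_itv/= lte_fin ltr01 oppr0 adde0 lte_fin ltr01.
Qed.

Let P0 : set R := `[0, +oo[%classic.
Let mP0 : measurable P0. Proof. exact: measurable_itv. Qed.

Let V k := C * q * (1 + psi (fun x => (f x + k%:R * `|x|)%R)) `^ (- q - 1).

Let section_lty (D : set R) (mD : measurable D) (b : R) : D `<=` `]0, b] -> 0 <= b ->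
  (section_measure mD P0 < +oo)%E.
Proof.
move=> Db b0; have := section_laplace mD 0 Db b0.
rewrite (_ : (fun t => (expR (- (0%:R * t)))%:E) = cst 1%E); last first.
  by apply/funext => t; rewrite mul0r oppr0 expR0.
rewrite integral_cst//= mul1e => ->.
by rewrite (size_massE mD Db b0) -EFinM ltry.
Qed.

Let section_prop (D : set R) (mD : measurable D) (b : R) (A : set R) :
  D `<=` `]0, b] -> 0 <= b -> measurable A ->
  (kappa (D `*` (A `&` P0)) = (fine (size_mass D) / a0)%:E * kappa (D0 `*` (A `&` P0)))%E.
Proof.
move=> Db b0 mA.
have mAP : measurable (A `&` P0) by exact: measurableI.
rewrite -!section_measureE//; apply: laplace_unique => //.
- by rewrite divr_ge0 ?(ltW a0_gt0)//; apply: fine_ge0; apply: integral_ge0 => x _; rewrite lee_fin !mulr_ge0.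
- exact: section_lty Db b0.
- exact: section_lty (@subset_refl _ _) ler01.
- move=> k; rewrite (section_laplace mD k Db b0) (section_laplace mD0 k (@subset_refl _ _) ler01).
  rewrite (size_massE mD Db b0) (size_massE mD0 (@subset_refl _ _) ler01) -/a0 -!EFinM; congr EFin => /=.
  have e (v s a : R) : a != 0 -> v * s = s / a * (v * a) by move=> ?; field.
  by apply: e; rewrite gt_eqF// a0_gt0.
Qed.

Let psi0E : psi (fun x => f x + 0%:R * `|x|) = psi f.
Proof. by congr (levy_exponent rho _); apply/funext => x; rewrite mul0r addr0. Qed.

Let ainv0 : 0 <= a0^-1. Proof. by rewrite invr_ge0 ltW// a0_gt0. Qed.

(** The tilted law of the sum of the points other than the removed one, obtained by normalising the
    section over [D0] by its size-biased mass. It is not a probability measure: its total mass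
    carries the new factor [q] and the exponent lowered by 1. *)
Let reduced : {measure set R -> \bar R} :=
  mscale (NngNum ainv0)
    (weighted_image (section_measure mD0) mP0 (@one0 R)
      (@measurable_cst _ _ R R setT 1) (@measurable_id _ R setT)).

Let reducedE (A : set R) : measurable A ->
  reduced A = ((a0^-1)%:E * kappa (D0 `*` (A `&` P0)))%E.
Proof.
move=> mA; rewrite /reduced/= /mscale/= /weighted_image integral_cst ?mul1e; last first.
  exact: measurableI.
by rewrite setIC -section_measureE//; exact: measurableI.
Qed.

Let reduced_setT : reduced setT = (C * q * (1 + psi f) `^ (- q - 1))%:E.
Proof.
rewrite reducedE// setTI -section_measureE//.
have := section_laplace mD0 0 (@subset_refl _ _) ler01.
rewrite (_ : (fun t => (expR (- (0%:R * t)))%:E) = cst 1%E); last first.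
  by apply/funext => t; rewrite mul0r oppr0 expR0.
rewrite integral_cst//= mul1e psi0E => ->.
rewrite (size_massE mD0 (@subset_refl _ _) ler01) -/a0 -EFinM; congr EFin => /=.
by rewrite mulrC mulfK// gt_eqF// a0_gt0.
Qed.

Let kappa_reduced (D : set R) (b : R) (A : set R) : measurable D ->
  D `<=` `]0, b] -> 0 <= b -> measurable A ->
  (kappa (D `*` (A `&` P0)) = size_mass D * reduced A)%E.
Proof.
move=> mD Db b0 mA; rewrite (section_prop mD Db b0 mA) reducedE//.
by rewrite (size_massE mD Db b0) muleA -EFinM.
Qed.

Let reduced_lty : (reduced setT < +oo)%E.
Proof. by rewrite reduced_setT ltry. Qed.

Let size0 x : 0 <= `|x| * rho x. Proof. by rewrite mulr_ge0. Qed.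
Let msize : measurable_fun setT (fun x : R => `|x| * rho x).
Proof. by apply: measurable_funM => //; exact: normr_measurable. Qed.

Section truncation.
Variables (b : R) (b0 : 0 <= b).
Let Db : set R := `]0, b]%classic.
Let mDb : measurable Db. Proof. exact: measurable_itv. Qed.

Let m1 : {measure set R -> \bar R} :=
  weighted_image mu mDb size0 msize (@measurable_id _ R setT).

Let m1E (A : set R) : measurable A -> m1 A = size_mass (Db `&` A).
Proof.
move=> mA; rewrite /m1/= /weighted_image /size_mass integral_mkcond [RHS]integral_mkcond.
apply: eq_integral => x _; rewrite !patchE indicE.
have -> : (x \in Db `&` id @^-1` A) = (x \in Db `&` A) by [].
case: (boolP (x \in Db `&` A)) => [xD|_]; last by rewrite !mul0r; case: ifP.
rewrite mul1r ifT//; move: xD; rewrite !inE /Db /= !in_itv/= andbT.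
by move=> [/andP[]].
Qed.

Let m1_lty : (m1 setT < +oo)%E.
Proof. by rewrite m1E// setIT; exact: size_mass_lty b0. Qed.

Let Q : set (R * R) := Db `*` P0.
Let mQ : measurable Q. Proof. exact: measurableX. Qed.

Let kappaQ : {measure set (R * R) -> \bar R} :=
  weighted_image kappa mQ (@one0 (R * R)) (@measurable_cst _ _ (R * R)%type R setT 1)
    (@measurable_id _ (R * R)%type setT).

(** The measure x rho(x) dx may be infinite on the half-line, as it is for stable densities, but it
    is finite on []0, b]]. There both factors are finite, and a product measure is determined by its
    values on rectangles. *)
Lemma palm_truncated (F : R -> R -> \bar R) :
  measurable_fun setT (fun z : R * R => F z.1 z.2) -> (forall x t, 0 <= F x t)%E ->
  (\int[kappa]_(z in Q) F z.1 z.2 =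
   \int[reduced]_t \int[mu]_(x in Db) ((x * rho x)%:E * F x t))%E.
Proof.
move=> mF F0.
have -> : (\int[kappa]_(z in Q) F z.1 z.2 = \int[kappaQ]_z F z.1 z.2)%E.
  rewrite ge0_integral_weighted_image//.
  by apply: eq_integral => z _; rewrite mul1e.
have E (X : set (R * R)) : measurable X ->
    (mfinite m1_lty \x mfinite reduced_lty)%E X = kappaQ X.
  apply: product_measure_unique => A A' mA mA'.
  have EE : Q `&` id @^-1` (A `*` A') = (Db `&` A) `*` (A' `&` P0).
    by apply/seteqP; split => [[u v] [[? ?] [? ?]]|[u v] [[? ?] [? ?]]].
  rewrite /kappaQ /= /weighted_image EE integral_cst; last by apply: measurableX; exact: measurableI.
  rewrite mul1e; apply: etrans (@kappa_reduced (Db `&` A) b A' _ _ b0 mA') _.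
  - exact: measurableI.
  - by move=> x [].
  - by rewrite -m1E.
rewrite -(eq_measure_integral _ (fun X mX _ => E X mX)).
rewrite fubini_tonelli2//.
apply: eq_integral => t _; rewrite /fubini_G/=.
rewrite ge0_integral_weighted_image//; last exact: measurableT_comp mF (measurable_pair2 t).
apply: eq_integral => x; rewrite inE /Db/= in_itv/= => /andP[x0 _].
by rewrite (ger0_norm (ltW x0)).
Qed.
End truncation.

(** A Campbell-Palm formula reduced to the pair (removed point, sum of the others): under the tilt
    by [f], the second coordinate has the law [M] whatever the first one is. Nothing about [M]
    beyond its total mass is recorded, because the integrals taken against it later reduce to
    constants. *)
Lemma palm_formula : exists M : {measure set R -> \bar R},
  M setT = (C * q * (1 + psi f) `^ (- q - 1))%:E /\
  forall F : R -> R -> \bar R,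
    measurable_fun setT (fun z : R * R => F z.1 z.2) -> (forall x t, 0 <= F x t)%E ->
    (\int[P]_w \sum_(0 <= j <oo)
        ((Z w * y j w * expR (- (psum y f w - f (y j w))))%:E *
         F (y j w) (psum y (fun x => `|x|)%R w - y j w)%R) =
     \int[M]_t \int[mu]_(x in `]0%R, +oo[) ((x * rho x)%:E * F x t))%E.
Proof.
exists reduced; split; first exact: reduced_setT.
move=> F mF F0; set F' := fun z : R * R => F z.1 z.2.
have F'0 z : (0 <= F' z)%E by exact: F0.
rewrite -(kappa_int mF F'0).
have mP : measurable (`]0, +oo[%classic : set R) by exact: measurable_itv.
pose S : set (R * R) := `]0, +oo[ `*` P0.
have mS : measurable S by exact: measurableX.
pose Q n : set (R * R) := `]0, n%:R]%classic `*` P0.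
have mQ n : measurable (Q n) by apply: measurableX => //; exact: measurable_itv.
(* Pairs outside [S] carry no mass: a removed point equal to 0 has weight 0, and where [Z] does not
   vanish each point is at most the total sum. *)
have -> : (\int[kappa]_z F z.1 z.2 = \int[kappa]_z (F' \_ S) z)%E.
  rewrite (kappa_int mF F'0) kappa_int.
  - apply: eq_integral => w _; apply: eq_eseriesr => j _.
    have [->|wn0] := eqVneq (wgt j w) 0; first by rewrite !mul0e.
    rewrite patchE mem_set//; split => /=.
      rewrite in_itv/= andbT lt_def y0 andbT; apply: contraNneq wn0 => yj.
      by rewrite /wgt yj mulr0 mul0r.
    rewrite /P0/= in_itv/= andbT subr_ge0.
    have Zw : Z w != 0 by apply: contraNneq wn0 => Zw; rewrite /wgt Zw !mul0r.
    by have := psum_ge y0 j (@testfun_norm R) (sumy Zw); rewrite ger0_norm.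
  - exact: measurable_patch.
  - by move=> z; rewrite patchE; case: ifP.
have subQ m n : (m <= n)%N -> (`]0, m%:R] : set R) `<=` `]0, n%:R].
  by move=> mn x /=; rewrite !in_itv/= => /andP[-> /le_trans]; apply; rewrite ler_nat.
have U : `]0%R, +oo[%classic = \bigcup_n (`]0, n%:R]%classic : set R).
  rewrite itv_bndy_bigcup_BRight; apply: eq_bigcup => // n _; by rewrite add0r.
have US : S = \bigcup_n Q n.
  rewrite /S U; apply/seteqP; split => [[u v] [[n _ ?] ?]|[u v] [n _ [? ?]]].
    by exists n.
  by split => //; exists n.
have c1 : (\int[kappa]_z (F' \_ (Q n)) z)%E @[n --> \oo] --> (\int[kappa]_z (F' \_ S) z)%E.
  rewrite -integral_mkcond US; under eq_cvg do rewrite -integral_mkcond.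
  apply: ge0_nondecreasing_set_cvg_integral => //.
  - apply/nondecreasing_seqP => n; apply/subsetPset => -[u v] [? ?]; split => //.
    exact: subQ (leqnSn n) _ _.
  - by move=> n; exact: measurable_funTS.
have mG t : measurable_fun setT (fun x : R => ((x * rho x)%:E * F x t)%E).
  apply: emeasurable_funM; first by apply/measurable_EFinP; exact: measurable_funM.
  exact: measurableT_comp mF (measurable_pair2 t).
have G0 n t x : `]0%R, n%:R]%classic x -> (0 <= (x * rho x)%:E * F x t)%E.
  by rewrite /= in_itv/= => /andP[x0 _]; rewrite mule_ge0// lee_fin mulr_ge0// ltW.
have c2 : (\int[reduced]_t \int[mu]_(x in `]0%R, n%:R]) ((x * rho x)%:E * F x t))%E
   @[n --> \oo] -->
   (\int[reduced]_t \int[mu]_(x in `]0%R, +oo[) ((x * rho x)%:E * F x t))%E.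
  apply: (@cvg_integral_nd _ _ _ reduced setT
    (fun n t => \int[mu]_(x in `]0%R, n%:R]) ((x * rho x)%:E * F x t))%E) => //.
  - move=> n; apply: (@measurable_integral_in _ _ _ _ R mu _
      (fun t x => (x * rho x)%:E * F x t)%E) => //; last by move=> t x; exact: G0.
    apply: emeasurable_funM.
      apply/measurable_EFinP; apply: measurable_funM => //.
      exact: measurableT_comp.
    exact: (measurableT_comp mF (measurable_fun_pair measurable_snd measurable_fst)).
  - by move=> n t _; apply: integral_ge0 => x; exact: G0.
  - move=> t _ m n mn; apply: ge0_subset_integral => //.
    + exact: (measurable_funTS (mG t)).
    + by move=> x; exact: G0.
    + exact: subQ.
  - move=> t _; rewrite U; apply: ge0_nondecreasing_set_cvg_integral => //.
    + by move=> m n mn; apply/subsetPset; exact: subQ.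
    + by move=> n; exact: (measurable_funTS (mG t)).
    + by move=> n x; exact: G0.
apply: (cvg_unique _ c1) => //.
apply: cvg_trans c2; apply: near_eq_cvg; apply: nearW => n.
by rewrite -integral_mkcond -palm_truncated.
Qed.

End palm.

(** * Size-biased picks *)

Section picks.
Context (R : realType) d (T : measurableType d).
Implicit Types J Jt : nat -> T -> R.

(* The point [J j], replaced by 0 once picked, so that a test function, which
   vanishes at 0, ignores it. *)
Definition unpicked J Jt (n j : nat) (w : T) : R :=
  if [exists k : 'I_n, Jt k w == J j w] then 0 else J j w.

Lemma unpicked0 J Jt j w : unpicked J Jt 0 j w = J j w.
Proof. by rewrite /unpicked; case: existsP => // -[[]]. Qed.

Lemma unpickedS J Jt n j w :
  unpicked J Jt n.+1 j w = if Jt n w == J j w then 0 else unpicked J Jt n j w.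
Proof.
rewrite /unpicked; case: existsP => [[[k kn] /= /eqP Jtk]|H].
  move: kn; rewrite ltnS leq_eqVlt => /predU1P[kE|kn]; first by rewrite -kE Jtk eqxx.
  case: ifP => // _; case: existsP => // -[]; exists (Ordinal kn); exact/eqP.
case: ifPn => [nj|_]; first by case: H; exists ord_max.
case: existsP => // -[[k kn] Jtk]; case: H.
by exists (Ordinal (ltnW kn : (k < n.+1)%N)).
Qed.

Lemma unpicked_ge0 J Jt n j w : (forall j w, 0 <= J j w) -> 0 <= unpicked J Jt n j w.
Proof. by move=> J0; rewrite /unpicked; case: ifP. Qed.

Lemma unpicked_le J Jt n j w : (forall j w, 0 <= J j w) -> unpicked J Jt n j w <= J j w.
Proof. by move=> J0; rewrite /unpicked; case: ifP. Qed.

(** The good event on which a value determines the index of its point, so that comparing values in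
    the definition of the picks is the same as comparing points. *)
Definition simple_points J (w : T) : Prop :=
  [/\ forall j, 0 < J j w, forall i j, J i w = J j w -> i = j & summable_at J w].

Definition pick_hits J Jt n w : Prop :=
  exists2 j, Jt n w = J j w & 0 < unpicked J Jt n j w.

Lemma remainingE J Jt n w : remaining J Jt n w = total_sum J w - \sum_(k < n) Jt k w.
Proof.
elim: n => [|n IH] /=; first by rewrite big_ord0 subr0.
by rewrite IH big_ord_recr/= opprD addrA.
Qed.

End picks.

Section picks_at.
Context (R : realType) d (T : measurableType d) (J Jt : nat -> T -> R) (w : T).
Hypothesis J0 : forall j w, 0 <= J j w.
Hypothesis simple : simple_points J w.
Local Notation y n := (unpicked J Jt n).

Lemma unpicked_gt0 n j : 0 < y n j w -> y n j w = J j w.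
Proof. by rewrite /unpicked; case: ifP => //; rewrite ltxx. Qed.

Lemma summable_unpicked n : summable_at (y n) w.
Proof.
have [_ _ sJ] := simple; apply: le_lt_trans sJ; apply: lee_nneseries => [j _ _|j _].
  by rewrite lee_fin unpicked_ge0.
by rewrite lee_fin unpicked_le.
Qed.

Lemma psum_unpickedS n f : testfun f -> pick_hits J Jt n w ->
  psum (y n.+1) f w = psum (y n) f w - f (Jt n w).
Proof.
move=> tf [j Jtn yj]; have [Jpos Jinj _] := simple.
apply/eqP; rewrite eq_sym subr_eq; apply/eqP; apply: EFin_inj; rewrite EFinD.
have ge n' i : (0 <= (f (y n' i w))%:E)%E by rewrite lee_fin testfun_ge0.
rewrite !psumE//; try exact: summable_unpicked; try (by move=> *; exact: unpicked_ge0).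
rewrite (@nneseriesD1 _ _ j)// [X in (_ = X + _)%E](@nneseriesD1 _ _ j)//.
rewrite unpickedS Jtn eqxx (testfun0 tf) add0e addeC (unpicked_gt0 yj); congr (_ + _)%E.
apply: eq_eseriesr => i /= ij; rewrite unpickedS Jtn ifF//.
by apply/negP => /eqP /Jinj ji; rewrite ji eqxx in ij.
Qed.

Lemma psum_unpicked0 f : psum (y 0) f w = psum J f w.
Proof.
by rewrite psum.unlock; congr fine; apply: eq_eseriesr => j _; rewrite unpicked0.
Qed.

Local Notation norm := (fun x : R => `|x|).

Lemma remaining_psum n : (forall k, (k < n)%N -> pick_hits J Jt k w) ->
  remaining J Jt n w = psum (y n) norm w.
Proof.
have [Jpos Jinj sJ] := simple.
elim: n => [|n IH] hitn /=.
  rewrite psum_unpicked0 psum.unlock /total_sum; congr fine; apply: eq_eseriesr => j _.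
  by rewrite ger0_norm.
rewrite IH; last by move=> k kn; apply: hitn; exact: ltnW.
rewrite psum_unpickedS//; [|exact: testfun_norm|exact: hitn].
by have [j -> _] := hitn n (ltnSn n); rewrite ger0_norm.
Qed.

(** Each pick removes a single index, so a tail of the enumeration survives. As all points are
    positive, this keeps the remaining sum positive after every number of picks. *)
Lemma unpicked_cofinite n : (forall k, (k < n)%N -> pick_hits J Jt k w) ->
  exists N, forall j, (N <= j)%N -> y n j w = J j w.
Proof.
have [_ Jinj _] := simple.
elim: n => [|n IH] hitn; first by exists 0 => j _; exact: unpicked0.
have [|N HN] := IH; first by move=> k kn; apply: hitn; exact: ltnW.
have [j0 Jtn _] := hitn n (ltnSn n).
exists (maxn N j0.+1) => j; rewrite geq_max => /andP[Nj j0j].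
rewrite unpickedS Jtn ifF ?HN//; apply/negP => /eqP /Jinj j0E.
by rewrite j0E ltnn in j0j.
Qed.

Lemma remaining_gt0 n : (forall k, (k < n)%N -> pick_hits J Jt k w) ->
  0 < remaining J Jt n w.
Proof.
move=> hitn; have [Jpos _ _] := simple; have [N /(_ _ (leqnn N)) yN] := unpicked_cofinite hitn.
rewrite remaining_psum//; apply: (@lt_le_trans _ _ (y n N w)); first by rewrite yN.
have := psum_ge (y := y n) (fun j w => unpicked_ge0 Jt n j w J0) N (@testfun_norm R) (summable_unpicked n).
by rewrite ger0_norm// unpicked_ge0.
Qed.

(** Strict because a second unpicked point exists further along the enumeration. Hence what is left
    after removing [j] is positive, which is where the bias functions can be divided by. *)
Lemma unpicked_lt n j : (forall k, (k < n)%N -> pick_hits J Jt k w) ->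
  0 < y n j w -> y n j w < psum (y n) norm w.
Proof.
move=> hitn yj; have [Jpos _ _] := simple; have [N HN] := unpicked_cofinite hitn.
pose i := maxn N j.+1.
have yi : y n i w = J i w by apply: HN; rewrite leq_maxl.
have y0 k : (0 <= (`|y n k w|)%:E)%E by rewrite lee_fin.
rewrite -lte_fin psumE//; [|by move=> *; exact: unpicked_ge0|exact: testfun_norm|exact: summable_unpicked].
rewrite (@nneseriesD1 _ _ j)// (@nneseriesD1 _ _ i)//=; last first.
  by rewrite gtn_eqF// leq_maxr.
rewrite (ger0_norm (ltW yj)) lteDl//.
apply: (@lt_le_trans _ _ (`|y n i w|)%:E); first by rewrite lte_fin normr_gt0 yi gt_eqF.
by rewrite leeDl// nneseries_ge0.
Qed.

Lemma stick_breaking_at n : (forall k, pick_hits J Jt k w) ->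
  size_biased_weight J Jt n w =
  (1 - residual_fraction J Jt n w) * \prod_(i < n) residual_fraction J Jt i w.
Proof.
move=> hit; have T0 k : remaining J Jt k w != 0 by rewrite gt_eqF// remaining_gt0.
have -> : \prod_(i < n) residual_fraction J Jt i w = remaining J Jt n w / remaining J Jt 0 w.
  elim: n => [|n IH]; first by rewrite big_ord0 divff.
  have e (a b c : R) : a != 0 -> b != 0 -> a / b * (c / a) = c / b by move=> *; field; apply/andP.
  by rewrite big_ord_recr IH; exact: e.
rewrite /size_biased_weight /residual_fraction -[total_sum J w]/(remaining J Jt 0 w).
have -> : remaining J Jt n.+1 w = remaining J Jt n w - Jt n w by [].
by field; rewrite !T0.
Qed.

End picks_at.

Section measurable_picks.
Context (R : realType) d (T : measurableType d) (J Jt : nat -> T -> R) (n : nat).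
Hypothesis J0 : forall j w, 0 <= J j w.
Hypothesis mJ : forall j, measurable_fun setT (J j).
Hypothesis mJt : forall k, (k < n)%N -> measurable_fun setT (Jt k).

(** The measurable space is arbitrary, so the same statement serves for [Omega] and for the
    sigma-algebra generated by the history of the picks. *)
Lemma measurable_unpicked m j : (m <= n)%N -> measurable_fun setT (unpicked J Jt m j).
Proof.
elim: m => [|m IH] mn.
  by rewrite (_ : unpicked J Jt 0 j = J j)//; apply/funext => w; exact: unpicked0.
rewrite (_ : unpicked J Jt m.+1 j =
    (fun w => if Jt m w == J j w then 0 else unpicked J Jt m j w)); last first.
  by apply/funext => w; exact: unpickedS.
apply: measurable_fun_ifT => //; last by apply: IH; exact: ltnW.
by apply: measurable_fun_eqr => //; exact: mJt.
Qed.

Lemma measurable_total_sum : measurable_fun setT (total_sum J).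
Proof.
apply: (@measurableT_comp _ _ _ _ _ _ (@fine R)) => //.
apply: ge0_emeasurable_sum => [k w _ _|k _]; first by rewrite lee_fin.
exact/measurable_EFinP.
Qed.

Lemma measurable_remaining m : (m <= n)%N -> measurable_fun setT (remaining J Jt m).
Proof.
elim: m => [|m IH] mn /=; first exact: measurable_total_sum.
by apply: measurable_funB; [apply: IH; exact: ltnW|exact: mJt].
Qed.

Lemma measurable_residual_fraction m : (m < n)%N ->
  measurable_fun setT (residual_fraction J Jt m).
Proof.
move=> mn; apply: measurable_funM; first exact: measurable_remaining.
apply: (measurableT_comp (@measurable_inv R)).
by apply: measurable_remaining; exact: ltnW.
Qed.
End measurable_picks.

Section conditional_probability.
Context (R : realType) d (Omega : measurableType d) (P : probability Omega R).
Variables (GG : set (set Omega)).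
Hypothesis GG_measurable : GG `<=` measurable.
Local Notation T' := (g_sigma_algebraType GG).
Variables (E : set Omega) (q : Omega -> R).
Hypothesis mE : measurable E.
Hypothesis mq : measurable_fun setT q.
Hypothesis condq : is_cond_prob P <<s GG >> E (fun w => (q w)%:E).
Hypothesis q0 : {ae P, forall w, 0 <= q w}.

Lemma measurable_g_sigma A : <<s GG >> A -> measurable A.
Proof. by apply: smallest_sub => //; exact: sigma_algebra_measurable. Qed.

Lemma measurable_fun_g_sigma d' (U : measurableType d') (f : Omega -> U) :
  measurable_fun setT (f : T' -> U) -> measurable_fun setT f.
Proof. by move=> mf _ B mB; apply: measurable_g_sigma; exact: mf. Qed.

(** The defining property of the conditional probability says that two measures agree on the
    sub-sigma-algebra, hence so do their integrals of functions measurable for it. The maximum with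
    0 gives a density nonnegative everywhere, as [q] is nonnegative only almost surely. *)
Lemma integral_cond_prob (Z : Omega -> \bar R) :
  measurable_fun setT (Z : T' -> \bar R) -> (forall w, 0 <= Z w)%E ->
  (\int[P]_(w in E) Z w = \int[P]_w ((Num.max (q w) 0)%:E * Z w))%E.
Proof.
move=> mZ Z0.
have one0 (x : Omega) : 0 <= (fun=> 1 : R) x by exact: ler01.
have mid : measurable_fun setT (id : Omega -> T').
  by move=> _ B mB; rewrite setTI; exact: measurable_g_sigma.
have mq' : measurable_fun setT (fun w => Num.max (q w) 0) by exact: measurable_maxr.
have q'0 w : 0 <= Num.max (q w) 0 by rewrite le_max lexx orbT.
pose m1 := weighted_image P mE one0 (@measurable_cst _ _ Omega R setT 1) mid.
pose m2 := weighted_image P measurableT q'0 mq' mid.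
have : (\int[m1]_w Z w = \int[m2]_w Z w)%E.
  apply: eq_measure_integral => A mA _.
  have mA' : measurable (id @^-1` A : set Omega) by exact: measurable_g_sigma.
  rewrite /m1 /m2 /= /weighted_image setTI integral_cst; last exact: measurableI.
  have [_ /(_ A mA) H] := condq.
  rewrite mul1e [E `&` _]setIC; apply: etrans H _.
  apply: ae_eq_integral => //.
  - exact/measurable_EFinP/measurable_funTS.
  - exact/measurable_EFinP/measurable_funTS.
  - by apply: filterS q0 => w qw _; rewrite /Num.max ltNge qw.
rewrite !ge0_integral_weighted_image//.
by move=> <-; apply: eq_integral => w _; rewrite mul1e.
Qed.

End conditional_probability.

Section size_biased.
Context (R : realType) d (Omega : measurableType d) (P : probability Omega R).
Variables (J Jt : nat -> {RV P >-> R}).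
Hypothesis J0 : forall j w, 0 <= J j w.
Hypothesis simple_ae : {ae P, forall w, simple_points J w}.
Hypothesis picks : is_size_biased_picks J Jt.
Local Notation y n := (unpicked J Jt n).
Local Notation rem n := (remaining J Jt n).
Local Notation norm := (fun x : R => `|x|).

Definition pick_history (n : nat) : set (set Omega) :=
  (\bigcup_i preimage_set_system setT (J i) measurable) `|`
  (\bigcup_(k in `I_n) preimage_set_system setT (Jt k) measurable).

Lemma pick_history_measurable n : pick_history n `<=` measurable.
Proof.
move=> A [] [k _ [B mB <-]]; rewrite setTI; exact: measurable_funPTI.
Qed.

Local Notation HT n := (g_sigma_algebraType (pick_history n)).

Lemma history_J n j : measurable_fun setT (J j : HT n -> R).
Proof.
by move=> _ B mB; apply: sub_sigma_algebra; left; exists j => //; exists B.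
Qed.

Lemma history_Jt n k : (k < n)%N -> measurable_fun setT (Jt k : HT n -> R).
Proof.
by move=> kn _ B mB; apply: sub_sigma_algebra; right; exists k => //; exists B.
Qed.

Lemma history_unpicked n j : measurable_fun setT (y n j : HT n -> R).
Proof.
apply: (@measurable_unpicked R _ (HT n) J Jt n) => //.
- by move=> i; exact: history_J.
- by move=> k; exact: history_Jt.
Qed.

Lemma history_remaining n : measurable_fun setT (rem n : HT n -> R).
Proof.
apply: (@measurable_remaining R _ (HT n) J Jt n) => //.
- by move=> i; exact: history_J.
- by move=> k; exact: history_Jt.
Qed.

Lemma history_residual n k : (k < n)%N ->
  measurable_fun setT (residual_fraction J Jt k : HT n -> R).
Proof.
move=> kn; apply: (@measurable_residual_fraction R _ (HT n) J Jt n) => //.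
- by move=> i; exact: history_J.
- by move=> i; exact: history_Jt.
Qed.

Let from_history n d' (U : measurableType d') (f : Omega -> U) :
  measurable_fun setT (f : HT n -> U) -> measurable_fun setT f.
Proof. by apply: measurable_fun_g_sigma; exact: pick_history_measurable. Qed.

Let pick_prob n j w := y n j w / rem n w.

Let mpick_prob n j : measurable_fun setT (pick_prob n j).
Proof.
apply: measurable_funM; first exact: from_history (@history_unpicked n j).
apply: (measurableT_comp (@measurable_inv R)); exact: from_history (@history_remaining n).
Qed.

Let E n j := [set w | Jt n w = J j w].

Let mE n j : measurable (E n j).
Proof.
have := @measurable_fun_eqr _ _ _ setT (Jt n) (J j) (@measurable_funPT _ _ _ _ (Jt n))
  (@measurable_funPT _ _ _ _ (J j)).
move=> /(_ measurableT [set true] I); rewrite setTI.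
by rewrite (_ : _ @^-1` _ = E n j)//; apply/seteqP; split => w /= /eqP.
Qed.

Let hits_before n w := forall k, (k < n)%N -> pick_hits J Jt k w.

Let cond_pick n j : is_cond_prob P <<s pick_history n >> (E n j) (fun w => (pick_prob n j w)%:E).
Proof.
have := picks n j; congr (is_cond_prob P _ _ _); apply/funext => w.
by rewrite /pick_prob remainingE /unpicked; case: ifP => // _; rewrite mul0r.
Qed.

Let pick_prob_ge0 n j w : simple_points J w -> hits_before n w -> 0 <= pick_prob n j w.
Proof.
by move=> sw hw; rewrite divr_ge0 ?unpicked_ge0// ltW// remaining_gt0.
Qed.

(** Conditioning is done separately for each candidate index [j], with an integrand [X j] that
    depends only on the points and the earlier picks. The assumption on earlier picks makes the pick
    probabilities nonnegative. *)
Lemma sum_picks n (X : nat -> Omega -> \bar R) :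
  {ae P, forall w, hits_before n w} ->
  (forall j, measurable_fun setT (X j : HT n -> \bar R)) ->
  (forall j w, 0 <= X j w)%E ->
  (\int[P]_w \sum_(0 <= j <oo) ((\1_(E n j) w)%:E * X j w) =
   \int[P]_w \sum_(0 <= j <oo) ((Num.max (y n j w / rem n w) 0)%:E * X j w))%E.
Proof.
move=> hae mX X0.
have mX' j : measurable_fun setT (X j) by exact: from_history (mX j).
rewrite integral_nneseries//; last 2 first.
- move=> j; apply: emeasurable_funM => //; apply/measurable_EFinP.
  exact: measurable_indic.
- by move=> j w _; rewrite mule_ge0// lee_fin.
pose B j w := ((Num.max (y n j w / rem n w) 0)%:E * X j w)%E.
have mB j : measurable_fun setT (B j).
  apply: emeasurable_funM => //; apply/measurable_EFinP.
  by apply: measurable_maxr => //; exact: mpick_prob.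
have B0 j w : setT w -> (0 <= B j w)%E.
  by move=> _; rewrite mule_ge0// lee_fin le_max lexx orbT.
rewrite [RHS](integral_nneseries P measurableT mB B0).
apply: eq_eseriesr => j _.
have := @integral_cond_prob R _ Omega P _ (@pick_history_measurable n) _ _ (mE n j)
  (mpick_prob n j) (cond_pick n j) _ (X j) (mX j) (X0 j).
move=> <-; last first.
  by apply: filterS2 simple_ae hae => w sw hw; exact: pick_prob_ge0.
rewrite [RHS]integral_mkcond; apply: eq_integral => w _.
by rewrite patchE indicE; case: ifP => _; rewrite ?mul1e ?mul0e.
Qed.

(** If the earlier picks hit available points, the remaining sum is the sum of the unpicked points,
    so the pick probabilities add up to 1. Therefore the event [H] that the next pick is an unpicked
    point has probability at least 1, and the induction goes on. *)
Lemma hits_ae n : {ae P, forall w, hits_before n w}.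
Proof.
elim: n => [|n IH]; first by apply: aeW => w k.
pose H := \bigcup_j (E n j `&` [set w | 0 < y n j w]).
have mpos j : measurable [set w | 0 < y n j w].
  have := from_history (@history_unpicked n j) measurableT (measurable_itv `]0, +oo[).
  rewrite setTI (_ : _ @^-1` _ = [set w | 0 < y n j w])//.
  by apply/seteqP; split => w /=; rewrite in_itv/= andbT.
have mH : measurable H by apply: bigcup_measurable => j _; exact: measurableI.
pose X j w : \bar R := (\1_[set w | 0 < y n j w] w)%:E.
have PH : (1 <= P H)%E.
  have mX j : measurable_fun setT (X j : HT n -> \bar R).
    apply/measurable_EFinP; apply: measurable_indic.
    have := @history_unpicked n j measurableT _ (measurable_itv `]0, +oo[).
    rewrite setTI (_ : _ @^-1` _ = [set w | 0 < y n j w])//.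
    by apply/seteqP; split => w /=; rewrite in_itv/= andbT.
  have X0 j w : (0 <= X j w)%E by rewrite lee_fin.
  have mX' j : measurable_fun setT (X j) by exact: from_history (@mX j).
  have mS : measurable_fun setT (fun w => \sum_(0 <= j <oo)
      ((Num.max (y n j w / rem n w) 0)%:E * X j w))%E.
    apply: ge0_emeasurable_sum => [k w _ _|k _].
      by rewrite mule_ge0// lee_fin le_max lexx orbT.
    apply: emeasurable_funM => //; apply/measurable_EFinP.
    by apply: measurable_maxr => //; exact: mpick_prob.
  have mS' : measurable_fun setT (fun w => \sum_(0 <= j <oo) ((\1_(E n j) w)%:E * X j w))%E.
    apply: ge0_emeasurable_sum => [k w _ _|k _].
      by rewrite mule_ge0// lee_fin.
    apply: emeasurable_funM => //; apply/measurable_EFinP; exact: measurable_indic.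
  have -> : 1%E = (\int[P]_w \sum_(0 <= j <oo) ((Num.max (y n j w / rem n w) 0)%:E * X j w))%E.
    rewrite -(probability_setT P) -[LHS]mul1e -integral_cst//.
    apply: ge0_ae_eq_integral => //.
      by move=> w _; apply: nneseries_ge0 => j _ _; rewrite mule_ge0// lee_fin le_max lexx orbT.
    apply: filterS2 simple_ae IH => w sw hw _.
    have T0 := remaining_gt0 J0 sw hw.
    under eq_eseriesr => j _.
      have -> : ((Num.max (y n j w / rem n w) 0)%:E * X j w = (rem n w)^-1%:E * (`|y n j w|)%:E)%E.
        have y0 : 0 <= y n j w by exact: unpicked_ge0.
        rewrite /X indicE max_l ?divr_ge0 ?(ltW T0)// -!EFinM; congr EFin.
        rewrite ger0_norm//; have [->|yn0] := eqVneq (y n j w) 0; first by rewrite !(mul0r, mulr0).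
        by rewrite mem_set ?mulr1 1?mulrC//= lt_def yn0.
      over.
    rewrite nneseriesZl; last by move=> j _; rewrite lee_fin.
    have yn0 j v : 0 <= y n j v by exact: unpicked_ge0.
    rewrite -(psumE yn0 (@testfun_norm R) (summable_unpicked Jt J0 sw n)).
    rewrite -remaining_psum// -EFinM mulVf// gt_eqF//.
  have -> : P H = (\int[P]_w (\1_H w)%:E)%E by rewrite integral_indic// setIT.
  rewrite -(sum_picks IH mX X0).
  apply: ae_ge0_le_integral => //.
  - by move=> w _; apply: nneseries_ge0 => j _ _; rewrite mule_ge0// lee_fin.
  - by apply/measurable_EFinP; exact: measurable_indic.
  (* As the points are distinct, at most one index contributes to the sum, which is thus bounded by
     the indicator of [H]. *)
  - apply: filterS simple_ae => w [_ Jinj _] _.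
    have [[j _ [Ej yj]]|nH] := pselect (H w); last first.
      rewrite eseries0 ?lee_fin// => j _ _; rewrite /X !indicE.
      have [Ej|Ej] := pselect (E n j w); last by rewrite memNset ?mul0e.
      have [yj|yj] := pselect (0 < y n j w); last by rewrite [X in (_ * X)%E](_ : _ = 0%E) ?mule0// memNset.
      by case: nH; exists j.
    rewrite (@nneseriesD1 _ _ j)//; last by move=> k _; rewrite mule_ge0// lee_fin.
    rewrite eseries0 ?adde0; last first.
      move=> k _ /= kj; rewrite indicE memNset ?mul0e// => Ek.
      by move/eqP: kj; apply; apply: Jinj; rewrite -Ek.
    rewrite /X !indicE (_ : w \in H); last by rewrite inE; exists j.
    by rewrite (mem_set Ej) (mem_set yj) -EFinM mulr1.
have PHC : P (~` H) = 0%E.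
  by rewrite probability_setC//; apply/eqP; rewrite sube_eq// ?add0e eq_le PH probability_le1.
have : {ae P, forall w, H w} by exists (~` H); split => //; exact: measurableC.
apply: filterS2 IH => w hw [j _ [Ej yj]] k; rewrite ltnS leq_eqVlt => /predU1P[->|]; last exact: hw.
by exists j.
Qed.

(** Integrates out the pick [Jt n]: [X j] is the value of the integrand [Y] when the pick equals
    [J j], expressed through the history only. *)
Lemma pick_integral n (X : nat -> Omega -> \bar R) (Y : Omega -> \bar R) :
  (forall j, measurable_fun setT (X j : HT n -> \bar R)) ->
  (forall j w, 0 <= X j w)%E ->
  measurable_fun setT Y -> (forall w, 0 <= Y w)%E ->
  {ae P, forall w, forall j, Jt n w = J j w -> Y w = X j w} ->
  (\int[P]_w Y w =
   \int[P]_w \sum_(0 <= j <oo) ((Num.max (y n j w / rem n w) 0)%:E * X j w))%E.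
Proof.
move=> mX X0 mY Y0 YX; rewrite -(sum_picks (hits_ae n) mX X0).
have mX' j : measurable_fun setT (X j) by exact: from_history (mX j).
apply: ge0_ae_eq_integral => //.
- apply: ge0_emeasurable_sum => [k w _ _|k _]; first by rewrite mule_ge0// lee_fin.
  by apply: emeasurable_funM => //; apply/measurable_EFinP; exact: measurable_indic.
- by move=> w _; apply: nneseries_ge0 => j _ _; rewrite mule_ge0// lee_fin.
have hS := hits_ae n.+1.
apply: filterS2 (filterI simple_ae hS) YX => w [[_ Jinj _] /(_ n (ltnSn n))[j Jtn _]] YX _.
rewrite (@nneseriesD1 _ _ j)//; last by move=> k _; rewrite mule_ge0// lee_fin.
rewrite eseries0 ?adde0; last first.
  move=> k _ /= kj; rewrite indicE memNset ?mul0e// => Ek.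
  by move/eqP: kj; apply; apply: Jinj; rewrite -Ek.
by rewrite indicE mem_set// mul1e (YX j).
Qed.

End size_biased.

(** * Weighting the first residual fractions *)

(* [h n] normalises the effect of weighting the first [n] residual fractions by
   [a 0], ..., [a n.-1]; the factor [1 / (t + x)] comes from the probability
   [x / (t + x)] of picking the point [x]. *)
Record biasing_system (R : realType) (rho : R -> R) (a h : nat -> R -> R) : Prop := {
  biasing_a_ge0 : forall n u, 0 <= a n u;
  biasing_a_meas : forall n, measurable_fun setT (a n);
  biasing_h_ge0 : forall n t, 0 <= h n t;
  biasing_h_meas : forall n, measurable_fun setT (h n);
  biasing_h_gt0 : forall n t, 0 < t -> 0 < h n t;
  biasing_h0 : forall t, h 0%N t = 1;
  biasing_hS : forall n t, 0 < t ->
    (\int[lebesgue_measure]_(x in `]0%R, +oo[)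
       (x * rho x * (a n (t / (t + x)) * h n (t + x) / (t + x)))%:E = (h n.+1 t)%:E)%E }.

Section chain.
Context (R : realType) (rho : R -> R).
Local Notation mu := (@lebesgue_measure R).
Hypotheses (mrho : measurable_fun setT rho) (rho0 : forall x, 0 <= rho x).
Hypothesis levy : (\int[mu]_(x in `]0%R, +oo[) (Num.min x 1 * rho x)%:E < +oo)%E.
Hypothesis rho_gt0 : forall x, 0 < x -> 0 < rho x.
Context d (Omega : measurableType d) (P : probability Omega R).
Variables (J Jt : nat -> {RV P >-> R}) (r : R).
Hypothesis r0 : 0 <= r.
Hypothesis J0 : forall j w, 0 <= J j w.
Hypothesis simple_ae : {ae P, forall w, simple_points J w}.
Hypothesis picks : is_size_biased_picks J Jt.
Local Notation psi := (levy_exponent rho).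
Hypothesis laplace_functional : forall f, testfun f ->
  (\int[P]_w (expR (- psum J f w))%:E = ((1 + psi f) `^ (- r))%:E)%E.
Local Notation y n := (unpicked J Jt n).
Local Notation rem n := (remaining J Jt n).
Local Notation norm := (fun x : R => `|x|).

Section system.
Variables (a h : nat -> R -> R).
Hypothesis sys : biasing_system rho a h.
Let a0 n u : 0 <= a n u. Proof. exact: biasing_a_ge0 sys n u. Qed.
Let ma n : measurable_fun setT (a n). Proof. exact: biasing_a_meas sys n. Qed.
Let h00 n t : 0 <= h n t. Proof. exact: biasing_h_ge0 sys n t. Qed.
Let mh n : measurable_fun setT (h n). Proof. exact: biasing_h_meas sys n. Qed.
Let h_gt0 n t : 0 < t -> 0 < h n t. Proof. exact: biasing_h_gt0 sys n t. Qed.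
Let h0 t : h 0%N t = 1. Proof. exact: biasing_h0 sys t. Qed.
Let hS := biasing_hS sys.

Definition chain_weight n w :=
  (\prod_(k < n) a k (residual_fraction J Jt k w)) / h n (rem n w).

Lemma measurable_chain_weight n : measurable_fun setT (chain_weight n).
Proof.
have mJ j : measurable_fun setT (J j) by [].
have mJt k : (k < n)%N -> measurable_fun setT (Jt k) by [].
apply: measurable_funM.
  apply: measurable_prod => k _; apply: measurableT_comp => //.
  exact: (measurable_residual_fraction J0 mJ mJt).
apply: (measurableT_comp (@measurable_inv R)); apply: measurableT_comp => //.
exact: (measurable_remaining J0 mJ mJt).
Qed.

Lemma chain_weight_ge0 n w : 0 <= chain_weight n w.
Proof. by rewrite divr_ge0// prodr_ge0. Qed.

Lemma chain_laplace n f : testfun f ->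
  (\int[P]_w (chain_weight n w * expR (- psum (y n) f w))%:E =
   (\prod_(k < n) (r + k%:R) * (1 + psi f) `^ (- (r + n%:R)))%:E)%E.
Proof.
elim: n f => [|n IH] f tf.
  rewrite big_ord0 mul1r addr0 -laplace_functional//.
  apply: eq_integral => w _; congr EFin.
  rewrite /chain_weight big_ord0 h0 divr1 mul1r; congr (expR (- _)).
  exact: psum_unpicked0.
pose q := r + n%:R.
have q0 : 0 <= q by rewrite addr_ge0.
pose C := \prod_(k < n) (r + k%:R).
have C0 : 0 <= C by rewrite prodr_ge0// => k _; rewrite addr_ge0.
have [N [mN PN subN]] : {ae P, forall w, simple_points J w /\
    forall k, (k < n.+1)%N -> pick_hits J Jt k w}.
  by apply: filterS2 simple_ae (hits_ae J0 simple_ae picks n.+1).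
have good w : ~ N w -> simple_points J w /\ forall k, (k < n.+1)%N -> pick_hits J Jt k w.
  by move=> nN; apply: contrapT => nG; apply: nN; exact: subN.
have hitn w : ~ N w -> forall k, (k < n)%N -> pick_hits J Jt k w.
  by move=> /good [_ hw] k kn; apply: hw; exact: ltnW.
(* The Palm formula asks for summability at every outcome of nonzero weight, so the weight is set to
   0 on the null set [N]. *)
pose Z w := \1_(~` N) w * chain_weight n w.
have Z0 w : 0 <= Z w by rewrite mulr_ge0// chain_weight_ge0.
have mZ : measurable_fun setT Z.
  apply: measurable_funM; last exact: measurable_chain_weight.
  by apply: measurable_indic; exact: measurableC.
have my j : measurable_fun setT (y n j).
  by apply: (@measurable_unpicked R _ Omega J Jt n).
have y0 j w : 0 <= y n j w by exact: unpicked_ge0.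
have ZN w : Z w != 0 -> ~ N w.
  by apply: contra_neq_not => Nw; rewrite /Z indicE memNset ?mul0r//; apply.
have sumy w : Z w != 0 -> summable_at (y n) w.
  by move=> /ZN /good [sw _]; exact: summable_unpicked.
have mexp g : testfun g -> measurable_fun setT (fun w => expR (- psum (y n) g w)).
  by move=> [mg g0 _]; apply: measurable_expN; exact: measurable_psum.
have ZL g : testfun g ->
    (\int[P]_w (Z w * expR (- psum (y n) g w))%:E = (C * (1 + psi g) `^ (- q))%:E)%E.
  move=> tg; rewrite -IH//; apply: ge0_ae_eq_integral => //.
  - by apply/measurable_EFinP; apply: measurable_funM => //; exact: mexp.
  - apply/measurable_EFinP; apply: measurable_funM; last exact: mexp.
    exact: measurable_chain_weight.
  - by move=> w _; rewrite lee_fin mulr_ge0 ?expR_ge0.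
  - by move=> w _; rewrite lee_fin mulr_ge0 ?expR_ge0// chain_weight_ge0.
  - exists N; split => // w /= nw; apply: contrapT => nN; apply: nw => _.
    by rewrite /Z indicE mem_set ?mul1r.
have [M [MT MF]] := palm_formula mrho rho0 levy Z0 mZ y0 my sumy C0 q0 ZL tf rho_gt0.
have mP : measurable (`]0, +oo[%classic : set R) by exact: measurable_itv.
have yt w j : ~ N w -> 0 < y n j w -> 0 < psum (y n) norm w - y n j w.
  move=> nN yj; rewrite subr_gt0; have [sw _] := good w nN.
  exact: (unpicked_lt J0 sw (hitn w nN)).
pose K0 : set R := `]-oo, 0]%classic.
have mK0 : measurable K0 by exact: measurable_itv.
(* The Palm formula for the indicator of a nonpositive remaining sum has left side 0, since points
   remain after each removal. The factor [A], possibly infinite, is positive, so [M K0] must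
   vanish. *)
have Mneg : M K0 = 0%E.
  have mF0 : measurable_fun setT (fun z : R * R => (\1_K0 z.2)%:E : \bar R).
    by apply/measurable_EFinP; exact: measurable_indic_comp.
  have := MF (fun _ t => (\1_K0 t)%:E) mF0 (fun _ t => ltac:(rewrite lee_fin; exact: ler0n)).
  rewrite integral0_eq; last first.
    move=> w _; apply: eseries0 => j _ _.
    have [->|/ZN nN] := eqVneq (Z w) 0; first by rewrite !mul0r mul0e.
    have [->|yj] := eqVneq (y n j w) 0; first by rewrite mulr0 mul0r mul0e.
    rewrite indicE memNset ?mule0// /K0/= in_itv/=; apply/negP; rewrite -ltNge.
    by apply: yt => //; rewrite lt_def yj y0.
  pose A := (\int[mu]_(x in `]0%R, +oo[) (x * rho x)%:E)%E.
  have mxr : measurable_fun setT (fun x : R => (x * rho x)%:E).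
    by apply/measurable_EFinP; exact: measurable_funM.
  have A0 : (0 < A)%E.
    apply: integral_gt0 => //.
    - exact: measurable_funTS.
    - by move=> x /=; rewrite in_itv/= andbT => x0; rewrite lte_fin mulr_gt0// rho_gt0.
    - suff : (0 < lebesgue_measure (`]0%R, +oo[%classic : set R))%E by [].
      by rewrite lebesgue_measure_itv/= ltry addye// ltry.
  have -> : (\int[M]_t \int[mu]_(x in `]0%R, +oo[) ((x * rho x)%:E * (\1_K0 t)%:E) =
     A * M K0)%E.
    have -> : M K0 = (\int[M]_t (\1_K0 t)%:E)%E by rewrite integral_indic// setIT.
    rewrite -ge0_integralZl//; last 2 first.
    - by apply/measurable_EFinP; exact: measurable_indic.
    - exact: ltW.
    apply: eq_integral => t _; rewrite -ge0_integralZr//.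
    - exact: measurable_funTS.
    - by move=> x /=; rewrite in_itv/= andbT => x0; rewrite lee_fin mulr_ge0// ltW.
  move/esym/eqP; rewrite mule_eq0 gt_eqF//= => /eqP; exact.
(* The integrand when the next pick is [J j]: the remaining sum and the sum of [f] both lose the
   term of that point. *)
pose X j w : \bar R := ((\prod_(k < n) a k (residual_fraction J Jt k w)) *
  (a n ((rem n w - J j w) / rem n w) / h n.+1 (rem n w - J j w) *
   expR (- (psum (y n) f w - f (J j w)))))%:E.
have X0 j w : (0 <= X j w)%E.
  rewrite lee_fin mulr_ge0 ?prodr_ge0// mulr_ge0 ?expR_ge0// divr_ge0//.
have mX j : measurable_fun setT (X j : g_sigma_algebraType (pick_history J Jt n) -> \bar R).
  have mrJ := measurable_funB (@history_remaining R d Omega P J Jt J0 n)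
    (@history_J R d Omega P J Jt n j).
  have [mf f0 _] := tf.
  apply/measurable_EFinP; apply: measurable_funM.
    apply: measurable_prod => k _; apply: measurableT_comp => //.
    by apply: history_residual.
  apply: measurable_funM.
    apply: measurable_funM.
      apply: measurableT_comp => //; apply: measurable_funM => //.
      apply: (measurableT_comp (@measurable_inv R)); exact: history_remaining.
    by apply: (measurableT_comp (@measurable_inv R)); exact: measurableT_comp.
  apply: measurable_expN; apply: measurable_funB.
    by apply: measurable_psum => // i; exact: history_unpicked.
  by apply: measurableT_comp => //; exact: history_J.
have mcw : measurable_fun setT (fun w => (chain_weight n.+1 w * expR (- psum (y n.+1) f w))%:E).
  have [mf f0 _] := tf.
  apply/measurable_EFinP; apply: measurable_funM; first exact: measurable_chain_weight.
  apply: measurable_expN; apply: measurable_psum => // i.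
  by apply: (@measurable_unpicked R _ Omega J Jt n.+1).
rewrite (@pick_integral R d Omega P J Jt J0 simple_ae picks n X)//; last 2 first.
- by move=> w; rewrite lee_fin mulr_ge0 ?expR_ge0// chain_weight_ge0.
- exists N; split => // w /= nw; apply: contrapT => nN; apply: nw => j Jtn; congr EFin.
  have [sw hw] := good w nN.
  rewrite /chain_weight big_ord_recr/= (psum_unpickedS J0 sw tf (hw n (ltnSn n))) -Jtn.
  by rewrite /residual_fraction/=; ring.
(* Here [t + x] stands for T_n and [t] for T_(n+1). The factor [h n (t + x)] undoes the old
   normalisation, [h n.+1 t] is the new one, and the denominator [t + x] combines with the size
   factor of the Palm formula into the pick probability. The indicators make [F] nonnegative on the
   whole plane. *)
pose F x t : \bar R := (\1_(`]0, +oo[) t * \1_(`]0, +oo[) x *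
  (a n (t / (t + x)) * h n (t + x) / (t + x) / h n.+1 t))%:E.
have F0 x t : (0 <= F x t)%E.
  rewrite lee_fin !indicE; have [t0|] := boolP (t \in _); last by rewrite !mul0r.
  have [x0|] := boolP (x \in _); last by rewrite mulr0 mul0r.
  move: t0 x0; rewrite !mem_setE !in_itv/= !andbT => t0 x0.
  by rewrite !mulr1 mul1r mulr_ge0 ?invr_ge0// mulr_ge0 ?mulr_ge0// invr_ge0 addr_ge0// ltW.
have minv := @measurable_inv R.
have mF : measurable_fun setT (fun z : R * R => F z.1 z.2).
  have m12 : measurable_fun setT (fun z : R * R => z.2 + z.1) by exact: measurable_funD.
  apply/measurable_EFinP; apply: measurable_funM.
    by apply: measurable_funM; apply: measurable_indic_comp.
  apply: measurable_funM; last by apply: (measurableT_comp minv); exact: measurableT_comp.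
  apply: measurable_funM; last exact: (measurableT_comp minv m12).
  apply: measurable_funM; last exact: measurableT_comp.
  apply: measurableT_comp => //; apply: measurable_funM => //.
  exact: (measurableT_comp minv m12).
have mpos j : measurable_fun setT (fun w => (y n j w, psum (y n) norm w - y n j w)).
  apply: measurable_fun_pair => //; apply: measurable_funB => //.
  by apply: measurable_psum => //; exact: normr_measurable.
have ZyF0 j w : (0 <= (Z w * y n j w * expR (- (psum (y n) f w - f (y n j w))))%:E *
    F (y n j w) (psum (y n) norm w - y n j w)%R)%E.
  apply: mule_ge0; last exact: F0.
  by rewrite lee_fin; apply: mulr_ge0; [exact: mulr_ge0|exact: expR_ge0].
transitivity (\int[P]_w \sum_(0 <= j <oo)
        ((Z w * y n j w * expR (- (psum (y n) f w - f (y n j w))))%:E *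
         F (y n j w) (psum (y n) norm w - y n j w)%R))%E.
  apply: ge0_ae_eq_integral => //.
  - apply: ge0_emeasurable_sum => [j w _ _|j _].
      by rewrite mule_ge0// lee_fin le_max lexx orbT.
    apply: emeasurable_funM.
      apply/measurable_EFinP; apply: measurable_maxr => //; apply: measurable_funM => //.
      apply: (measurableT_comp minv).
      by apply: (@measurable_remaining R _ Omega J Jt n).
    apply: (measurable_fun_g_sigma _ (mX j)); exact: pick_history_measurable.
  - apply: ge0_emeasurable_sum => [j w _ _|j _] //.
    apply: emeasurable_funM; last exact: (measurableT_comp mF (mpos j)).
    have [mf f0 _] := tf.
    apply/measurable_EFinP; apply: measurable_funM; first exact: measurable_funM.
    apply: measurable_expN; apply: measurable_funB; first exact: measurable_psum.
    exact: measurableT_comp.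
  - by move=> w _; apply: nneseries_ge0 => j _ _; rewrite mule_ge0// lee_fin le_max lexx orbT.
  - by move=> w _; apply: nneseries_ge0.
  exists N; split => // w /= nw; apply: contrapT => nN; apply: nw => _.
  have [sw hw] := good w nN.
  apply: eq_eseriesr => j _.
  have [yj|yj] := eqVneq (y n j w) 0.
    by rewrite yj mul0r maxxx mulr0 mul0r !mul0e.
  have yj0 : 0 < y n j w by rewrite lt_def yj y0.
  have T0 := remaining_gt0 J0 sw (hitn w nN).
  have Trem := remaining_psum J0 sw (hitn w nN).
  have t0 := yt w j nN yj0; rewrite -Trem in t0 *.
  rewrite max_l; last by rewrite divr_ge0// ltW.
  rewrite /X /F !indicE !mem_set/= ?in_itv/= ?andbT//.
  rewrite -(unpicked_gt0 yj0) subrK -!EFinM; congr EFin.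
  rewrite /Z /chain_weight indicE mem_set//.
  have alg (p0 a0' h1 h2 e yj' t : R) : t != 0 -> h1 != 0 -> h2 != 0 ->
      yj' / t * (p0 * (a0' / h2 * e)) =
      1 * (p0 / h1) * yj' * e * (1 * 1 * (a0' * h1 / t / h2)).
    by move=> tn0 h1n0 h2n0; field; rewrite tn0 h1n0 h2n0.
  by apply: alg; rewrite gt_eqF// h_gt0.
rewrite (MF F mF F0).
(* By the recursion [biasing_hS], the inner integral is 1 for every positive [t], so only the total
   mass of [M] is left. *)
have -> : (\int[M]_t \int[mu]_(x in `]0%R, +oo[) ((x * rho x)%:E * F x t) =
    \int[M]_t (\1_(`]0%R, +oo[) t)%:E)%E.
  apply: eq_integral => t _; rewrite indicE.
  have [|tn] := boolP (t \in _); last first.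
    by apply: integral0_eq => x _; rewrite /F indicE (negbTE tn) !mul0r mule0.
  rewrite mem_setE in_itv/= andbT => t0.
  transitivity (\int[mu]_(x in `]0%R, +oo[) ((h n.+1 t)^-1%:E *
     (x * rho x * (a n (t / (t + x)) * h n (t + x) / (t + x)))%:E))%E.
    apply: eq_integral => x x0; rewrite /F !indicE x0 mem_setE in_itv/= t0/= -!EFinM; congr EFin.
    by rewrite !mul1r; ring.
  rewrite ge0_integralZl//.
  - by rewrite hS// -EFinM mulVf// gt_eqF// h_gt0.
  - have m12 : measurable_fun setT (fun x : R => t + x) by exact: measurable_funD.
    apply/measurable_EFinP/measurable_funTS; apply: measurable_funM; first exact: measurable_funM.
    apply: measurable_funM; last exact: (measurableT_comp minv m12).
    apply: measurable_funM; last exact: measurableT_comp.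
    apply: measurableT_comp => //; apply: measurable_funM => //.
    exact: (measurableT_comp minv m12).
  - move=> x /=; rewrite in_itv/= andbT => x0; rewrite lee_fin mulr_ge0//.
      by rewrite mulr_ge0// ltW.
    by rewrite mulr_ge0 ?mulr_ge0// invr_ge0 addr_ge0// ltW.
  - by rewrite lee_fin invr_ge0.
rewrite integral_indic// setIT.
have : M setT = (M K0 + M `]0%R, +oo[%classic)%E.
  rewrite -measureU//.
    congr (M _); apply/esym; rewrite -subTset => x _ /=; rewrite /K0/= !in_itv/= andbT.
    by have [?|?] := leP x 0; [left|right].
  rewrite -subset0 => x [] /=; rewrite /K0/= !in_itv/= andbT => x0 /(le_lt_trans x0).
  by rewrite ltxx.
rewrite Mneg add0e => <-; rewrite MT; congr EFin.
have -> : - (r + n.+1%:R) = - q - 1 by rewrite /q -[n.+1%:R]natr1; ring.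
by rewrite big_ord_recr.
Qed.

Lemma remaining_gt0_ae n : {ae P, forall w, [/\ simple_points J w,
  forall k, (k < n)%N -> pick_hits J Jt k w & 0 < rem n w]}.
Proof.
apply: filterS2 simple_ae (hits_ae J0 simple_ae picks n) => w sw hw.
by split => //; exact: remaining_gt0.
Qed.

Lemma measurable_remaining_RV n : measurable_fun setT (rem n).
Proof.
apply: (@measurable_remaining R _ Omega J Jt n) => //.
Qed.

Lemma chain_laplace_remaining n l : 0 <= l ->
  (\int[P]_w (chain_weight n w * expR (- (l * rem n w)))%:E =
   (\prod_(k < n) (r + k%:R) *
     (1 + psi (fun x => l * `|x|)) `^ (- (r + n%:R)))%:E)%E.
Proof.
move=> l0; have tn := @testfun_norm R; rewrite -chain_laplace; last exact: testfunZ.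
have [N [mN PN subN]] := remaining_gt0_ae n.
have mw := measurable_chain_weight n.
have mr := @measurable_remaining_RV n.
apply: ge0_ae_eq_integral => //.
- by apply/measurable_EFinP/measurable_funM/measurable_expN/measurable_funM.
- apply/measurable_EFinP/measurable_funM/measurable_expN => //.
  have [mf f0 _] := testfunZ l0 tn.
  by apply: measurable_psum => // i; apply: (@measurable_unpicked R _ Omega J Jt n).
- by move=> w _; rewrite lee_fin mulr_ge0 ?expR_ge0// chain_weight_ge0.
- by move=> w _; rewrite lee_fin mulr_ge0 ?expR_ge0// chain_weight_ge0.
exists N; split => // w /= nw; apply: subN => -[sw hw _]; apply: nw => _.
rewrite remaining_psum// psumZ//; first by move=> j v; exact: unpicked_ge0.
exact: summable_unpicked.
Qed.

End system.

Section image.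
Variables (a h : nat -> R -> R) (n : nat).
Hypothesis sys : biasing_system rho a h.
Let w0 w : 0 <= chain_weight a h n w. Proof. exact: chain_weight_ge0. Qed.
Let mw : measurable_fun setT (chain_weight a h n). Proof. exact: measurable_chain_weight. Qed.
Let mr := @measurable_remaining_RV n.

Definition remaining_law := [the {measure set R -> \bar R} of
  weighted_image P measurableT w0 mw mr].

Lemma remaining_lawE (F : R -> \bar R) : measurable_fun setT F -> (forall t, 0 <= F t)%E ->
  (\int[remaining_law]_t F t = \int[P]_w ((chain_weight a h n w)%:E * F (rem n w)))%E.
Proof. by move=> mF F0; rewrite ge0_integral_weighted_image. Qed.

Lemma remaining_law_setT :
  remaining_law setT = (\prod_(k < n) (r + k%:R))%:E.
Proof.
have := chain_laplace_remaining sys n (lexx 0).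
have -> : psi (fun x => 0 * `|x|) = 0.
  rewrite levy_exponent.unlock integral0_eq// => x _.
  by rewrite mul0r oppr0 expR0 subrr mul0r.
rewrite addr0 powR1 mulr1 => <-; rewrite /= /weighted_image setTI preimage_setT.
by apply: eq_integral => w _; rewrite mul0r oppr0 expR0 mulr1.
Qed.

Lemma remaining_law_neg (A : set R) : measurable A -> A `<=` `]-oo, 0[ ->
  remaining_law A = 0%E.
Proof.
move=> mA A0; have [N [mN PN subN]] := remaining_gt0_ae n.
rewrite /= /weighted_image setTI; apply: null_set_integral => //.
- by rewrite -[_ @^-1` _]setTI; exact: mr.
- exact/measurable_EFinP/measurable_funTS.
- apply/negligibleP; first by rewrite -[_ @^-1` _]setTI; exact: mr.
  exists N; split => // w /A0 /=; rewrite in_itv/= => r_lt0; apply: subN => -[_ _].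
  by rewrite ltNge (ltW r_lt0).
Qed.
End image.

Lemma integral_chain_weight_indep n (a h b g : nat -> R -> R) (F : R -> \bar R) :
  biasing_system rho a h -> biasing_system rho b g ->
  measurable_fun setT F -> (forall t, 0 <= F t)%E ->
  (\int[P]_w ((chain_weight a h n w)%:E * F (rem n w)) =
   \int[P]_w ((chain_weight b g n w)%:E * F (rem n w)))%E.
Proof.
move=> sa sb mF F0.
rewrite -(remaining_lawE n sa mF F0) -(remaining_lawE n sb mF F0).
have mD : measurable (`[0, +oo[%classic : set R) by exact: measurable_itv.
have fin a' h' (s' : biasing_system rho a' h') :
    (remaining_law n s' `[0%R, +oo[%classic < +oo)%E.
  apply: (@le_lt_trans _ _ (remaining_law n s' setT)); first by apply: le_measure; rewrite ?inE.
  by have -> := remaining_law_setT n s'; rewrite ltry.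
have lapE a' h' (s' : biasing_system rho a' h') (k : nat) :
    (\int[remaining_law n s']_(t in `[0%R, +oo[) (expR (- (k%:R * t)))%:E =
     (\prod_(i < n) (r + i%:R) * (1 + psi (fun x => k%:R * `|x|)) `^ (- (r + n%:R)))%:E)%E.
  rewrite -(chain_laplace_remaining s' n (ler0n R k)) integral_mkcond.
  have mek : measurable_fun setT (fun t : R => (expR (- (k%:R * t)))%:E).
    by apply/measurable_EFinP/measurable_expN/measurable_funM.
  have mekD := measurable_patch mD mek.
  have ekD0 t : (0 <= ((fun t : R => (expR (- (k%:R * t)))%:E) \_ `[0%R, +oo[) t)%E.
    by rewrite patchE; case: ifP => // _; rewrite lee_fin expR_ge0.
  have mw := measurable_chain_weight s' n.
  rewrite remaining_lawE//; have [N [mN PN subN]] := remaining_gt0_ae n.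
  apply: ge0_ae_eq_integral => //.
  - apply: emeasurable_funM; first exact/measurable_EFinP.
    exact: (measurableT_comp mekD (@measurable_remaining_RV n)).
  - by apply/measurable_EFinP/measurable_funM/measurable_expN/measurable_funM/measurable_remaining_RV.
  - by move=> w _; rewrite mule_ge0// lee_fin (chain_weight_ge0 s').
  - by move=> w _; rewrite lee_fin mulr_ge0 ?expR_ge0// (chain_weight_ge0 s').
  exists N; split => // w /= nw; apply: subN => -[_ _ r_gt0]; apply: nw => _.
  by rewrite patchE ifT// mem_setE in_itv/= ltW.
apply: eq_measure_integral => A mA _.
have split0 a' h' (s' : biasing_system rho a' h') :
    remaining_law n s' A = remaining_law n s' (A `&` `[0%R, +oo[%classic).
  rewrite -{1}(setIT A) -(setUv `[0, +oo[%classic) setIUr measureU//.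
  - rewrite [X in (_ + X)%E]remaining_law_neg ?adde0//.
      by apply: measurableI => //; exact: measurableC.
    by move=> x [_] /=; rewrite !in_itv/= andbT => /negP; rewrite -ltNge.
  - exact: measurableI.
  - by apply: measurableI => //; exact: measurableC.
  - by rewrite setIACA setICr setI0.
rewrite !split0.
have := @laplace_unique R (remaining_law n sa) (remaining_law n sb) 1 ler01 (fin _ _ sa) (fin _ _ sb).
move=> lu; rewrite lu ?mul1e// => k; by rewrite mul1e !lapE.
Qed.

(** Integrating [h n] against the weight of the system [a] cancels its denominator and leaves the
    bare product. The law of T_n under that weight may then be computed with any other system; in
    the applications [b] is constantly 1. *)
Lemma integral_prod_residual n (a h b g : nat -> R -> R) :
  biasing_system rho a h -> biasing_system rho b g ->
  (\int[P]_w (\prod_(k < n) a k (residual_fraction J Jt k w))%:E =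
   \int[P]_w (chain_weight b g n w * h n (rem n w))%:E)%E.
Proof.
move=> sa sb; have mr := @measurable_remaining_RV n.
have mh := biasing_h_meas sa n; have h0 := biasing_h_ge0 sa n.
have mhE : measurable_fun setT (fun t => (h n t)%:E) by exact/measurable_EFinP.
have hE0 t : (0 <= (h n t)%:E)%E by rewrite lee_fin.
under [RHS]eq_integral do rewrite EFinM.
rewrite -(integral_chain_weight_indep n sa sb mhE hE0); have [N [mN PN subN]] := remaining_gt0_ae n.
have mJt k : (k < n)%N -> measurable_fun setT (Jt k) by [].
have mJ j : measurable_fun setT (J j) by [].
apply: ge0_ae_eq_integral => //.
- apply/measurable_EFinP/measurable_prod => k _; apply: measurableT_comp.
    exact: (biasing_a_meas sa).
  exact: (measurable_residual_fraction J0 mJ mJt).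
- apply/measurable_EFinP/measurable_funM; first exact: measurable_chain_weight sa n.
  exact: measurableT_comp.
- by move=> w _; rewrite lee_fin prodr_ge0// => k _; exact: (biasing_a_ge0 sa).
- by move=> w _; rewrite lee_fin mulr_ge0// (chain_weight_ge0 sa).
exists N; split => // w /= nw; apply: subN => -[_ _ r_gt0]; apply: nw => _.
by rewrite -EFinM /chain_weight divfK// gt_eqF// (biasing_h_gt0 sa).
Qed.

End chain.

(** * The gamma and stable densities *)

Lemma integral_expRN (R : realType) :
  (\int[@lebesgue_measure R]_(x in `]0%R, +oo[) (expR (- x))%:E = 1)%E.
Proof.
rewrite -(@integral_exponential_pdf R 1 ltr01) integral_itv_obnd_cbnd; last first.
  by apply/measurable_EFinP/measurable_funTS/measurable_expN.
rewrite integral_mkcond; apply: eq_integral => x _; rewrite patchE.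
case: ifPn => x0; first by move: x0; rewrite mem_setE in_itv/= andbT => x0; rewrite exponential_pdfE// mul1r mulN1r.
by rewrite /exponential_pdf patchE (negbTE x0).
Qed.

Lemma ge0_integral_ln (R : realType) (p : R) (F : R -> \bar R) : 0 < p ->
  measurable_fun setT F -> (forall x, 0 <= F x)%E ->
  (\int[lebesgue_measure]_(x in `]0%R, +oo[) F x =
   \int[lebesgue_measure]_(u in `]0%R, 1%R[) ((p / u)%:E * F (- (p * ln u))%R))%E.
Proof.
move=> p0 mF F0.
(* The substitution lemma wants a weight nonnegative on the whole line; on the unit interval the
   absolute value disappears. *)
pose w (u : R) := `|p / u|.
have w0 u : 0 <= w u by exact: normr_ge0.
have mpu : measurable_fun setT (fun u : R => p / u).
  by apply: measurable_funM => //; exact: measurable_inv.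
have wE (u : R) : 0 < u -> w u = p / u by move=> u0; rewrite /w ger0_norm// divr_ge0// ltW.
transitivity (\int[lebesgue_measure]_(u in `]0%R, 1%R[) ((w u)%:E * F (- (p * ln u))%R))%E.
  apply: (@ge0_substitution R `]0, 1[ (fun u => - (p * ln u)) w) => //.
  - by apply: measurable_funN; apply: measurable_funM => //; exact: measurable_ln.
  - by apply: measurableT_comp => //; exact: normr_measurable.
  - move=> u /=; rewrite in_itv/= => /andP[u0 u1].
    by rewrite oppr_gt0 pmulr_rlt0// ln_lt0// u0.
  - move=> a b a0 ab.
    have b0 : 0 < b by exact: le_lt_trans ab.
    have key (u : R) : 0 < u ->
        (a < - (p * ln u) <= b) = (expR (- (b / p)) <= u < expR (- (a / p))).
      move=> u0; have uE : u = expR (ln u) by rewrite lnK ?posrE.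
      rewrite [in RHS]uE ler_expR ltr_expR lerNl ltrNr andbC.
      by rewrite -!mulNr ler_pdivrMr// ltr_pdivlMr// ![ln u * _]mulrC.
    have -> : `]0%R, 1%R[ `&` (fun u => - (p * ln u)) @^-1` `]a, b] =
        `[expR (- (b / p)), expR (- (a / p))[%classic.
      apply/seteqP; split => u /=; rewrite !in_itv/=.
        by move=> [/andP[u0 u1]]; rewrite key.
      move=> h; have u0 : 0 < u by case/andP: h => h _; exact: lt_le_trans (expR_gt0 _) h.
      rewrite key// u0; split => //; case/andP: h => _ /lt_le_trans; apply.
      by rewrite -expR0 ler_expR oppr_le0 divr_ge0// ltW.
    set c := expR _; set e := expR _.
    have ce : c < e by rewrite ltr_expR ltrN2 ltr_pM2r// invr_gt0.
    have c0 : 0 < c by exact: expR_gt0.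
    have D x : c <= x <= e -> is_derive x 1 (fun u : R => p * ln u) (p / x).
      move=> /andP[cx _]; have x0 : 0 < x by exact: lt_le_trans cx.
      have H := is_derive1_ln x0.
      by apply: is_derive_eq.
    have -> : (\int[lebesgue_measure]_(u in `[c, e[) (w u)%:E =
        \int[lebesgue_measure]_(u in `[c, e[) (p / u)%:E)%E.
      apply: eq_integral => u; rewrite mem_setE in_itv/= => /andP[cu _].
      by rewrite wE// (lt_le_trans c0).
    rewrite integral_itv_bndo_bndc; last exact/measurable_EFinP/measurable_funTS.
    rewrite (integral_derive_itvcc ce D).
      by congr EFin; rewrite /c /e !expRK; field; rewrite gt_eqF.
    move=> x /andP[cx _]; have x0 : 0 < x by exact: lt_le_trans cx.
    apply: (@continuousM _ _ (fun=> p)); first exact: cvg_cst.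
    by apply: inv_continuous; rewrite gt_eqF.
apply: eq_integral => u; rewrite mem_setE in_itv/= => /andP[u0 _].
by rewrite wE.
Qed.

(** The substitution x = - p ln u turns e^(-x) into u^p, so this is the total mass of the
    exponential law; no limit at the singular endpoint 0 has to be taken. *)
Lemma integral_powR01 (R : realType) (p : R) : 0 < p ->
  (\int[@lebesgue_measure R]_(u in `]0%R, 1%R[) (u `^ (p - 1))%:E = (p^-1)%:E)%E.
Proof.
move=> p0; have := @ge0_integral_ln R p (fun x => (expR (- x))%:E) p0.
rewrite integral_expRN => H.
rewrite -[RHS]mule1 H; last 2 first.
- by apply/measurable_EFinP/measurable_expN.
- by move=> x; rewrite lee_fin expR_ge0.
rewrite -ge0_integralZl//; last 3 first.
- apply: measurable_funTS; apply: emeasurable_funM; apply/measurable_EFinP.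
    by apply: measurable_funM => //; exact: measurable_inv.
  by apply: measurable_expN; apply: measurable_funN; apply: measurable_funM => //.
- move=> u /=; rewrite in_itv/= => /andP[u0 _].
  by rewrite -EFinM lee_fin mulr_ge0 ?expR_ge0// divr_ge0// ltW.
- by rewrite lee_fin invr_ge0 ltW.
apply: eq_integral => u; rewrite mem_setE in_itv/= => /andP[u0 _].
rewrite opprK -EFinM; congr EFin.
have un0 : u != 0 by rewrite gt_eqF.
rewrite powRB ?un0 ?implybT// powRr1 ?ltW// /powR (negbTE un0).
by field; rewrite un0 gt_eqF.
Qed.

Section gamma_density.
Context (R : realType) (theta : R).
Hypothesis theta_gt0 : 0 < theta.
Local Notation mu := (@lebesgue_measure R).

(* The absolute value only serves to have a density nonnegative on the whole line. *)
Definition gamma_density (x : R) : R := theta * expR (- x) / `|x|.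

Lemma measurable_gamma_density : measurable_fun setT gamma_density.
Proof.
apply: measurable_funM; first by apply: measurable_funM => //; exact: measurable_expN.
apply: (measurableT_comp (@measurable_inv R)); exact: normr_measurable.
Qed.

Lemma gamma_density_ge0 x : 0 <= gamma_density x.
Proof. by rewrite divr_ge0// mulr_ge0 ?expR_ge0// ltW. Qed.

Lemma gamma_densityE x : 0 < x -> gamma_density x = theta * expR (- x) / x.
Proof. by move=> x0; rewrite /gamma_density gtr0_norm. Qed.

Lemma gamma_density_gt0 x : 0 < x -> 0 < gamma_density x.
Proof. by move=> x0; rewrite gamma_densityE// divr_gt0// mulr_gt0// expR_gt0. Qed.

Lemma gamma_density_levy :
  (\int[mu]_(x in `]0%R, +oo[) (Num.min x 1 * gamma_density x)%:E < +oo)%E.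
Proof.
apply: (@le_lt_trans _ _ (\int[mu]_(x in `]0%R, +oo[) (theta%:E * (expR (- x))%:E))%E).
  apply: ge0_le_integral => //.
  - move=> x /=; rewrite in_itv/= andbT => x0.
    by rewrite lee_fin mulr_ge0 ?gamma_density_ge0// le_min ltW//= ler01.
  - apply/measurable_EFinP/measurable_funTS/measurable_funM; last exact: measurable_gamma_density.
    exact: measurable_minr.
  - by apply/measurable_EFinP/measurable_funTS/measurable_funM => //; exact: measurable_expN.
  move=> x /=; rewrite in_itv/= andbT => x0.
  rewrite -EFinM (_ : theta * expR (- x) = x * gamma_density x); last first.
    by rewrite gamma_densityE//; field; rewrite gt_eqF.
  by rewrite lee_fin ler_wpM2r ?gamma_density_ge0// ge_min lexx.
rewrite ge0_integralZl//.
- by rewrite integral_expRN mule1 ltry.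
- by apply/measurable_EFinP/measurable_funTS/measurable_expN.
- by rewrite lee_fin ltW.
Qed.

Lemma gamma_density_bounded (a : R) : 0 < a ->
  exists K, forall x, a <= x -> gamma_density x <= K.
Proof.
move=> a0; exists (theta / a) => x ax; have x0 : 0 < x by exact: lt_le_trans ax.
rewrite gamma_densityE// ler_pM ?invr_ge0 ?mulr_ge0 ?expR_ge0 ?(ltW theta_gt0) ?(ltW x0)//.
  by rewrite ger_pMr// -expR0 ler_expR oppr_le0 ltW.
by rewrite lef_pV2.
Qed.
End gamma_density.

Section stable_density.
Context (R : realType) (alpha C : R).
Hypotheses (alpha_gt0 : 0 < alpha) (alpha_lt1 : alpha < 1) (C_gt0 : 0 < C).
Local Notation mu := (@lebesgue_measure R).

Definition stable_density (x : R) : R := C * alpha * x `^ (- alpha - 1).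

Lemma measurable_stable_density : measurable_fun setT stable_density.
Proof. by apply: measurable_funM => //; exact: measurable_powR. Qed.

Lemma stable_density_ge0 x : 0 <= stable_density x.
Proof. by rewrite mulr_ge0 ?powR_ge0// mulr_ge0// ltW. Qed.

Lemma stable_density_gt0 x : 0 < x -> 0 < stable_density x.
Proof. by move=> x0; rewrite mulr_gt0 ?powR_gt0// mulr_gt0. Qed.

Lemma ler_powRN (x y s : R) : 0 < x -> x <= y -> 0 <= s -> y `^ (- s) <= x `^ (- s).
Proof.
move=> x0 xy s0; have y0 : 0 < y by exact: lt_le_trans xy.
rewrite !powRN lef_pV2 ?posrE ?powR_gt0//.
by apply: ge0_ler_powR => //; rewrite nnegrE ltW.
Qed.

Let alpha1 : - alpha - 1 = - (alpha + 1). Proof. by rewrite opprD. Qed.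
Let alpha1_ge0 : 0 <= alpha + 1. Proof. by rewrite addr_ge0// ltW. Qed.

Lemma stable_density_bounded (a : R) : 0 < a ->
  exists K, forall x, a <= x -> stable_density x <= K.
Proof.
move=> a0; exists (stable_density a) => x ax; rewrite ler_wpM2l//; first by rewrite mulr_ge0// ltW.
by rewrite alpha1 ler_powRN.
Qed.

Lemma stable_density_levy :
  (\int[mu]_(x in `]0%R, +oo[) (Num.min x 1 * stable_density x)%:E < +oo)%E.
Proof.
pose k : R := C * alpha.
have k0 : 0 <= k by rewrite mulr_ge0// ltW.
(* From 1 + x <= 2 x for x >= 1, which compares x^(-alpha-1) with the shifted power [far]. The
   latter has no singularity at 0 and is integrated by u = 1/(1 + x). *)
pose K : R := 2 `^ (alpha + 1).
pose near0 (x : R) : R := x `^ (1 - alpha - 1).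
pose far (x : R) : R := (1 + x) `^ (- alpha - 1).
have mnear : measurable_fun setT near0 by exact: measurable_powR.
have mfar : measurable_fun setT far.
  rewrite /far.
  apply: (@measurableT_comp _ _ _ _ _ _ (fun y : R => y `^ (- alpha - 1)) _ (fun x : R => 1 + x)).
    exact: measurable_powR.
  exact: measurable_funD.
have m1near : measurable_fun setT (fun x : R => \1_(`]0, 1[) x * near0 x).
  by apply: measurable_funM => //; apply: measurable_indic; exact: measurable_itv.
apply: (@le_lt_trans _ _ (\int[mu]_(x in `]0%R, +oo[)
   (k%:E * (\1_(`]0, 1[) x * near0 x)%:E + (k * K)%:E * (far x)%:E))%E).
  apply: ge0_le_integral => //.
  - move=> x /=; rewrite in_itv/= andbT => x0.
    by rewrite lee_fin mulr_ge0 ?stable_density_ge0// le_min ltW//= ler01.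
  - apply/measurable_EFinP/measurable_funTS/measurable_funM; last exact: measurable_stable_density.
    exact: measurable_minr.
  - apply/measurable_EFinP/measurable_funTS/measurable_funD; exact: measurable_funM.
  move=> x /=; rewrite in_itv/= andbT => x0; rewrite -!EFinM -EFinD lee_fin.
  have -> : Num.min x 1 * stable_density x = k * (Num.min x 1 * x `^ (- alpha - 1)).
    by rewrite /stable_density -/k mulrCA.
  rewrite -[k * K * _]mulrA -mulrDr ler_wpM2l//.
  have f0 : 0 <= K * far x by rewrite mulr_ge0// powR_ge0.
  have [x1|x1] := ltP x 1.
    rewrite indicE mem_set ?mul1r/= ?in_itv/= ?x0// /near0.
    have -> : 1 - alpha - 1 = 1 + (- alpha - 1) by rewrite addrA.
    by rewrite (@powRD _ x 1) ?(gt_eqF x0) ?implybT// powRr1 ?lerDl// ltW.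
  rewrite mul1r indicE memNset; last by rewrite /= in_itv/= x0/=; apply/negP; rewrite -leNgt.
  rewrite mul0r add0r /K /far alpha1.
  have h : (2 * x) `^ (- (alpha + 1)) <= (1 + x) `^ (- (alpha + 1)).
    by apply: ler_powRN => //; lra.
  rewrite powRM ?(ltW x0)// powRN in h.
  by rewrite -ler_pdivrMl ?powR_gt0.
have mI : measurable (`]0, 1[%classic : set R) by exact: measurable_itv.
rewrite ge0_integralD//.
- rewrite !ge0_integralZl//.
  + have -> : (\int[mu]_(x in `]0%R, +oo[) (\1_(`]0%R, 1%R[) x * near0 x)%:E =
        ((1 - alpha)^-1)%:E)%E.
      rewrite -integral_powR01; last by rewrite subr_gt0.
      rewrite integral_mkcond [RHS]integral_mkcond; apply: eq_integral => x _.
      rewrite !patchE indicE !mem_setE !in_itv/= andbT.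
      by case: (0 < x); rewrite //=; case: (x < 1); rewrite ?mul1r ?mul0r.
    have -> : (\int[mu]_(x in `]0%R, +oo[) (far x)%:E = (alpha^-1)%:E)%E.
      rewrite (@ge0_integral_fraction R 1)//; last 2 first.
      - exact/measurable_EFinP.
      - by move=> x; rewrite lee_fin powR_ge0.
      rewrite -integral_powR01//; apply: eq_integral => u.
      rewrite mem_setE in_itv/= => /andP[u0 u1]; rewrite -EFinM; congr EFin.
      have un0 : u != 0 by rewrite gt_eqF.
      have -> : alpha - 1 = - 2%:R + (alpha + 1) by ring.
      rewrite powRD ?un0 ?implybT// powR_invn ?ltW// /far mul1r addrC subrK; congr (_ * _).
      by rewrite mul1r alpha1 -(powR_inv1 (ltW u0)) -powRrM mulN1r opprK.
    by rewrite -!EFinM -EFinD ltry.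
  + exact/measurable_EFinP/measurable_funTS.
  + by move=> x _; rewrite lee_fin powR_ge0.
  + by rewrite lee_fin mulr_ge0// powR_ge0.
  + exact/measurable_EFinP/measurable_funTS.
  + by move=> x _; rewrite lee_fin mulr_ge0// powR_ge0.
- by move=> x _; rewrite -EFinM lee_fin mulr_ge0// mulr_ge0// powR_ge0.
- exact/measurable_EFinP/measurable_funTS/measurable_funM.
- by move=> x _; rewrite -EFinM lee_fin mulr_ge0 ?powR_ge0// mulr_ge0// powR_ge0.
- exact/measurable_EFinP/measurable_funTS/measurable_funM.
Qed.

(** The unnormalised Beta((n + 1) alpha, 1 - alpha) density; the second exponent is kept in the form
    b - 1 of [beta_law]. *)
Definition beta_weight (n : nat) (u : R) : R :=
  u `^ (n.+1%:R * alpha - 1) * (1 - u) `^ (1 - alpha - 1).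

Lemma beta_weight_ge0 n u : 0 <= beta_weight n u.
Proof. by rewrite mulr_ge0// powR_ge0. Qed.

Lemma measurable_beta_weight n : measurable_fun setT (beta_weight n).
Proof.
apply: measurable_funM; first exact: measurable_powR.
apply: (@measurableT_comp _ _ _ _ _ _ (fun y : R => y `^ (1 - alpha - 1)) _ (fun u : R => 1 - u)).
  exact: measurable_powR.
exact: measurable_funB.
Qed.

(** All the powers are homogeneous, so the substitution u = t/(t + x) separates [t] from [u]. The
    density contributes t^(-alpha) and a Beta weight, which is why a bias function proportional to
    t^(-n alpha) is sent to one proportional to t^(-(n+1) alpha). *)
Lemma stable_biasing_integral (b : R -> R) (n : nat) (t : R) : 0 < t ->
  measurable_fun setT b -> (forall u, 0 <= b u) ->
  (\int[mu]_(x in `]0%R, +oo[)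
     (x * stable_density x * (b (t / (t + x)) * (t + x) `^ (- (n%:R * alpha)) / (t + x)))%:E =
   (C * alpha * t `^ (- (n.+1%:R * alpha)))%:E *
   \int[mu]_(u in `]0%R, 1%R[) (b u * beta_weight n u)%:E)%E.
Proof.
move=> t0 mb b0.
have mtx : measurable_fun setT (fun x : R => t + x) by exact: measurable_funD.
have minv := @measurable_inv R.
pose G (x : R) : R := `|x| * stable_density x *
  (b (t / (t + x)) * (t + x) `^ (- (n%:R * alpha)) / `|t + x|).
have mG : measurable_fun setT G.
  apply: measurable_funM.
    by apply: measurable_funM; [exact: normr_measurable|exact: measurable_stable_density].
  apply: measurable_funM.
    apply: measurable_funM.
      apply: measurableT_comp => //; apply: measurable_funM => //.
      exact: (measurableT_comp minv).
    apply: (@measurableT_comp _ _ _ _ _ _ (fun y : R => y `^ _) _ (fun x : R => t + x)) => //.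
  apply: (measurableT_comp minv); apply: measurableT_comp => //; exact: normr_measurable.
transitivity (\int[mu]_(x in `]0%R, +oo[) (G x)%:E)%E.
  apply: eq_integral => x; rewrite mem_setE in_itv/= andbT => x0.
  by rewrite /G !gtr0_norm// addr_gt0.
rewrite (ge0_integral_fraction t0)//; last 2 first.
- exact/measurable_EFinP.
- move=> x; rewrite lee_fin mulr_ge0//; first by rewrite mulr_ge0// stable_density_ge0.
  by rewrite mulr_ge0// mulr_ge0// powR_ge0.
rewrite -ge0_integralZl//; last 3 first.
- apply/measurable_EFinP/measurable_funTS/measurable_funM => //; exact: measurable_beta_weight.
- by move=> u _; rewrite lee_fin mulr_ge0// beta_weight_ge0.
- by rewrite lee_fin mulr_ge0 ?powR_ge0// mulr_ge0// ltW.
apply: eq_integral => u; rewrite mem_setE in_itv/= => /andP[u0 u1]; rewrite -!EFinM; congr EFin.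
have un0 : u != 0 by rewrite gt_eqF.
have tn0 : t != 0 by rewrite gt_eqF.
have v0 : 0 < 1 - u by rewrite subr_gt0.
have xE : t / u - t = t * (1 - u) / u by field.
have x0 : 0 < t / u - t by rewrite xE divr_gt0// mulr_gt0.
have txE : t + (t / u - t) = t / u by rewrite addrC subrK.
rewrite /G txE !gtr0_norm ?divr_gt0// (_ : t / (t / u) = u); last by field; rewrite un0 tn0.
rewrite /stable_density /beta_weight.
set x := t / u - t in x0 xE *.
have invpow (p : R) : u^-1 `^ (- p) = u `^ p.
  by rewrite -(powR_inv1 (ltW u0)) -powRrM mulN1r opprK.
have e1 : x * x `^ (- alpha - 1) = t `^ (- alpha) * (1 - u) `^ (1 - alpha - 1) * u `^ alpha.
  have -> : x * x `^ (- alpha - 1) = x `^ (- alpha).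
    rewrite [in RHS](_ : - alpha = 1 + (- alpha - 1)); last by ring.
    by rewrite (@powRD _ x 1) ?(gt_eqF x0) ?implybT// powRr1 ?ltW.
  rewrite xE !powRM ?mulr_ge0 ?invr_ge0 ?(ltW t0) ?(ltW v0) ?(ltW u0)// invpow.
  by congr (_ * _ `^ _ * _); ring.
have e2 : (t / u) `^ (- (n%:R * alpha)) = t `^ (- (n%:R * alpha)) * u `^ (n%:R * alpha).
  by rewrite powRM ?invr_ge0 ?(ltW t0) ?(ltW u0)// invpow.
have e3 : u `^ (n.+1%:R * alpha - 1) = u `^ alpha * u `^ (n%:R * alpha) / u.
  rewrite (_ : n.+1%:R * alpha - 1 = alpha + n%:R * alpha + (- 1)); last by rewrite -natr1; ring.
  by rewrite !powRD ?un0 ?implybT// powR_inv1// ltW.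
have e4 : t `^ (- (n.+1%:R * alpha)) = t `^ (- alpha) * t `^ (- (n%:R * alpha)).
  rewrite -powRD ?tn0 ?implybT//; congr (_ `^ _); rewrite -natr1; ring.
rewrite (mulrCA x) e1 e2 e3 e4; field; rewrite un0 tn0//.
Qed.

Definition beta_integral (n : nat) (b : R -> R) : R :=
  fine (\int[mu]_(u in `]0%R, 1%R[) (b u * beta_weight n u)%:E)%E.

Section beta_integral.
Variables (b : R -> R) (A : R) (n : nat).
Hypotheses (mb : measurable_fun setT b) (b0 : forall u, 0 <= b u) (bA : forall u, b u <= A).

(** Finiteness is read off the Levy condition: by the substitution at [t = 1], a positive multiple
    of this integral is the integral of the stable density against a function bounded by a multiple
    of min(x, 1). *)
Lemma beta_integralE :
  (\int[mu]_(u in `]0%R, 1%R[) (b u * beta_weight n u)%:E = (beta_integral n b)%:E)%E.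
Proof.
have Ca0 : 0 < C * alpha by rewrite mulr_gt0.
have I0 : (0 <= \int[mu]_(u in `]0%R, 1%R[) (b u * beta_weight n u)%:E)%E.
  by apply: integral_ge0 => u _; rewrite lee_fin mulr_ge0// beta_weight_ge0.
rewrite /beta_integral fineK// ge0_fin_numE//.
have := stable_biasing_integral n ltr01 mb b0; rewrite powR1 mulr1.
set L := integral _ _ _ => LE.
have : (L < +oo)%E.
  have m1 : measurable_fun setT (fun x : R => 1 + x) by exact: measurable_funD.
  have minv := @measurable_inv R.
  have A0 : 0 <= A by exact: le_trans (bA 0).
  rewrite /L; under eq_integral do rewrite mulrAC.
  apply: (integral_lty_levy measurable_stable_density stable_density_ge0 stable_density_levy _ _ A0).
  - apply: measurable_funM => //; apply: measurable_funM; last exact: (measurableT_comp minv).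
    apply: measurable_funM.
      apply: measurableT_comp => //; apply: measurable_funM => //.
      exact: (measurableT_comp minv).
    by apply: (@measurableT_comp _ _ _ _ _ _ (fun y : R => y `^ _) _ (fun x : R => 1 + x)).
  - move=> x x0; rewrite mulr_ge0 ?(ltW x0)// mulr_ge0 ?invr_ge0 ?addr_ge0 ?(ltW x0)//.
    by rewrite mulr_ge0// powR_ge0.
  - move=> x x0; have x1 : 1 <= 1 + x by lra.
    have p1 : (1 + x) `^ (- (n%:R * alpha)) <= 1.
      by have := @ler_powRN 1 (1 + x) (n%:R * alpha) ltr01 x1; rewrite powR1; apply; rewrite mulr_ge0 ?(ltW alpha_gt0).
    have q1 : b (1 / (1 + x)) * (1 + x) `^ (- (n%:R * alpha)) <= A.
      by rewrite -[leRHS]mulr1 ler_pM// powR_ge0.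
    rewrite mulrCA ler_pM//.
    + by rewrite mulr_ge0// powR_ge0.
    + by rewrite divr_ge0// ?ltW//; lra.
    + have x1_gt0 : 0 < 1 + x by lra.
      by rewrite le_min !ler_pdivrMr//; apply/andP; split; nra.
rewrite LE; move: I0; move: (integral _ _ _) => [z||] // _; first by move=> _; exact: ltry.
by rewrite gt0_muley// lte_fin.
Qed.

Lemma beta_integral_gt0 : (forall u, 0 < b u) -> 0 < beta_integral n b.
Proof.
move=> b_gt0; rewrite -lte_fin -beta_integralE; apply: integral_gt0 => //.
- by apply/measurable_EFinP/measurable_funTS/measurable_funM => //; exact: measurable_beta_weight.
- move=> u /=; rewrite in_itv/= => /andP[u0 u1].
  by rewrite lte_fin mulr_gt0// mulr_gt0// powR_gt0// subr_gt0.
- suff : (0 < lebesgue_measure (`]0%R, 1%R[%classic : set R))%E by [].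
  by rewrite lebesgue_measure_itv/= lte_fin ltr01 oppr0 adde0.
Qed.
End beta_integral.

Definition stable_bias (a : nat -> R -> R) (n : nat) (t : R) : R :=
  (\prod_(k < n) (C * alpha * beta_integral k (a k))) * t `^ (- (n%:R * alpha)).

Lemma stable_biasing_system (a : nat -> R -> R) (A : R) :
  (forall n, measurable_fun setT (a n)) -> (forall n u, 0 < a n u <= A) ->
  biasing_system stable_density a (stable_bias a).
Proof.
move=> ma a01.
have a_gt0 n u : 0 < a n u by case/andP: (a01 n u).
have a_ge0 n u : 0 <= a n u by exact: ltW.
have aA n u : a n u <= A by case/andP: (a01 n u).
have Ca0 : 0 < C * alpha by rewrite mulr_gt0.
have c0 n : 0 < \prod_(k < n) (C * alpha * beta_integral k (a k)).
  by apply: prodr_gt0 => k _; rewrite mulr_gt0//; exact: beta_integral_gt0.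
split => //.
- by move=> n t; rewrite mulr_ge0 ?powR_ge0// ltW.
- by move=> n; apply: measurable_funM => //; exact: measurable_powR.
- by move=> n t t0; rewrite mulr_gt0// powR_gt0.
- by move=> t; rewrite /stable_bias big_ord0 mul0r oppr0 powRr0 mul1r.
move=> n t t0; pose c := \prod_(k < n) (C * alpha * beta_integral k (a k)).
have mtx : measurable_fun setT (fun x : R => t + x) by exact: measurable_funD.
have minv := @measurable_inv R.
transitivity (c%:E * \int[mu]_(x in `]0%R, +oo[)
  (x * stable_density x * (a n (t / (t + x)) * (t + x) `^ (- (n%:R * alpha)) / (t + x)))%:E)%E.
  rewrite -ge0_integralZl//.
  - by apply: eq_integral => x _; rewrite -EFinM; congr EFin; rewrite /stable_bias -/c; ring.
  - apply/measurable_EFinP/measurable_funTS/measurable_funM.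
      by apply: measurable_funM => //; exact: measurable_stable_density.
    apply: measurable_funM; last exact: (measurableT_comp minv).
    apply: measurable_funM.
      apply: measurableT_comp => //; apply: measurable_funM => //.
      exact: (measurableT_comp minv).
    by apply: (@measurableT_comp _ _ _ _ _ _ (fun y : R => y `^ _) _ (fun x : R => t + x)).
  - move=> x /=; rewrite in_itv/= andbT => x0.
    rewrite lee_fin mulr_ge0//; first by rewrite mulr_ge0 ?stable_density_ge0// ltW.
    by rewrite mulr_ge0 ?invr_ge0 ?addr_ge0 ?(ltW t0) ?(ltW x0)// mulr_ge0// powR_ge0.
  - by rewrite lee_fin; apply: ltW; exact: c0.
rewrite stable_biasing_integral// (@beta_integralE _ A)// -!EFinM; congr EFin.
by rewrite /stable_bias big_ord_recr/= -/c; ring.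
Qed.

Lemma beta_normE n : beta_norm (n.+1%:R * alpha) (1 - alpha) = beta_integral n (fun=> 1).
Proof. by congr fine; apply: eq_integral => u _; rewrite mul1r. Qed.

Lemma beta_integral1_gt0 n : 0 < beta_integral n (fun=> 1).
Proof. by apply: (@beta_integral_gt0 _ 1). Qed.

Lemma beta_lawE n (A : set R) : measurable A ->
  beta_law (n.+1%:R * alpha) (1 - alpha) A =
  (beta_integral n \1_A / beta_integral n (fun=> 1))%:E.
Proof.
move=> mA; have N0 := beta_integral1_gt0 n.
have m1 : measurable_fun setT (\1_A : R -> R) by exact: measurable_indic.
have A1 u : (\1_A u : R) <= 1 by rewrite indicE; case: (_ \in _) => //; exact: ler01.
rewrite (mulrC (beta_integral _ _)) EFinM -(beta_integralE (A := 1))// -ge0_integralZl//; last 3 first.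
- apply/measurable_EFinP/measurable_funTS/measurable_funM => //; exact: measurable_beta_weight.
- by move=> u _; rewrite lee_fin mulr_ge0// beta_weight_ge0.
- by rewrite lee_fin invr_ge0 ltW.
rewrite /beta_law setIC beta_normE integral_mkcondr; apply: eq_integral => u _.
rewrite patchE indicE /beta_weight; case: (u \in A); last by rewrite mul0r mule0.
by rewrite -EFinM mul1r mulrC.
Qed.

End stable_density.

(** * Residual fractions for the stable density *)

Section stable_residual.
Context (R : realType) (alpha C : R).
Hypotheses (alpha_gt0 : 0 < alpha) (alpha_lt1 : alpha < 1) (C_gt0 : 0 < C).
Context d (Omega : measurableType d) (P : probability Omega R).
Variables (J Jt : nat -> {RV P >-> R}) (r : R).
Hypothesis r0 : 0 <= r.
Hypothesis J0 : forall j w, 0 <= J j w.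
Hypothesis simple_ae : {ae P, forall w, simple_points J w}.
Hypothesis picks : is_size_biased_picks J Jt.
Local Notation rho := (stable_density alpha C).
Hypothesis laplace_functional : forall f, testfun f ->
  (\int[P]_w (expR (- psum J f w))%:E = ((1 + levy_exponent rho f) `^ (- r))%:E)%E.

(* Weighting only the last fraction, by [1 + \1_A], keeps the weight positive. *)
Lemma stable_residual_law n :
  has_law P (residual_fraction J Jt n) (beta_law (n.+1%:R * alpha) (1 - alpha)).
Proof.
move=> A mA.
have mU : measurable_fun setT (residual_fraction J Jt n).
  have mJ j : measurable_fun setT (J j) by [].
  have mJt k : (k < n.+1)%N -> measurable_fun setT (Jt k) by [].
  exact: (measurable_residual_fraction J0 mJ mJt).
pose a k (u : R) : R := 1 + (if k == n then \1_A u else 0).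
pose b (k : nat) (u : R) : R := 1.
have ma k : measurable_fun setT (a k).
  by apply: measurable_funD => //; case: (k == n) => //; exact: measurable_indic.
have mb k : measurable_fun setT (b k) by exact: measurable_cst.
have A1 (u : R) : 0 <= (\1_A u : R) <= 1 by rewrite indicE; case: (_ \in _); rewrite /= ?lexx ?ler01.
have a2 k u : 0 < a k u <= 2.
  by rewrite /a; have := A1 u; case: (k == n); lra.
have b2 k u : 0 < b k u <= 2 by rewrite /b; lra.
have sa := stable_biasing_system alpha_gt0 alpha_lt1 C_gt0 ma a2.
have sb := stable_biasing_system alpha_gt0 alpha_lt1 C_gt0 mb b2.
have := integral_prod_residual (@measurable_stable_density R alpha C)
  (stable_density_ge0 alpha_gt0 C_gt0) (stable_density_levy alpha_gt0 alpha_lt1 C_gt0)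
  (stable_density_gt0 alpha_gt0 C_gt0) r0 J0 simple_ae picks laplace_functional n.+1 sa sb.
have mUA : measurable (residual_fraction J Jt n @^-1` A) by rewrite -[_ @^-1` _]setTI; exact: mU.
have -> : (\int[P]_w (\prod_(k < n.+1) a k (residual_fraction J Jt k w))%:E =
    1 + P (residual_fraction J Jt n @^-1` A))%E.
  transitivity (\int[P]_w (1 + (\1_(residual_fraction J Jt n @^-1` A) w)%:E))%E.
    apply: eq_integral => w _; rewrite big_ord_recr/= big1 ?mul1r.
      by rewrite /a eqxx EFinD.
    by move=> k _; rewrite /a/= ltn_eqF ?addr0.
  rewrite ge0_integralD//.
  - have -> : (\int[P]__ 1 = 1)%E by rewrite integral_cst// mul1e; exact: probability_setT.
    by rewrite integral_indic// setIT.
  - exact/measurable_EFinP/measurable_indic.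
pose K := beta_integral alpha n (a n) / beta_integral alpha n (fun=> 1).
have I1 := beta_integral1_gt0 alpha_gt0 alpha_lt1 C_gt0 n.
(* The two bias functions share the power of T and the first [n] constants and differ only in the
   last constant. Their quotient, which is the integrand, is therefore almost surely [K]. *)
rewrite (_ : integral _ _ _ = K%:E); last first.
  transitivity (\int[P]_w (cst K%:E w))%E; last first.
    by rewrite integral_cst// [X in (_ * X)%E]probability_setT mule1.
  have [N [mN PN subN]] := remaining_gt0_ae J0 simple_ae picks n.+1.
  have mr := @measurable_remaining_RV R d Omega P J Jt J0 n.+1.
  have K0 : 0 <= K.
    by rewrite divr_ge0// ltW//; apply: (beta_integral_gt0 alpha_gt0 alpha_lt1 C_gt0 (A := 2)) => // u; case/andP: (a2 n u) => // /ltW.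
  apply: ge0_ae_eq_integral => //.
  - apply/measurable_EFinP/measurable_funM.
      apply: (@measurable_chain_weight _ _ _ _ _ _ _ J0 _ _ sb).
    apply: measurableT_comp => //; exact: (biasing_h_meas sa).
  - move=> w _; rewrite lee_fin mulr_ge0//; first exact: (chain_weight_ge0 _ _ sb).
    exact: (biasing_h_ge0 sa).
  exists N; split => // w /= nw; apply: subN => -[_ _ r_gt0]; apply: nw => _; congr EFin.
  rewrite /chain_weight big1// mul1r /stable_bias.
  set t := remaining _ _ _ _ in r_gt0 *.
  have ca (c : nat -> R -> R) : \prod_(k < n.+1) (C * alpha * beta_integral alpha k (c k)) =
      (\prod_(k < n) (C * alpha * beta_integral alpha k (c k))) * (C * alpha * beta_integral alpha n (c n)).
    by rewrite big_ord_recr.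
  rewrite !ca.
  have -> : \prod_(k < n) (C * alpha * beta_integral alpha k (a k)) =
      \prod_(k < n) (C * alpha * beta_integral alpha k (b k)).
    apply: eq_bigr => k _; congr (_ * fine _); apply: eq_integral => u _.
    by rewrite /a ltn_eqF// addr0.
  set p := \prod_(k < n) _.
  have p0 : 0 < p.
    apply: prodr_gt0 => k _; apply: mulr_gt0; first exact: mulr_gt0.
    exact: (beta_integral1_gt0 alpha_gt0 alpha_lt1 C_gt0).
  have tp : 0 < t `^ (- (n.+1%:R * alpha)) by exact: powR_gt0.
  rewrite /K /b; field; rewrite !gt_eqF//.
have -> : K = 1 + beta_integral alpha n \1_A / beta_integral alpha n (fun=> 1).
  transitivity ((beta_integral alpha n (fun=> 1) + beta_integral alpha n \1_A) /
    beta_integral alpha n (fun=> 1)); last by rewrite mulrDl divff// gt_eqF.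
  congr (_ / _); apply: EFin_inj; rewrite EFinD.
  have m1A : measurable_fun setT (\1_A : R -> R) by exact: measurable_indic.
  have a2' u : a n u <= 2 by case/andP: (a2 n u).
  have a0' u : 0 <= a n u by case/andP: (a2 n u) => /ltW.
  have A2 u : (\1_A u : R) <= 2 by have := A1 u; lra.
  have b2' (u : R) : (fun=> 1 : R) u <= 2 by lra.
  rewrite (esym (beta_integralE alpha_gt0 alpha_lt1 C_gt0 n (ma n) a0' a2')).
  rewrite (esym (beta_integralE alpha_gt0 alpha_lt1 C_gt0 n (mb 0) (fun=> ler01) b2')).
  rewrite (esym (beta_integralE alpha_gt0 alpha_lt1 C_gt0 n m1A _ A2)) => [|u]; last first.
    by case/andP: (A1 u).
  rewrite -ge0_integralD//; last 4 first.
  - by move=> u _; rewrite lee_fin mulr_ge0// beta_weight_ge0.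
  - by apply/measurable_EFinP/measurable_funTS/measurable_funM; [exact: (mb 0)|exact: measurable_beta_weight].
  - by move=> u _; rewrite lee_fin mulr_ge0// beta_weight_ge0.
  - by apply/measurable_EFinP/measurable_funTS/measurable_funM; [exact: m1A|exact: measurable_beta_weight].
  apply: eq_integral => u _; rewrite -EFinD; congr EFin.
  by rewrite /a eqxx mulrDl.
rewrite (beta_lawE alpha_gt0 alpha_lt1 C_gt0)// EFinD => /(congr1 (fun z => z - 1)%E).
by rewrite ![(1 + _)%E]addeC !addeK.
Qed.
End stable_residual.

(** * Residual fractions for the gamma density *)

Section gamma_bias.
Context (R : realType) (theta : R).
Hypothesis theta_gt0 : 0 < theta.
Local Notation mu := (@lebesgue_measure R).
Local Notation I01 := (`]0%R, 1%R[%classic).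
Variables (a : nat -> R -> R) (A : R).
Hypotheses (ma : forall n, measurable_fun setT (a n)) (a01 : forall n u, 0 < a n u <= A).

(** This is e^(-t) h_n(t). Because e^(-x) = e^t e^(-(t+x)), passing to e^(-t) h_n(t) turns the
    recursion into a multiplicative convolution in u = t/(t + x), which rescales the argument of the
    previous kernel by 1/u. *)
Fixpoint gamma_kernel (n : nat) (s : R) : R :=
  if n is m.+1
  then fine (\int[mu]_(u in I01) (theta * a m u / u * gamma_kernel m (s / u))%:E)%E
  else expR (- s).
Local Notation k := gamma_kernel.

Let a_gt0 n u : 0 < a n u. Proof. by case/andP: (a01 n u). Qed.
Let aA n u : a n u <= A. Proof. by case/andP: (a01 n u). Qed.
Let A_gt0 : 0 < A. Proof. exact: lt_le_trans (a_gt0 0 0) (aA 0 0). Qed.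
Let minv := @measurable_inv R.

Let mI01 : measurable (I01 : set R). Proof. exact: measurable_itv. Qed.

Lemma gamma_kernel_ge0 n s : 0 <= k n s.
Proof.
elim: n s => [|n IH] s /=; first exact: expR_ge0.
apply: fine_ge0; apply: integral_ge0 => u /=; rewrite in_itv/= => /andP[u0 _].
by rewrite lee_fin mulr_ge0// divr_ge0 ?ltW// mulr_gt0.
Qed.

Lemma measurable_gamma_kernel n : measurable_fun setT (k n).
Proof.
elim: n => [|n IH] /=; first exact: measurable_expN.
apply: measurableT_comp => //.
have H := @measurable_integral_in _ _ (measurableTypeR R) (measurableTypeR R) R mu I01
  (fun s u : R => (theta * a n u / u * k n (s / u))%:E) mI01.
apply: H.
- have mu2 : measurable_fun setT (fun z : R * R => z.2^-1) by exact: (measurableT_comp minv).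
  apply/measurable_EFinP; apply: measurable_funM.
    apply: measurable_funM => //; apply: measurable_funM => //.
    exact: (measurableT_comp (ma n)).
  by apply: measurableT_comp => //; exact: measurable_funM.
- move=> s u /=; rewrite in_itv/= => /andP[u0 _].
  by rewrite lee_fin mulr_ge0 ?gamma_kernel_ge0// divr_ge0 ?ltW// mulr_gt0.
Qed.

Let kernel_measurable n s :
  measurable_fun setT (fun u => (theta * a n u / u * k n (s / u))%:E).
Proof.
apply/measurable_EFinP; apply: measurable_funM.
  by apply: measurable_funM => //; apply: measurable_funM.
apply: measurableT_comp; first exact: measurable_gamma_kernel.
by apply: measurable_funM.
Qed.

Let kernel_bound n s K : 0 < s -> 0 <= K -> (forall s, 0 < s -> k n s <= K / s) ->
  (\int[mu]_(u in I01) (theta * a n u / u * k n (s / u))%:E <= (theta * A * K / s)%:E)%E.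
Proof.
move=> s0 K0 kK.
have -> : (theta * A * K / s)%:E = (\int[mu]_(u in I01) (cst (theta * A * K / s)%:E u))%E.
  rewrite integral_cst//.
  suff h : lebesgue_measure (I01 : set R) = 1%E by rewrite -[LHS]mule1; congr (_ * _)%E.
  by rewrite lebesgue_measure_itv/= lte_fin ltr01 oppr0 adde0.
apply: ge0_le_integral => //.
- move=> u /=; rewrite in_itv/= => /andP[u0 _].
  by rewrite lee_fin mulr_ge0 ?gamma_kernel_ge0// divr_ge0 ?ltW// mulr_gt0.
- exact: measurable_funTS (kernel_measurable n s).
- move=> u /=; rewrite in_itv/= => /andP[u0 _]; rewrite lee_fin.
  apply: (@le_trans _ _ (theta * A / u * (K / (s / u)))).
    apply: ler_pM; rewrite ?gamma_kernel_ge0//.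
    + by rewrite divr_ge0 ?ltW// mulr_gt0.
    + by rewrite ler_pM2r ?invr_gt0// ler_pM2l.
    + by apply: kK; exact: divr_gt0.
  rewrite le_eqVlt; apply/orP; left; apply/eqP; field; rewrite !gt_eqF//.
Qed.

Let kernelS_fin n s K : 0 < s -> 0 <= K -> (forall s, 0 < s -> k n s <= K / s) ->
  (\int[mu]_(u in I01) (theta * a n u / u * k n (s / u))%:E = (k n.+1 s)%:E)%E.
Proof.
move=> s0 K0 kK; rewrite fineK// ge0_fin_numE.
  by rewrite (le_lt_trans (kernel_bound s0 K0 kK))// ltry.
apply: integral_ge0 => u /=; rewrite in_itv/= => /andP[u0 _].
by rewrite lee_fin mulr_ge0 ?gamma_kernel_ge0// divr_ge0 ?ltW// mulr_gt0.
Qed.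

(** The decay 1/s is inherited along the recursion: the singular factor 1/u meets K/(s/u) = K u/s,
    so the integrand is bounded on the unit interval. It starts from e^(-s) <= 1/s. *)
Let gamma_kernel_le n : exists2 K, 0 <= K & forall s, 0 < s -> k n s <= K / s.
Proof.
elim: n => [|n [K K0 kK]].
  exists 1 => // s s0 /=; rewrite ler_pdivlMr// expRN mulrC ler_pdivrMr ?expR_gt0// mul1r.
  by have := expR_ge1Dx s; lra.
exists (theta * A * K) => [|s s0]; first by rewrite mulr_ge0// mulr_ge0// ltW.
by rewrite -lee_fin -(kernelS_fin s0 K0 kK); exact: kernel_bound.
Qed.

Lemma gamma_kernelS n s : 0 < s ->
  (\int[mu]_(u in I01) (theta * a n u / u * k n (s / u))%:E = (k n.+1 s)%:E)%E.
Proof. by move=> s0; have [K K0 kK] := gamma_kernel_le n; exact: kernelS_fin s0 K0 kK. Qed.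

Lemma gamma_kernel_gt0 n s : 0 < s -> 0 < k n s.
Proof.
elim: n s => [|n IH] s s0; first exact: expR_gt0.
rewrite -lte_fin -gamma_kernelS//; apply: integral_gt0 => //.
- exact: measurable_funTS (kernel_measurable n s).
- move=> u /=; rewrite in_itv/= => /andP[u0 _].
  by rewrite lte_fin mulr_gt0 ?IH ?divr_gt0// mulr_gt0.
- suff : (0 < lebesgue_measure (I01 : set R))%E by [].
  by rewrite lebesgue_measure_itv/= lte_fin ltr01 oppr0 adde0.
Qed.

Definition gamma_bias (n : nat) (t : R) : R := if n is m.+1 then expR t * k n t else 1.

Lemma gamma_biasE n t : gamma_bias n t = expR t * k n t.
Proof. by case: n => //=; rewrite -expRD subrr expR0. Qed.

Lemma gamma_biasing_system : biasing_system (gamma_density theta) a gamma_bias.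
Proof.
have me := @measurable_expR R.
have mk := measurable_gamma_kernel.
have gE n : gamma_bias n = fun t => expR t * k n t.
  by apply/funext => t; rewrite gamma_biasE.
split => //.
- by move=> n u; exact: ltW.
- by move=> n t; rewrite gE mulr_ge0 ?expR_ge0 ?gamma_kernel_ge0.
- by move=> n; rewrite gE; apply: measurable_funM.
- by move=> n t t0; rewrite gE mulr_gt0 ?expR_gt0 ?gamma_kernel_gt0.
move=> n t t0; rewrite gE EFinM -gamma_kernelS// -ge0_integralZl//; last 2 first.
- by apply: measurable_funTS; exact: kernel_measurable.
- move=> u /=; rewrite in_itv/= => /andP[u0 _].
  by rewrite lee_fin mulr_ge0 ?gamma_kernel_ge0// divr_ge0 ?ltW// mulr_gt0.
pose G (x : R) : R := theta * expR t * a n (t / (t + x)) * k n (t + x) / `|t + x|.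
have mtx : measurable_fun setT (fun x : R => t + x) by exact: measurable_funD.
transitivity (\int[mu]_(x in `]0%R, +oo[) (G x)%:E)%E.
  apply: eq_integral => x; rewrite mem_setE in_itv/= andbT => x0.
  have tx0 : 0 < t + x by exact: addr_gt0.
  rewrite /G gtr0_norm// gamma_densityE//; congr EFin.
  have -> : expR (t + x) = expR t * expR x by rewrite expRD.
  rewrite expRN; field; rewrite !gt_eqF ?expR_gt0//.
rewrite (ge0_integral_fraction t0)//; last 2 first.
- apply/measurable_EFinP; apply: measurable_funM; last first.
    by apply: (measurableT_comp minv); apply: measurableT_comp => //; exact: normr_measurable.
  apply: measurable_funM; last exact: measurableT_comp.
  apply: measurable_funM => //; apply: measurableT_comp => //.
  by apply: measurable_funM => //; exact: (measurableT_comp minv).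
- move=> x; rewrite lee_fin divr_ge0// mulr_ge0 ?gamma_kernel_ge0//.
  by rewrite mulr_ge0 ?(ltW (a_gt0 _ _))// mulr_ge0 ?expR_ge0// ltW.
apply: eq_integral => u; rewrite mem_setE in_itv/= => /andP[u0 u1]; rewrite -!EFinM; congr EFin.
have txE : t + (t / u - t) = t / u by rewrite addrC subrK.
rewrite /G txE gtr0_norm ?divr_gt0// (_ : t / (t / u) = u); last first.
  by field; rewrite !gt_eqF.
field; rewrite !gt_eqF//.
Qed.
End gamma_bias.

(** * Gamma integrals and Beta means *)

Section gamma_integrals.
Context (R : realType).
Local Notation mu := (@lebesgue_measure R).
Local Notation pos := (`]0%R, +oo[%classic).
Implicit Types (q c theta v p : R).

Lemma integral_expRZ c : 0 < c ->
  (\int[mu]_(x in pos) (expR (- (c * x)))%:E = (c^-1)%:E)%E.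
Proof.
move=> c0; have : (1 = c%:E * \int[mu]_(x in pos) (expR (- (c * x)))%:E)%E.
  rewrite -(integral_expRN R) (ge0_integral_scale c0)//.
  exact/measurable_EFinP/measurable_expN.
by move=> e; rewrite -[RHS]mule1 [X in (_ * X)%E]e muleA -EFinM mulVf ?gt_eqF// mul1e.
Qed.

Lemma measurable_gamma_integrand q :
  measurable_fun setT (fun v : R => v `^ (q - 1) * expR (- v)).
Proof.
by apply: measurable_funM; [exact: measurable_powR|exact: measurable_expN].
Qed.

Lemma gamma_normE q : 0 < q ->
  (\int[mu]_(v in pos) (v `^ (q - 1) * expR (- v))%:E = (gamma_norm q)%:E)%E.
Proof.
move=> q0; rewrite fineK// ge0_fin_numE; last first.
  by apply: integral_ge0 => v _; rewrite lee_fin mulr_ge0 ?powR_ge0 ?expR_ge0.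
(* With w = v/(2q), ln w <= w - 1 gives w^q <= e^(q w) = e^(v/2), that is v^q <= (2q)^q e^(v/2);
   half of the exponential decay survives. *)
pose K : R := (2 * q) `^ q.
have mn : measurable_fun setT (fun v : R => \1_(`]0, 1[) v * v `^ (q - 1)).
  apply: measurable_funM; last exact: measurable_powR.
  by apply: measurable_indic; exact: measurable_itv.
have mf : measurable_fun setT (fun v : R => expR (- (2^-1 * v))).
  by apply: measurable_expN; exact: measurable_funM.
apply: (@le_lt_trans _ _ (\int[mu]_(v in pos)
   ((\1_(`]0, 1[) v * v `^ (q - 1))%:E + K%:E * (expR (- (2^-1 * v)))%:E))%E).
  apply: ge0_le_integral => //.
  - by move=> v _; rewrite lee_fin mulr_ge0 ?powR_ge0 ?expR_ge0.
  - by apply/measurable_EFinP/measurable_funTS; exact: measurable_gamma_integrand.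
  - by apply/measurable_EFinP/measurable_funTS/measurable_funD => //; exact: measurable_funM.
  move=> v /=; rewrite in_itv/= andbT => v0; rewrite -EFinM -EFinD lee_fin.
  have [v1|v1] := ltP v 1.
    rewrite indicE mem_set/= ?in_itv/= ?v0// mul1r.
    apply: (@le_trans _ _ (v `^ (q - 1))).
      by rewrite ger_pMr ?powR_gt0// -expR0 ler_expR oppr_le0 ltW.
    by rewrite lerDl mulr_ge0 ?powR_ge0 ?expR_ge0.
  rewrite indicE memNset/=; last by rewrite in_itv/= v0/=; apply/negP; rewrite -leNgt.
  rewrite mul0r add0r.
  apply: (@le_trans _ _ (v `^ q * expR (- v))).
    by rewrite ler_pM2r ?expR_gt0//; apply: ler_powR => //; rewrite lerBlDr lerDl.
  have vE : v = 2 * q * (v / (2 * q)) by field; rewrite gt_eqF.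
  rewrite [in v `^ q]vE powRM ?divr_ge0 ?mulr_ge0 ?(ltW q0) ?(ltW v0)//.
  rewrite -mulrA ler_pM2l; last by apply: powR_gt0; exact: mulr_gt0.
  have -> : expR (- (2^-1 * v)) = expR (2^-1 * v) * expR (- v).
    by rewrite -expRD; congr expR; field.
  rewrite ler_pM2r ?expR_gt0//.
  have w0 : 0 < v / (2 * q) by rewrite divr_gt0// mulr_gt0.
  rewrite /powR gt_eqF// ler_expR.
  have -> : 2^-1 * v = q * (v / (2 * q)) by field; rewrite gt_eqF.
  rewrite ler_pM2l//; have := @le_ln1Dx R (v / (2 * q) - 1).
  by rewrite [1 + _]addrC subrK => h; apply: le_trans (h _) _; lra.
rewrite ge0_integralD//; last 4 first.
- by move=> v _; rewrite lee_fin mulr_ge0// powR_ge0.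
- by apply: measurable_funTS; exact/measurable_EFinP.
- by move=> v _; rewrite -EFinM lee_fin mulr_ge0 ?powR_ge0 ?expR_ge0.
- by apply: measurable_funTS; apply/measurable_EFinP; exact: measurable_funM.
rewrite ge0_integralZl//; last 2 first.
- by apply: measurable_funTS; exact/measurable_EFinP.
- by rewrite lee_fin powR_ge0.
rewrite integral_expRZ//.
rewrite (_ : integral _ _ _ = (q^-1)%:E); last first.
  rewrite -integral_powR01// integral_mkcond [RHS]integral_mkcond; apply: eq_integral => x _.
  rewrite !patchE indicE !mem_setE !in_itv/= andbT.
  by case: (0 < x); rewrite //=; case: (x < 1); rewrite ?mul1r ?mul0r.
by rewrite -EFinM -EFinD ltry.
Qed.

Lemma gamma_norm_gt0 q : 0 < q -> 0 < gamma_norm q.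
Proof.
move=> q0; rewrite -lte_fin -gamma_normE//; apply: integral_gt0 => //.
- by apply/measurable_EFinP/measurable_funTS; exact: measurable_gamma_integrand.
- by move=> v /=; rewrite in_itv/= andbT => v0; rewrite lte_fin mulr_gt0 ?powR_gt0 ?expR_gt0.
- suff : (0 < lebesgue_measure (pos : set R))%E by [].
  by rewrite lebesgue_measure_itv/= ltry addye// ltry.
Qed.

Lemma gamma_laplace q c : 0 < q -> 0 < c ->
  (\int[mu]_(v in pos) (v `^ (q - 1) * expR (- (c * v)))%:E =
   (gamma_norm q * c `^ (- q))%:E)%E.
Proof.
move=> q0 c0.
have := ge0_integral_scale c0 (F := fun v => (v `^ (q - 1) * expR (- v))%:E).
rewrite gamma_normE// => H.
rewrite mulrC EFinM H; last 2 first.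
- by apply/measurable_EFinP; exact: measurable_gamma_integrand.
- by move=> x; rewrite lee_fin mulr_ge0 ?powR_ge0 ?expR_ge0.
rewrite muleA -EFinM -ge0_integralZl//.
- apply: eq_integral => v; rewrite mem_setE in_itv/= andbT => v0.
  rewrite -EFinM powRM ?ltW//; congr EFin.
  have -> : c `^ (q - 1) = c `^ q / c.
    by rewrite powRB ?(gt_eqF c0) ?implybT// powRr1// ltW.
  rewrite powRN; field; rewrite !gt_eqF ?powR_gt0//.
- apply/measurable_EFinP/measurable_funTS.
  have mc : measurable_fun setT (fun v : R => c * v) by exact: measurable_funM.
  exact: (measurableT_comp (measurable_gamma_integrand q) mc).
- by move=> x _; rewrite lee_fin mulr_ge0 ?powR_ge0 ?expR_ge0.
- by rewrite lee_fin mulr_ge0 ?powR_ge0 ?(ltW c0).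
Qed.

(** A Frullani integral: (1 - e^(-l x)) e^(-x)/x is the integral of e^(-(1+s) x) over s in [0, l],
    and Tonelli's theorem reduces it to the integral of 1/(1 + s). *)
Lemma gamma_levy_exponent theta (l : R) : 0 < theta -> 0 <= l ->
  levy_exponent (gamma_density theta) (fun x => l * `|x|) = theta * ln (1 + l).
Proof.
move=> theta0; rewrite le_eqVlt => /predU1P[<-|l0].
  rewrite addr0 ln1 mulr0 levy_exponent.unlock integral0_eq// => x _.
  by rewrite mul0r oppr0 expR0 subrr mul0r.
apply: EFin_inj.
rewrite -(levy_exponentE (measurable_gamma_density _) (gamma_density_ge0 theta0)
  (gamma_density_levy theta0) (testfunZ (ltW l0) (@testfun_norm R))).
pose f (x s : R) : \bar R := (theta * expR (- ((1 + s) * x)))%:E.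
transitivity (\int[mu]_(x in pos) \int[mu]_(s in `[0%R, l]) f x s)%E.
  apply: eq_integral => x; rewrite mem_setE in_itv/= andbT => x0.
  pose F (s : R) : R := - (theta / x * expR (- ((1 + s) * x))).
  have D s : 0 <= s <= l -> is_derive s 1 F (theta * expR (- ((1 + s) * x))).
    move=> _; rewrite /F; apply: is_derive_eq.
    by rewrite /GRing.scale/=; field; rewrite gt_eqF.
  rewrite (integral_derive_itvcc l0 D).
    rewrite gamma_densityE// gtr0_norm// /F; congr EFin.
    have -> : expR (- ((1 + l) * x)) = expR (- (l * x)) * expR (- x) by rewrite -expRD; congr expR; ring.
    by rewrite addr0 mul1r; field; rewrite gt_eqF.
  move=> s _; apply/differentiable_continuous/derivable1_diffP; exact: ex_derive.
have mf : measurable_fun setT (fun z : R * R => f z.1 z.2).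
  apply/measurable_EFinP; apply: measurable_funM => //; apply: measurable_expN.
  by apply: measurable_funM => //; exact: measurable_funD.
rewrite (@tonelli_in _ _ (measurableTypeR R) (measurableTypeR R) R mu mu pos `[0%R, l] f)//; last first.
  by move=> x s _ _; rewrite lee_fin mulr_ge0 ?expR_ge0// ltW.
transitivity (\int[mu]_(s in `[0%R, l]) (theta / (1 + s))%:E)%E.
  apply: eq_integral => s; rewrite mem_setE in_itv/= => /andP[s0 _].
  have s1 : 0 < 1 + s by lra.
  rewrite EFinM -(integral_expRZ s1) -ge0_integralZl//.
  - by apply/measurable_EFinP/measurable_funTS/measurable_expN/measurable_funM.
  - by rewrite lee_fin ltW.
have D s : 0 <= s <= l -> is_derive s 1 (fun s : R => theta * ln (1 + s)) (theta / (1 + s)).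
  move=> /andP[s0 _]; have s1 : 0 < 1 + s by lra.
  have H := is_derive1_ln s1.
  by apply: is_derive_eq; rewrite /GRing.scale/=; field; rewrite gt_eqF.
rewrite (integral_derive_itvcc l0 D); first by rewrite addr0 ln1 mulr0 subr0.
move=> s /andP[s0 _]; have s1 : 1 + s != 0 by rewrite gt_eqF//; lra.
apply: continuousM; first exact: cvg_cst.
apply: continuousV => //; apply: continuousD; [exact: cvg_cst|exact: cvg_id].
Qed.
End gamma_integrals.

Section gamma_mean.
Context (R : realType) (theta : R).
Hypothesis theta_gt0 : 0 < theta.
Local Notation mu := (@lebesgue_measure R).
Local Notation I01 := (`]0%R, 1%R[%classic).
Let minv := @measurable_inv R.

(** For v > 0 and a bounded nonnegative measurable [b], [v * gamma_mean b v] is the mean of [b]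
    under Beta(v theta, 1). The factor [v] is left out because it arises from another source, the
    n-th power of [v] in the Gamma mixture of order r + n. *)
Definition gamma_mean (b : R -> R) (v : R) : R :=
  fine (\int[mu]_(u in I01) (theta * b u / u * expR (v * theta * ln u))%:E)%E.

Lemma powR_expR_ln (v u : R) : 0 < u -> u `^ (v * theta - 1) = expR (v * theta * ln u) / u.
Proof.
move=> u0; rewrite powRB ?(gt_eqF u0) ?implybT// powRr1 ?(ltW u0)//.
by rewrite /powR (gt_eqF u0).
Qed.

Variables (b : R -> R) (A : R).
Hypotheses (mb : measurable_fun setT b) (b0 : forall u, 0 <= b u) (bA : forall u, b u <= A).

Lemma gamma_mean_integrand_ge0 v u : I01 u -> (0 <= (theta * b u / u * expR (v * theta * ln u))%:E)%E.
Proof.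
rewrite /= in_itv/= => /andP[u0 _].
by rewrite lee_fin mulr_ge0 ?expR_ge0// divr_ge0 ?(ltW u0)// mulr_ge0// ltW.
Qed.

Let measurable_integrand : measurable_fun setT
  (fun z : R * R => (theta * b z.2 / z.2 * expR (z.1 * theta * ln z.2))%:E).
Proof.
have mu2 : measurable_fun setT (fun z : R * R => z.2^-1) by exact: (measurableT_comp minv).
apply/measurable_EFinP; apply: measurable_funM.
  by apply: measurable_funM => //; apply: measurable_funM => //; exact: (measurableT_comp mb).
apply: measurableT_comp => //; apply: measurable_funM; first exact: measurable_funM.
by apply: measurableT_comp => //; exact: measurable_ln.
Qed.

Lemma measurable_gamma_mean_integrand v : measurable_fun setT
  (fun u : R => (theta * b u / u * expR (v * theta * ln u))%:E).
Proof. exact: (measurableT_comp measurable_integrand (measurable_pair1 v)). Qed.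

Lemma gamma_meanE v : 0 < v ->
  (\int[mu]_(u in I01) (theta * b u / u * expR (v * theta * ln u))%:E =
   (gamma_mean b v)%:E)%E.
Proof.
move=> v0; rewrite fineK// ge0_fin_numE; last first.
  by apply: integral_ge0 => u; exact: gamma_mean_integrand_ge0.
have vt0 : 0 < v * theta by rewrite mulr_gt0.
apply: (@le_lt_trans _ _ (\int[mu]_(u in I01) ((theta * A)%:E * (u `^ (v * theta - 1))%:E))%E).
  apply: ge0_le_integral => //.
  - exact: gamma_mean_integrand_ge0.
  - exact: measurable_funTS (measurable_gamma_mean_integrand v).
  - by apply: measurable_funTS; apply/measurable_EFinP; apply: measurable_funM => //; exact: measurable_powR.
  - move=> u /=; rewrite in_itv/= => /andP[u0 _]; rewrite -EFinM lee_fin powR_expR_ln//.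
    rewrite -mulrA [_^-1 * _]mulrC ler_pM2r; last by rewrite divr_gt0 ?expR_gt0.
    by rewrite ler_pM2l.
rewrite ge0_integralZl//.
- by rewrite integral_powR01// -EFinM ltry.
- by apply: measurable_funTS; apply/measurable_EFinP; exact: measurable_powR.
- by move=> u _; rewrite lee_fin powR_ge0.
- by rewrite lee_fin mulr_ge0 ?(ltW theta_gt0)// (le_trans (b0 0)).
Qed.

Lemma gamma_mean_ge0 v : 0 <= gamma_mean b v.
Proof. by apply: fine_ge0; apply: integral_ge0 => u; exact: gamma_mean_integrand_ge0. Qed.

Lemma measurable_gamma_mean : measurable_fun setT (gamma_mean b).
Proof.
apply: measurableT_comp => //.
have H := @measurable_integral_in _ _ (measurableTypeR R) (measurableTypeR R) R mu I01
  (fun v u : R => (theta * b u / u * expR (v * theta * ln u))%:E) (measurable_itv _).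
apply: H; first exact: measurable_integrand.
by move=> v u; exact: gamma_mean_integrand_ge0.
Qed.
End gamma_mean.

Lemma gamma_mean1 (R : realType) (theta v : R) : 0 < theta -> 0 < v ->
  gamma_mean theta (fun=> 1) v = v^-1.
Proof.
move=> theta0 v0; have vt0 : 0 < v * theta by rewrite mulr_gt0.
apply: EFin_inj; rewrite -(@gamma_meanE _ _ theta0 (fun=> 1) 1)//.
transitivity (\int[lebesgue_measure]_(u in `]0%R, 1%R[)
   (theta%:E * (u `^ (v * theta - 1))%:E))%E.
  apply: eq_integral => u; rewrite mem_setE in_itv/= => /andP[u0 _].
  by rewrite powR_expR_ln// -EFinM; congr EFin; field; rewrite gt_eqF.
rewrite ge0_integralZl//.
- by rewrite integral_powR01// -EFinM; congr EFin; field; rewrite !gt_eqF.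
- by apply: measurable_funTS; apply/measurable_EFinP; exact: measurable_powR.
- by move=> u _; rewrite lee_fin powR_ge0.
- by rewrite lee_fin ltW.
Qed.

Section gamma_residual.
Context (R : realType) (theta r : R).
Hypotheses (theta_gt0 : 0 < theta) (r_gt0 : 0 < r).
Local Notation mu := (@lebesgue_measure R).
Local Notation I01 := (`]0%R, 1%R[%classic).
Local Notation pos := (`]0%R, +oo[%classic).
Context d (Omega : measurableType d) (P : probability Omega R).
Variables (J Jt : nat -> {RV P >-> R}).
Hypothesis J0 : forall j w, 0 <= J j w.
Hypothesis simple_ae : {ae P, forall w, simple_points J w}.
Hypothesis picks : is_size_biased_picks J Jt.
Local Notation rho := (gamma_density theta).
Hypothesis laplace_functional : forall f, testfun f ->
  (\int[P]_w (expR (- psum J f w))%:E = ((1 + levy_exponent rho f) `^ (- r))%:E)%E.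
Local Notation rem n := (remaining J Jt n).

Section bias.
Variables (a : nat -> R -> R) (A : R).
Hypotheses (ma : forall n, measurable_fun setT (a n)) (a01 : forall n u, 0 < a n u <= A).
Local Notation k := (gamma_kernel theta a).
Let a_ge0 n u : 0 <= a n u. Proof. by case/andP: (a01 n u) => /ltW. Qed.
Let aA n u : a n u <= A. Proof. by case/andP: (a01 n u). Qed.
Let minv := @measurable_inv R.

Variable n : nat.
Let q := r + n%:R.
Let q_gt0 : 0 < q. Proof. by rewrite ltr_wpDr. Qed.
Let c := \prod_(j < n) (r + j%:R) / gamma_norm q.

Let one (j : nat) (u : R) : R := 1.
Let one01 j u : 0 < one j u <= 1. Proof. by rewrite ltr01 lexx. Qed.
Let sys1 : biasing_system rho one (gamma_bias theta one).
Proof. by apply: (gamma_biasing_system theta_gt0 _ one01) => j; exact: measurable_cst. Qed.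
Local Notation W := (chain_weight J Jt one (gamma_bias theta one) n).
Let W0 w : 0 <= W w. Proof. exact: (chain_weight_ge0 _ _ sys1). Qed.
Let mW : measurable_fun setT W. Proof. exact: (@measurable_chain_weight _ _ _ _ _ _ _ J0 _ _ sys1). Qed.
Let mT : measurable_fun setT (rem n). Proof. exact: measurable_remaining_RV. Qed.

Let g (p v : R) : R := v `^ (q - 1) * expR (- v) * expR (v * theta * ln p).

Let gamma_normq_gt0 : 0 < gamma_norm q. Proof. exact: gamma_norm_gt0. Qed.

Let c_ge0 : 0 <= c.
Proof.
rewrite divr_ge0 ?(ltW gamma_normq_gt0)// prodr_ge0// => j _.
by rewrite addr_ge0// ltW.
Qed.

(** The integrand is the Laplace transform of T_n at l = 1/p - 1, where 1 + psi = 1 - theta ln p.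
    Its negative power is a Gamma mixture in which [p] occurs as p^(v theta), a multiplicative
    function of [p]. *)
Let chain_exp_remaining p : 0 < p <= 1 ->
  (\int[P]_w (W w * (expR (rem n w) * k 0 (rem n w / p)))%:E =
   c%:E * \int[mu]_(v in pos) (g p v)%:E)%E.
Proof.
move=> /andP[p0 p1]; pose l := p^-1 - 1.
have l0 : 0 <= l by rewrite subr_ge0 invf_ge1.
have := chain_laplace_remaining (measurable_gamma_density theta) (gamma_density_ge0 theta_gt0)
  (gamma_density_levy theta_gt0) (gamma_density_gt0 theta_gt0) (ltW r_gt0)
  J0 simple_ae picks laplace_functional sys1 n l0.
rewrite gamma_levy_exponent// (_ : 1 + l = p^-1); last by rewrite /l addrC subrK.
rewrite lnV ?posrE// => H.
transitivity (\int[P]_w (W w * expR (- (l * rem n w)))%:E)%E.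
  apply: eq_integral => w _; congr (_ * _)%:E; rewrite -expRD; congr expR.
  by rewrite /l; field; rewrite gt_eqF.
rewrite H.
have c1 : 0 < 1 + theta * - ln p.
  by rewrite ltr_wpDr// mulr_ge0 ?(ltW theta_gt0)// oppr_ge0 ln_le0.
have := gamma_laplace q_gt0 c1; rewrite -/q => Hg.
have -> : (\int[mu]_(v in pos) (g p v)%:E = (gamma_norm q * (1 + theta * - ln p) `^ (- q))%:E)%E.
  rewrite -Hg; apply: eq_integral => v _; congr EFin.
  by rewrite /g -mulrA -expRD; congr (_ * expR _); ring.
by rewrite -EFinM; congr EFin; rewrite /c; field; rewrite gt_eqF.
Qed.

(** The kernel recursion holds only at positive arguments. T_n is positive almost surely, and the
    indicator allows the recursion to be used pointwise under the integral. *)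
Let positive_part (X : R -> R) : measurable_fun setT X -> (forall t, 0 <= X t) ->
  (\int[P]_w (W w * X (rem n w))%:E =
   \int[P]_w (\1_(`]0, +oo[) (rem n w) * (W w * X (rem n w)))%:E)%E.
Proof.
move=> mX X0; have [N [mN PN subN]] := remaining_gt0_ae J0 simple_ae picks n.
have m1 : measurable_fun setT (fun w => W w * X (rem n w)).
  by apply: measurable_funM => //; exact: measurableT_comp.
apply: ge0_ae_eq_integral => //.
- exact/measurable_EFinP.
- by apply/measurable_EFinP; apply: measurable_funM => //; exact: measurable_indic_comp.
- by move=> w _; rewrite lee_fin mulr_ge0.
- by move=> w _; rewrite lee_fin mulr_ge0// mulr_ge0.
exists N; split => // w /= nw; apply: subN => -[_ _ T0]; apply: nw => _.
by rewrite indicE mem_set ?mul1r//= in_itv/= T0.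
Qed.

Let G m (v : R) : R := \prod_(j < m) gamma_mean theta (a j) v.

(** Opening one layer of the kernel replaces [p] by [p * u], hence the generalisation over [p].
    Since p^(v theta) is multiplicative, every layer splits off its own factor u^(v theta), which
    integrates to a [gamma_mean]. The number [n] of picks, and with it the weight [W], stays fixed
    while [m] grows. *)
Lemma gamma_kernel_expectation m p : 0 < p <= 1 ->
  (\int[P]_w (W w * (expR (rem n w) * k m (rem n w / p)))%:E =
   c%:E * \int[mu]_(v in pos) (g p v * G m v)%:E)%E.
Proof.
elim: m p => [|m IH] p p01.
  rewrite chain_exp_remaining//; congr (_ * _)%E; apply: eq_integral => v _.
  by rewrite /G big_ord0 mulr1.
have /andP[p0 p1] := p01.
have mk := measurable_gamma_kernel theta_gt0 ma a01.
have k0 := gamma_kernel_ge0 theta_gt0 a01.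
have mau : measurable_fun setT (fun u : R => theta * a m u / u).
  by apply: measurable_funM => //; exact: measurable_funM.
have meT : measurable_fun setT (fun w => expR (rem n w)) by exact: measurableT_comp.
have mXp j (s : R) : measurable_fun setT (fun t : R => expR t * k j (t / s)).
  apply: measurable_funM => //; apply: measurableT_comp => //; exact: measurable_funM.
have Xp0 j (s t : R) : 0 <= expR t * k j (t / s) by rewrite mulr_ge0 ?expR_ge0.
rewrite (positive_part (mXp _ _) (Xp0 _ _)).
pose W' w := \1_(`]0, +oo[) (rem n w) * W w.
have W'0 w : 0 <= W' w by rewrite mulr_ge0.
have mW' : measurable_fun setT W' by apply: measurable_funM => //; exact: measurable_indic_comp.
pose f (w : Omega) (u : R) : \bar R :=
  (W' w * (expR (rem n w) * (theta * a m u / u * k m (rem n w / p / u))))%:E.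
have f0 w u : I01 u -> (0 <= f w u)%E.
  rewrite /= in_itv/= => /andP[u0 _]; rewrite lee_fin mulr_ge0// mulr_ge0 ?expR_ge0//.
  by rewrite mulr_ge0// divr_ge0 ?(ltW u0)// mulr_ge0// ltW.
have mf : measurable_fun setT (fun z : Omega * R => f z.1 z.2).
  have mu2 : measurable_fun setT (fun z : Omega * R => z.2^-1) by exact: (measurableT_comp minv).
  have mT1 : measurable_fun setT (fun z : Omega * R => rem n z.1) by exact: measurableT_comp.
  apply/measurable_EFinP; apply: measurable_funM; first exact: measurableT_comp.
  apply: measurable_funM; first exact: measurableT_comp.
  apply: measurable_funM.
    by apply: measurable_funM => //; apply: measurable_funM => //; exact: (measurableT_comp (ma m)).
  by apply: measurableT_comp => //; apply: measurable_funM => //; exact: measurable_funM.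
transitivity (\int[P]_w \int[mu]_(u in I01) f w u)%E.
  apply: eq_integral => w _; rewrite (mulrA (\1_(`]0, +oo[) (rem n w))) -/(W' w).
  have [T0|T0] := ltP 0 (rem n w); last first.
    have W'w : W' w = 0 by rewrite /W' indicE memNset ?mul0r//= in_itv/= andbT; apply/negP; rewrite -leNgt.
    by rewrite W'w mul0r integral0_eq// => u _; rewrite /f W'w mul0r.
  have Tp : 0 < rem n w / p by rewrite divr_gt0.
  rewrite mulrA EFinM -(gamma_kernelS theta_gt0 ma a01 _ Tp) -ge0_integralZl//.
  - by apply: eq_integral => u _; rewrite /f -EFinM; congr EFin; ring.
  - apply: measurable_funTS; apply/measurable_EFinP; apply: measurable_funM => //.
    by apply: measurableT_comp => //; exact: measurable_funM.
  - move=> u /=; rewrite in_itv/= => /andP[u0 _]; rewrite lee_fin mulr_ge0//.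
    by rewrite divr_ge0 ?(ltW u0)// mulr_ge0// ltW.
  - by rewrite lee_fin mulr_ge0 ?expR_ge0.
have TO := @tonelli_in _ _ Omega (measurableTypeR R) R P mu setT I01 f measurableT (measurable_itv _) mf.
rewrite TO; last by move=> w u _; exact: f0.
pose F (u v : R) : \bar R := (c * (g p v * G m v * (theta * a m u / u * expR (v * theta * ln u))))%:E.
have mG : measurable_fun setT (G m).
  by apply: measurable_prod => j _; exact: (measurable_gamma_mean theta_gt0 (ma j) (a_ge0 j)).
have G0 v : 0 <= G m v.
  by apply: prodr_ge0 => j _; exact: (gamma_mean_ge0 theta_gt0 (a_ge0 j)).
have g0 (s v : R) : 0 <= g s v by rewrite mulr_ge0 ?expR_ge0// mulr_ge0 ?powR_ge0 ?expR_ge0.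
have mg (s : R) : measurable_fun setT (g s).
  apply: measurable_funM; first exact: measurable_gamma_integrand.
  by apply: measurableT_comp => //; apply: measurable_funM => //; exact: measurable_funM.
transitivity (\int[mu]_(u in I01) \int[mu]_(v in pos) F u v)%E.
  apply: eq_integral => u; rewrite mem_setE in_itv/= => /andP[u0 u1].
  have pu : 0 < p * u <= 1 by rewrite mulr_gt0//= mulr_ile1 ?(ltW p0) ?(ltW u0) ?(ltW u1).
  have au0 : 0 <= theta * a m u / u by rewrite divr_ge0 ?(ltW u0)// mulr_ge0// ltW.
  transitivity ((theta * a m u / u)%:E *
      \int[P]_w (W w * (expR (rem n w) * k m (rem n w / (p * u))))%:E)%E.
    rewrite (positive_part (mXp _ _) (Xp0 _ _)) -ge0_integralZl//.
    - apply: eq_integral => w _; rewrite /f /W' -EFinM; congr EFin.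
      have -> : rem n w / p / u = rem n w / (p * u) by rewrite invfM mulrA.
      by ring.
    - apply/measurable_EFinP; apply: measurable_funM; first exact: measurable_indic_comp.
      apply: measurable_funM => //; apply: measurable_funM => //; apply: measurableT_comp => //.
      exact: measurable_funM.
    - by move=> w _; rewrite lee_fin mulr_ge0// mulr_ge0.
  have mgG : measurable_fun setT (fun v : R => g (p * u) v * G m v) by exact: measurable_funM.
  rewrite IH// muleA -EFinM -ge0_integralZl//.
  - apply: eq_integral => v _; rewrite -EFinM; congr EFin.
    rewrite /g lnM ?posrE// mulrDr expRD; ring.
  - by apply: measurable_funTS; exact/measurable_EFinP.
  - by move=> v _; rewrite lee_fin mulr_ge0.
  - by rewrite lee_fin mulr_ge0.
have F0 u v : I01 u -> pos v -> (0 <= F u v)%E.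
  rewrite /= in_itv/= => /andP[u0 _] _; rewrite lee_fin mulr_ge0// mulr_ge0//; first exact: mulr_ge0.
  by rewrite mulr_ge0 ?expR_ge0// divr_ge0 ?(ltW u0)// mulr_ge0// ltW.
have mF : measurable_fun setT (fun z : R * R => F z.1 z.2).
  have mu1 : measurable_fun setT (fun z : R * R => z.1^-1) by exact: (measurableT_comp minv).
  apply/measurable_EFinP; apply: measurable_funM => //; apply: measurable_funM.
    by apply: measurable_funM; [exact: (measurableT_comp (mg p))|exact: (measurableT_comp mG)].
  apply: measurable_funM.
    by apply: measurable_funM => //; apply: measurable_funM => //; exact: (measurableT_comp (ma m)).
  apply: measurableT_comp => //; apply: measurable_funM; first exact: measurable_funM.
  by apply: measurableT_comp => //; exact: measurable_ln.
have TO' := @tonelli_in _ _ (measurableTypeR R) (measurableTypeR R) R mu mu I01 pos F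
  (measurable_itv _) (measurable_itv _) mF F0.
rewrite TO'.
transitivity (\int[mu]_(v in pos) (c%:E * (g p v * G m.+1 v)%:E))%E; last first.
  apply: ge0_integralZl.
  - exact: measurable_itv.
  - apply: measurable_funTS; apply/measurable_EFinP; apply: measurable_funM; first exact: (mg p).
    apply: measurable_prod => j _; exact: (measurable_gamma_mean theta_gt0 (ma j) (a_ge0 j)).
  - move=> v _; rewrite lee_fin; apply: mulr_ge0; first exact: g0.
    by apply: prodr_ge0 => j _; exact: (gamma_mean_ge0 theta_gt0 (a_ge0 j)).
  - by rewrite lee_fin; exact: c_ge0.
apply: eq_integral => v; rewrite mem_setE in_itv/= andbT => v0.
have -> : (c%:E * (g p v * G m.+1 v)%:E)%E =
    ((c * (g p v * G m v))%:E * (gamma_mean theta (a m) v)%:E)%E.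
  by rewrite -!EFinM /G big_ord_recr/= -/(G m v) !mulrA.
rewrite -(gamma_meanE theta_gt0 (ma m) (a_ge0 m) (aA m) v0).
transitivity (\int[mu]_(u in I01) ((c * (g p v * G m v))%:E *
    (theta * a m u / u * expR (v * theta * ln u))%:E))%E.
  by apply: eq_integral => u _; rewrite /F -EFinM mulrA.
apply: ge0_integralZl.
- exact: measurable_itv.
- apply: measurable_funTS; exact: (measurable_gamma_mean_integrand theta (ma m) v).
- by move=> u; exact: (gamma_mean_integrand_ge0 theta_gt0 (a_ge0 m)).
- rewrite lee_fin; apply: mulr_ge0; first exact: c_ge0.
  by apply: mulr_ge0; [exact: g0|exact: G0].
Qed.

Lemma integral_prod_residual_gamma :
  (\int[P]_w (\prod_(j < n) a j (residual_fraction J Jt j w))%:E =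
   c%:E * \int[mu]_(v in pos)
     (v `^ (q - 1) * expR (- v) * \prod_(j < n) gamma_mean theta (a j) v)%:E)%E.
Proof.
have sysa := gamma_biasing_system theta_gt0 ma a01.
rewrite (integral_prod_residual (measurable_gamma_density theta) (gamma_density_ge0 theta_gt0)
  (gamma_density_levy theta_gt0) (gamma_density_gt0 theta_gt0) (ltW r_gt0)
  J0 simple_ae picks laplace_functional n sysa sys1).
transitivity (\int[P]_w (W w * (expR (rem n w) * k n (rem n w / 1)))%:E)%E.
  by apply: eq_integral => w _; rewrite gamma_biasE divr1.
have p01 : 0 < (1 : R) <= 1 by rewrite ltr01 lexx.
apply: etrans (gamma_kernel_expectation n p01) _; apply: congr1.
by apply: eq_integral => v _; rewrite /g ln1 mulr0 expR0 mulr1.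
Qed.
End bias.

(** The factor v^n contained in v^(r+n-1) is shared out among the n means, making each of them a
    Beta(v theta, 1) expectation and leaving the Gamma(r, 1) density. *)
Lemma gamma_residual_expectation n (a : nat -> R -> R) (A : R) :
  (forall n, measurable_fun setT (a n)) -> (forall n u, 0 < a n u <= A) ->
  (\int[P]_w (\prod_(j < n) a j (residual_fraction J Jt j w))%:E =
   \int[mu]_(v in pos) (v `^ (r - 1) * expR (- v) / gamma_norm r *
      \prod_(j < n) (v * gamma_mean theta (a j) v))%:E)%E.
Proof.
move=> ma a01.
pose one (j : nat) (u : R) : R := 1.
have one01 j u : 0 < one j u <= 1 by rewrite ltr01 lexx.
have m1 j : measurable_fun setT (one j) by exact: measurable_cst.
have n0 := gamma_norm_gt0 r_gt0.
have prodv (v : R) (x : nat -> R) : \prod_(j < n) (v * x j) = v ^+ n * \prod_(j < n) x j.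
  by rewrite big_split/= prodr_const card_ord.
have powq (v : R) : 0 < v -> v `^ (r + n%:R - 1) = v `^ (r - 1) * v ^+ n.
  move=> v0; rewrite -powR_mulrn ?(ltW v0)// -powRD ?(gt_eqF v0) ?implybT//.
  by congr (_ `^ _); ring.
set c := \prod_(j < n) (r + j%:R) / gamma_norm (r + n%:R).
(* Taking all test functions equal to 1 makes the left side 1 and determines the constant; the
   functional equation of the Gamma function comes out as a consequence. *)
have cE : c = (gamma_norm r)^-1.
  have := integral_prod_residual_gamma m1 one01 n; rewrite -/c.
  rewrite (_ : integral _ _ _ = 1%E); last first.
    under eq_integral do rewrite big1//.
    by rewrite integral_cst// mul1e; exact: probability_setT.
  rewrite (_ : integral _ _ _ = (gamma_norm r)%:E); last first.
    rewrite -gamma_normE//; apply: eq_integral => v; rewrite mem_setE in_itv/= andbT => v0.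
    congr EFin; under eq_bigr do rewrite gamma_mean1//.
    rewrite prodr_const card_ord powq// -mulrA [expR _ * _]mulrC mulrA.
    by rewrite -[_ * v ^+ n * _]mulrA exprVn mulfV ?mulr1// expf_neq0// gt_eqF.
  by rewrite -EFinM => -[H]; apply: (mulIf (lt0r_neq0 n0)); rewrite mulVf ?gt_eqF.
have a_ge0 j u : 0 <= a j u by case/andP: (a01 j u) => /ltW.
rewrite (integral_prod_residual_gamma ma a01) -/c cE.
rewrite -ge0_integralZl//.
- apply: eq_integral => v; rewrite mem_setE in_itv/= andbT => v0.
  by rewrite -EFinM; congr EFin; rewrite (prodv v (fun j => gamma_mean theta (a j) v)) powq//; ring.
- apply: measurable_funTS; apply/measurable_EFinP; apply: measurable_funM.
    exact: measurable_gamma_integrand.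
  by apply: measurable_prod => j _; exact: (measurable_gamma_mean theta_gt0 (ma j) (a_ge0 j)).
- move=> v _; rewrite lee_fin mulr_ge0//; first by rewrite mulr_ge0 ?powR_ge0 ?expR_ge0.
  by apply: prodr_ge0 => j _; exact: (gamma_mean_ge0 theta_gt0 (a_ge0 j)).
- by rewrite lee_fin invr_ge0 ltW.
Qed.
End gamma_residual.

(** * From integrals of products to laws of sequences *)

Section product_indicators.
Context d (T : measurableType d) (R : realType) (P : probability T R).
Variables (X : nat -> set R -> T -> R) (n : nat).
Hypothesis X_ge0 : forall j A w, 0 <= X j A w.
Hypothesis X_le1 : forall j A w, measurable A -> X j A w <= 1.
Hypothesis X0 : forall j w, X j set0 w = 0.
Hypothesis mX : forall j A, measurable A -> measurable_fun setT (X j A).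

(* The factors are [X j (A j)] for [j < m] and [1 + X j (A j)] for [j >= m]. *)
Definition shifted_product (m : nat) (A : nat -> set R) (w : T) : R :=
  \prod_(j < n) ((m <= j)%:R + X j (A j) w).

Lemma shifted_product_ge0 m A w : 0 <= shifted_product m A w.
Proof. by apply: prodr_ge0 => j _; rewrite addr_ge0. Qed.

Lemma measurable_shifted_product m A : (forall j, measurable (A j)) ->
  measurable_fun setT (shifted_product m A).
Proof. by move=> mA; apply: measurable_prod => j _; apply: measurable_funD => //; exact: mX. Qed.

Definition drop_set (m : nat) (A : nat -> set R) (j : nat) : set R :=
  if j == m then set0 else A j.

Lemma measurable_drop_set m A : (forall j, measurable (A j)) ->
  forall j, measurable (drop_set m A j).
Proof. by move=> mA j; rewrite /drop_set; case: eqP. Qed.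

(** The m-th factor 1 + X is split into its two terms. Since [X] vanishes on the empty set, the term
    1 is again a shifted factor, with [set0] in position [m]. *)
Lemma shifted_productS m A w : (m < n)%N ->
  shifted_product m A w = shifted_product m (drop_set m A) w + shifted_product m.+1 A w.
Proof.
move=> mn; have D (F : 'I_n -> R) :
    \prod_(j < n) F j = F (Ordinal mn) * \prod_(j < n | j != Ordinal mn) F j.
  by rewrite (bigD1 (Ordinal mn)).
rewrite /shifted_product 3!D/= /drop_set eqxx X0 leqnn ltnn.
rewrite addr0 add0r mul1r mulrDl mul1r; congr (_ + _ * _).
  by apply: eq_bigr => j; rewrite -val_eqE/= => /negbTE ->.
by apply: eq_bigr => j; rewrite -val_eqE/= => jm; rewrite [in RHS]ltn_neqAle eq_sym jm.
Qed.

Lemma integral_shifted_productS m A : (forall j, measurable (A j)) -> (m < n)%N ->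
  (\int[P]_w (shifted_product m A w)%:E =
   \int[P]_w (shifted_product m (drop_set m A) w)%:E +
   \int[P]_w (shifted_product m.+1 A w)%:E)%E.
Proof.
move=> mA mn; under eq_integral do rewrite shifted_productS// EFinD.
have mdA := measurable_drop_set m mA.
rewrite ge0_integralD//.
- by move=> w _; rewrite lee_fin shifted_product_ge0.
- by apply/measurable_EFinP; exact: measurable_shifted_product.
- by move=> w _; rewrite lee_fin shifted_product_ge0.
- by apply/measurable_EFinP; exact: measurable_shifted_product.
Qed.

Lemma integral_shifted_product_fin m A : (forall j, measurable (A j)) ->
  (\int[P]_w (shifted_product m A w)%:E \is a fin_num)%E.
Proof.
move=> mA; rewrite ge0_fin_numE; last first.
  by apply: integral_ge0 => w _; rewrite lee_fin shifted_product_ge0.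
apply: (@le_lt_trans _ _ (\int[P]_w (cst (2 ^+ n)%:E w))%E).
  apply: ge0_le_integral => //.
  - by move=> w _; rewrite lee_fin shifted_product_ge0.
  - by apply/measurable_EFinP; exact: measurable_shifted_product.
  - move=> w _; rewrite lee_fin -[X in _ <= _ ^+ X]card_ord -prodr_const.
    apply: ler_prod => j _; have h0 := X_ge0 j (A j) w; have h1 := X_le1 j w (mA j).
    by case: (m <= j)%N; rewrite ?addr_ge0//= ?add0r; lra.
by rewrite integral_cst// [X in (_ * X)%E]probability_setT mule1 ltry.
Qed.
End product_indicators.

(** Inclusion-exclusion, one factor at a time: the identity for the products of 1 + X is assumed for
    all choices of sets, so the one with [set0] in position [m] can be subtracted, both integrals
    being finite. The two families stay abstract since one consists of indicators and the other of
    conditional probabilities. *)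
Lemma integral_prod_indicators d1 (T1 : measurableType d1) d2 (T2 : measurableType d2)
    (R : realType) (P1 : probability T1 R) (P2 : probability T2 R)
    (X1 : nat -> set R -> T1 -> R) (X2 : nat -> set R -> T2 -> R) (n : nat) :
  (forall j A w, 0 <= X1 j A w) -> (forall j A w, 0 <= X2 j A w) ->
  (forall j A w, measurable A -> X1 j A w <= 1) ->
  (forall j A w, measurable A -> X2 j A w <= 1) ->
  (forall j w, X1 j set0 w = 0) -> (forall j w, X2 j set0 w = 0) ->
  (forall j A, measurable A -> measurable_fun setT (X1 j A)) ->
  (forall j A, measurable A -> measurable_fun setT (X2 j A)) ->
  (forall A : nat -> set R, (forall j, measurable (A j)) ->
    (\int[P1]_w (\prod_(j < n) (1 + X1 j (A j) w))%:E =
     \int[P2]_w (\prod_(j < n) (1 + X2 j (A j) w))%:E)%E) ->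
  forall A : nat -> set R, (forall j, measurable (A j)) ->
    (\int[P1]_w (\prod_(j < n) X1 j (A j) w)%:E =
     \int[P2]_w (\prod_(j < n) X2 j (A j) w)%:E)%E.
Proof.
move=> h1 h2 l1 l2 z1 z2 m1 m2 H.
have step m : (m <= n)%N -> forall A, (forall j, measurable (A j)) ->
    (\int[P1]_w (shifted_product X1 n m A w)%:E = \int[P2]_w (shifted_product X2 n m A w)%:E)%E.
  elim: m => [_|m IH mn] A mA; first exact: H.
  have e1 := integral_shifted_productS P1 h1 z1 m1 mA mn.
  have e2 := integral_shifted_productS P2 h2 z2 m2 mA mn.
  have mdA := measurable_drop_set m mA.
  have := IH (ltnW mn) _ mA; rewrite e1 e2 (IH (ltnW mn) _ mdA).
  set x := integral _ _ _ => /(congr1 (fun y => y - x)%E).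
  have xf : x \is a fin_num by exact: (integral_shifted_product_fin P2 n h2 l2 m2 m mdA).
  by rewrite ![(x + _)%E]addeC !addeK.
move=> A mA; have := step n (leqnn n) A mA; rewrite /shifted_product.
have e d (T : measurableType d) (X : nat -> set R -> T -> R) w :
    \prod_(j < n) ((n <= j)%:R + X j (A j) w) = \prod_(j < n) X j (A j) w.
  by apply: eq_bigr => j _; rewrite leqNgt ltn_ord add0r.
by under eq_integral do rewrite e; under [RHS]eq_integral do rewrite e.
Qed.

Lemma seq_eq_in_law_cylinders (R : realType)
    d (Omega : measurableType d) (P : probability Omega R)
    d' (Omega' : measurableType d') (P' : probability Omega' R)
    (X : nat -> Omega -> R) (Y : nat -> Omega' -> R) :
  (forall i, measurable_fun setT (X i)) -> (forall i, measurable_fun setT (Y i)) ->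
  (forall n (A : nat -> set R), (forall i, measurable (A i)) ->
     P [set w | forall i, (i < n)%N -> A i (X i w)] =
     P' [set w | forall i, (i < n)%N -> A i (Y i w)]) ->
  seq_eq_in_law P P' X Y.
Proof.
move=> mX mY cyl S GS.
pose pX (S : set (nat -> R)) := [set w | S (fun i => X i w)].
pose pY (S : set (nat -> R)) := [set w | S (fun i => Y i w)].
pose H := [set S | [/\ measurable (pX S), measurable (pY S) & P (pX S) = P' (pY S)]].
suff : H S by case.
pose Cyl : set (set (nat -> R)) := [set S | exists n (A : nat -> set R),
  (forall i, measurable (A i)) /\ S = [set x | forall i, (i < n)%N -> A i (x i)]].
have CylI : setI_closed Cyl.
  move=> _ _ [n1 [A1 [mA1 ->]]] [n2 [A2 [mA2 ->]]].
  exists (maxn n1 n2), (fun i => (if (i < n1)%N then A1 i else setT) `&`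
    (if (i < n2)%N then A2 i else setT)); split.
    by move=> i; apply: measurableI; case: ifP.
  apply/seteqP; split => x /=.
    by move=> [h1 h2] i _; split; case: ifPn => // ?; [exact: h1|exact: h2].
  move=> h; split => i ilt.
    by have [] := h i; rewrite ?leq_max ilt.
  by have [_] := h i (leq_trans ilt (leq_maxr _ _)); rewrite ilt.
have mcyl d0 (T : measurableType d0) (Z : nat -> T -> R) n (A : nat -> set R) :
    (forall i, measurable_fun setT (Z i)) -> (forall i, measurable (A i)) ->
    measurable [set w | forall i, (i < n)%N -> A i (Z i w)].
  move=> mZ mA; rewrite (_ : [set w | _] = \bigcap_(i in `I_n) (Z i @^-1` A i)).
    by apply: bigcap_measurableType => i _; rewrite -[_ @^-1` _]setTI; exact: mZ.
  by apply/seteqP; split.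
have dH : dynkin H.
  split.
  - split; [exact: measurableT|exact: measurableT|].
    by rewrite [LHS](probability_setT P) [RHS](probability_setT P').
  - move=> E [mEX mEY PE]; split.
    + exact: measurableC.
    + exact: measurableC.
    + have -> : pX (~` E) = ~` pX E by [].
      have -> : pY (~` E) = ~` pY E by [].
      by rewrite !probability_setC// PE.
  - move=> F tF HF.
    have eX : pX (\bigcup_k F k) = \bigcup_k pX (F k) by [].
    have eY : pY (\bigcup_k F k) = \bigcup_k pY (F k) by [].
    have mFX k : measurable (pX (F k)) by case: (HF k).
    have mFY k : measurable (pY (F k)) by case: (HF k).
    have tX : trivIset setT (fun k => pX (F k)).
      by move=> i j _ _ [w [Fi Fj]]; apply: tF => //; exists (fun i => X i w).
    have tY : trivIset setT (fun k => pY (F k)).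
      by move=> i j _ _ [w [Fi Fj]]; apply: tF => //; exists (fun i => Y i w).
    split.
    + by rewrite eX; exact: bigcupT_measurable.
    + by rewrite eY; exact: bigcupT_measurable.
    rewrite eX eY !measure_bigcup//; apply: eq_eseriesr => k _.
    by case: (HF k).
have CylH : Cyl `<=` H.
  move=> _ [n [A [mA ->]]]; split; [exact: mcyl|exact: mcyl|exact: cyl].
have : <<d Cyl >> `<=` H by exact: smallest_sub.
apply; rewrite setI_closed_g_dynkin_g_sigma_algebra//.
apply: GS; split; first exact: smallest_sigma_algebra.
move=> _ [i _] [B mB <-]; apply: sub_sigma_algebra.
exists i.+1, (fun j => if j == i then B else setT); split.
  by move=> j; case: eqP.
rewrite setTI; apply/seteqP; split => x /=.
  by move=> Bx j _; case: eqP => // ->.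
by move=> /(_ i (ltnSn i)); rewrite eqxx.
Qed.

Lemma beta_law_ge0 (R : realType) (a b : R) (A : set R) : (0 <= beta_law a b A)%E.
Proof.
apply: integral_ge0 => u _; rewrite lee_fin divr_ge0 ?mulr_ge0 ?powR_ge0//.
by apply: fine_ge0; apply: integral_ge0 => v _; rewrite lee_fin mulr_ge0 ?powR_ge0.
Qed.

(** * The mixed Beta law *)

Section mixed_beta.
Context (R : realType) (theta : R).
Hypothesis theta_gt0 : 0 < theta.
Local Notation mu := (@lebesgue_measure R).
Local Notation I01 := (`]0%R, 1%R[%classic).

(** The Beta(v theta, 1) probability of [A] as a function of the mixing parameter, put equal to 0
    for [v <= 0] so that it is measurable with values in [0, 1] on the whole line. *)
Definition beta_prob1 (A : set R) (v : R) : R :=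
  if 0 < v then v * gamma_mean theta \1_A v else 0.

Let ind01 (A : set R) (u : R) : 0 <= (\1_A u : R) <= 1.
Proof. by rewrite indicE; case: (_ \in _); rewrite /= ?lexx ?ler01. Qed.
Let ind0 (A : set R) (u : R) : 0 <= (\1_A u : R). Proof. by case/andP: (ind01 A u). Qed.
Let ind1 (A : set R) (u : R) : (\1_A u : R) <= 1. Proof. by case/andP: (ind01 A u). Qed.

Lemma gamma_mean_1D (A : set R) (v : R) : measurable A -> 0 < v ->
  v * gamma_mean theta (fun u => 1 + \1_A u) v = 1 + beta_prob1 A v.
Proof.
move=> mA v0; rewrite /beta_prob1 v0.
have mI : measurable_fun setT (\1_A : R -> R) by exact: measurable_indic.
have m1I : measurable_fun setT (fun u => 1 + \1_A u : R) by exact: measurable_funD.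
have m1 : measurable_fun setT (fun _ : R => 1 : R) by exact: measurable_cst.
suff -> : gamma_mean theta (fun u => 1 + \1_A u) v =
    gamma_mean theta (fun=> 1) v + gamma_mean theta \1_A v.
  by rewrite mulrDr gamma_mean1// mulfV// gt_eqF.
have h0 u : 0 <= 1 + \1_A u :> R by have := ind0 A u; lra.
have h2 u : 1 + \1_A u <= 2 :> R by have := ind1 A u; lra.
have one1 (u : R) : (fun=> 1 : R) u <= 1 by [].
have one0 (u : R) : 0 <= (fun=> 1 : R) u by [].
apply: EFin_inj; rewrite EFinD -(gamma_meanE theta_gt0 m1I h0 h2 v0).
rewrite -(gamma_meanE theta_gt0 m1 one0 one1 v0) -(gamma_meanE theta_gt0 mI (ind0 A) (ind1 A) v0).
rewrite -ge0_integralD//.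
- by apply: eq_integral => u _; rewrite -EFinD; congr EFin; ring.
- by move=> u; exact: (gamma_mean_integrand_ge0 theta_gt0 one0).
- exact: measurable_funTS (measurable_gamma_mean_integrand theta m1 v).
- by move=> u; exact: (gamma_mean_integrand_ge0 theta_gt0 (ind0 A)).
- exact: measurable_funTS (measurable_gamma_mean_integrand theta mI v).
Qed.

Lemma beta_prob1_ge0 A v : 0 <= beta_prob1 A v.
Proof.
rewrite /beta_prob1; case: ifPn => // v0.
by rewrite mulr_ge0 ?(ltW v0)//; exact: (gamma_mean_ge0 theta_gt0 (ind0 A)).
Qed.

Lemma beta_prob1_le1 A v : measurable A -> beta_prob1 A v <= 1.
Proof.
move=> mA; rewrite /beta_prob1; case: ifPn => // v0.
rewrite mulrC -ler_pdivlMr// div1r -(gamma_mean1 theta_gt0 v0).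
have mI : measurable_fun setT (\1_A : R -> R) by exact: measurable_indic.
have m1 : measurable_fun setT (fun _ : R => 1 : R) by exact: measurable_cst.
have one1 (u : R) : (fun=> 1 : R) u <= 1 by [].
have one0 (u : R) : 0 <= (fun=> 1 : R) u by [].
rewrite -lee_fin -(gamma_meanE theta_gt0 m1 one0 one1 v0) -(gamma_meanE theta_gt0 mI (ind0 A) (ind1 A) v0).
apply: ge0_le_integral => //.
- by move=> u; exact: (gamma_mean_integrand_ge0 theta_gt0 (ind0 A)).
- exact: measurable_funTS (measurable_gamma_mean_integrand theta mI v).
- exact: measurable_funTS (measurable_gamma_mean_integrand theta m1 v).
- move=> u /=; rewrite in_itv/= => /andP[u0 _]; rewrite lee_fin.
  by rewrite ler_pM2r ?expR_gt0// ler_pM2r ?invr_gt0// ler_pM2l.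
Qed.

Lemma beta_prob1_set0 v : beta_prob1 set0 v = 0.
Proof.
rewrite /beta_prob1; case: ifPn => // _; rewrite /gamma_mean integral0_eq ?mulr0//.
by move=> u _; rewrite indic0 mulr0 mul0r mul0r.
Qed.

Lemma measurable_beta_prob1 A : measurable A -> measurable_fun setT (beta_prob1 A).
Proof.
move=> mA; apply: (@eq_measurable_fun _ _ _ _ _
  (fun v : R => \1_(`]0, +oo[) v * (v * gamma_mean theta \1_A v))).
  move=> v _; rewrite /beta_prob1 indicE mem_setE in_itv/= andbT.
  by case: (0 < v); rewrite ?mul1r ?mul0r.
apply: measurable_funM; first by apply: measurable_indic; exact: measurable_itv.
apply: measurable_funM => //; apply: (measurable_gamma_mean theta_gt0 _ (ind0 A)).
exact: measurable_indic.
Qed.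

Lemma beta_law1E A v : measurable A -> 0 < v ->
  beta_law (v * theta) 1 A = (beta_prob1 A v)%:E.
Proof.
move=> mA v0; rewrite /beta_prob1 v0.
have vt0 : 0 < v * theta by rewrite mulr_gt0.
have mI : measurable_fun setT (\1_A : R -> R) by exact: measurable_indic.
have N : beta_norm (v * theta) 1 = (v * theta)^-1.
  apply: EFin_inj; rewrite -integral_powR01// /beta_norm /Rintegral.
  under eq_integral do rewrite subrr powRr0 mulr1.
  by rewrite integral_powR01.
rewrite EFinM -(gamma_meanE theta_gt0 mI (ind0 A) (ind1 A) v0) -ge0_integralZl//.
- rewrite /beta_law N setIC integral_mkcondr; apply: eq_integral => u.
  rewrite mem_setE in_itv/= => /andP[u0 _]; rewrite patchE indicE.
  case: (u \in A); last by rewrite mulr0 !mul0r mule0.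
  rewrite -EFinM powR_expR_ln// subrr powRr0; congr EFin.
  by rewrite [true%:R](_ : _ = 1)//; field; rewrite !gt_eqF.
- exact: measurable_funTS (measurable_gamma_mean_integrand theta mI v).
- by move=> u; exact: (gamma_mean_integrand_ge0 theta_gt0 (ind0 A)).
- by rewrite lee_fin ltW.
Qed.
End mixed_beta.

Lemma integral_gamma_law (R : realType) (r : R) d (Omega : measurableType d)
    (P : probability Omega R) (V : {RV P >-> R}) (F : R -> \bar R) :
  0 < r -> has_law P V (gamma_law r) -> measurable_fun setT F -> (forall v, 0 <= F v)%E ->
  (\int[P]_w F (V w) = \int[lebesgue_measure]_(v in `]0%R, +oo[)
    ((v `^ (r - 1) * expR (- v) / gamma_norm r)%:E * F v))%E.
Proof.
move=> r0 lawV mF F0.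
pose RT := measurableTypeR R.
have g0 := gamma_norm_gt0 r0.
pose D (v : R) : R := v `^ (r - 1) * expR (- v) / gamma_norm r.
have D0 v : 0 <= D v by rewrite divr_ge0 ?(ltW g0)// mulr_ge0 ?powR_ge0 ?expR_ge0.
have mD : @measurable_fun _ _ RT R setT D.
  by apply: measurable_funM => //; exact: measurable_gamma_integrand.
have mV : measurable_fun setT V by [].
have one0 (w : Omega) : 0 <= (fun=> 1 : R) w by [].
pose m1 := @weighted_image _ Omega _ RT R P setT (fun=> 1) V measurableT one0 (@measurable_cst _ _ Omega R setT 1) mV.
pose m2 := @weighted_image _ RT _ RT R lebesgue_measure _ D id (measurable_itv `]0, +oo[) D0 mD (@measurable_id _ RT setT).
have : (\int[m1]_v F v = \int[m2]_v F v)%E.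
  apply: eq_measure_integral => A mA _.
  have := lawV A mA; rewrite /m1 /m2 /= /weighted_image setTI integral_cst ?mul1e.
    by move=> e; apply: etrans e _; rewrite /gamma_law setIC.
  by rewrite -[_ @^-1` _]setTI; exact (mV measurableT A mA).
rewrite /m1 /m2 !ge0_integral_weighted_image// => <-.
by apply: eq_integral => w _; rewrite mul1e.
Qed.

Section gamma_sequence.
Context (R : realType) (theta r : R).
Hypotheses (theta_gt0 : 0 < theta) (r_gt0 : 0 < r).
Context d (Omega : measurableType d) (P : probability Omega R).
Variables (J Jt : nat -> {RV P >-> R}).
Hypothesis J0 : forall j w, 0 <= J j w.
Hypothesis simple_ae : {ae P, forall w, simple_points J w}.
Hypothesis picks : is_size_biased_picks J Jt.
Local Notation rho := (gamma_density theta).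
Hypothesis laplace_functional : forall f, testfun f ->
  (\int[P]_w (expR (- psum J f w))%:E = ((1 + levy_exponent rho f) `^ (- r))%:E)%E.
Context d' (Omega' : measurableType d') (P' : probability Omega' R).
Variables (V : {RV P' >-> R}) (Y : nat -> {RV P' >-> R}).
Hypothesis lawV : has_law P' V (gamma_law r).
Hypothesis iidY : cond_iid V Y (fun v => beta_law (v * theta) 1).

Let mU i : measurable_fun setT (residual_fraction J Jt i).
Proof.
have mJ j : measurable_fun setT (J j) by [].
have mJt k : (k < i.+1)%N -> measurable_fun setT (Jt k) by [].
exact: (measurable_residual_fraction J0 mJ mJt).
Qed.

Let mV : measurable_fun setT V. Proof. by []. Qed.

Let V_gt0 : {ae P', forall w, 0 < V w}.
Proof.
exists (V @^-1` `]-oo, 0]); split.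
- by rewrite -[_ @^-1` _]setTI; apply: mV => //; exact: measurable_itv.
- rewrite lawV; last exact: measurable_itv.
  rewrite /gamma_law (_ : _ `&` _ = set0) ?integral_set0//.
  rewrite -subset0 => x [] /=; rewrite !in_itv/= andbT => x0 /(le_lt_trans x0).
  by rewrite ltxx.
- by move=> w /= /negP; rewrite -leNgt in_itv.
Qed.

(** The expectations computed for the gamma density concern the positive functions 1 + 1_A;
    [integral_prod_indicators] passes from them to the indicators themselves, simultaneously on both
    probability spaces. *)
Let cylinder_residual n (A : nat -> set R) : (forall j, measurable (A j)) ->
  P [set w | forall i, (i < n)%N -> A i (residual_fraction J Jt i w)] =
  (\int[P']_w (\prod_(j < n) beta_prob1 theta (A j) (V w))%:E)%E.
Proof.
move=> mA.
pose X1 (j : nat) (B : set R) (w : Omega) : R := \1_B (residual_fraction J Jt j w).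
pose X2 (j : nat) (B : set R) (w : Omega') : R := beta_prob1 theta B (V w).
have -> : P [set w | forall i, (i < n)%N -> A i (residual_fraction J Jt i w)] =
    (\int[P]_w (\prod_(j < n) X1 j (A j) w)%:E)%E.
  set S := [set w | _].
  have mS : measurable S.
    rewrite (_ : S = \bigcap_(i in `I_n) (residual_fraction J Jt i @^-1` A i)).
      by apply: bigcap_measurableType => i _; rewrite -[_ @^-1` _]setTI; exact: mU.
    by apply/seteqP; split.
  have -> : P S = (\int[P]_w (\1_S w)%:E)%E by rewrite integral_indic// setIT.
  apply: eq_integral => w _; congr EFin; rewrite indicE.
  have [wS|wS] := boolP (w \in S).
    rewrite big1// => j _; rewrite /X1 indicE mem_set//.
    by move/set_mem: wS; apply.
  have /existsNP[i /not_implyP[ilt nAi]] : ~ (forall i, (i < n)%N -> A i (residual_fraction J Jt i w)).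
    by move=> h; move/negP: wS; apply; apply/mem_set.
  by rewrite (bigD1 (Ordinal ilt))//= /X1 indicE memNset// mul0r.
have ind01 (B : set R) (u : R) : 0 <= (\1_B u : R) <= 1.
  by rewrite indicE; case: (_ \in _); rewrite /= ?lexx ?ler01.
apply: (@integral_prod_indicators _ _ _ _ _ P P' X1 X2 n) => //.
- by move=> j B w; exact: beta_prob1_ge0.
- by move=> j B w _; case/andP: (ind01 B (residual_fraction J Jt j w)).
- by move=> j B w mB; exact: beta_prob1_le1.
- by move=> j w; rewrite /X1 indic0.
- by move=> j w; rewrite /X2 beta_prob1_set0.
- by move=> j B mB; apply: measurable_indic_comp.
- by move=> j B mB; apply: (measurableT_comp (measurable_beta_prob1 theta_gt0 mB)).
move=> {A mA} A mA.
pose a (j : nat) (u : R) : R := 1 + \1_(A j) u.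
have ma j : measurable_fun setT (a j) by apply: measurable_funD => //; exact: measurable_indic.
have a01 j u : 0 < a j u <= 2 by have := ind01 (A j) u; rewrite /a; lra.
have := gamma_residual_expectation theta_gt0 r_gt0 J0 simple_ae picks laplace_functional n ma a01.
move=> ->.
have mF : measurable_fun setT (fun v => (\prod_(j < n) (1 + beta_prob1 theta (A j) v))%:E).
  apply/measurable_EFinP; apply: measurable_prod => j _; apply: measurable_funD => //.
  exact: measurable_beta_prob1.
have F0 v : (0 <= (\prod_(j < n) (1 + beta_prob1 theta (A j) v))%:E)%E.
  rewrite lee_fin prodr_ge0// => j _; apply: addr_ge0 => //; exact: beta_prob1_ge0.
rewrite (integral_gamma_law r_gt0 lawV mF F0).
apply: eq_integral => v; rewrite mem_setE in_itv/= andbT => v0; rewrite -EFinM; congr (_ * _)%:E.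
by apply: eq_bigr => j _; rewrite gamma_mean_1D.
Qed.

Lemma gamma_residual_law : seq_eq_in_law P P' (residual_fraction J Jt) Y.
Proof.
apply: seq_eq_in_law_cylinders => // n A mA.
rewrite cylinder_residual//.
have [mq HY] := iidY (A := fun i : 'I_n => A i) (fun i => mA i).
pose G := \bigcup_(i in [set: unit]) preimage_set_system setT V measurable.
have GT : <<s \bigcup_(i in [set: unit]) preimage_set_system setT V measurable >> [set: Omega'].
  exact: (@measurableT _ (g_sigma_algebraType (\bigcup_(i in [set: unit]) preimage_set_system setT V measurable))).
(* The conditional identity is used only on the whole space: integrating out the mixing variable
   gives the unconditional probability of the cylinder. *)
have := HY _ GT; rewrite setTI => e.
transitivity (P' [set w | forall i : 'I_n, A i (Y i w)]); last first.
  congr (P' _); apply/seteqP; split => w /= h; first by move=> i ilt; exact: (h (Ordinal ilt)).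
  by move=> i; exact: h.
rewrite e.
have G_meas : G `<=` measurable.
  move=> _ [_ _ [B mB <-]]; exact: mV.
apply: ge0_ae_eq_integral => //.
- apply/measurable_EFinP; apply: measurable_prod => j _.
  by apply: (measurableT_comp (measurable_beta_prob1 theta_gt0 (mA j))).
- apply: (measurable_fun_g_sigma G_meas) => _ C mC; rewrite setTI; exact: mq.
- by move=> w _; rewrite lee_fin prodr_ge0// => j _; exact: beta_prob1_ge0.
- by move=> w _; apply: prode_ge0 => j _; exact: beta_law_ge0.
move: V_gt0; apply: filterS => w Vw _.
rewrite -prodEFin; apply: eq_bigr => j _; exact/esym/beta_law1E.
Qed.
End gamma_sequence.

(** The exponential of -oo is 0, so the function is a real exponential on the set where [F] is
    finite, extended by 0. *)
Lemma measurable_expeRN d (T : measurableType d) (R : realType) (F : T -> \bar R) :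
  measurable_fun setT F -> (forall w, 0 <= F w)%E -> measurable_fun setT (fun w => expeR (- F w)%E).
Proof.
move=> mF F0; pose D := F @^-1` (~` [set +oo%E]).
have mD : measurable D.
  by rewrite -[D]setTI; apply: mF => //; apply: measurableC; exact: emeasurable_set1.
have m1 : measurable_fun setT (fun w => (expR (- fine (F w)))%:E).
  by apply/measurable_EFinP; apply: measurable_expN; exact: measurableT_comp.
apply: (eq_measurable_fun _ _ (measurable_patch mD m1)) => w _; rewrite patchE.
have := F0 w; rewrite /D; case: ifPn => [/set_mem/=|/negP].
  by case: (F w).
case E : (F w) => [x| |]//=.
by move=> + _; case; apply/mem_set; rewrite /= E.
Qed.

(** * The negative binomial process: summability and absence of ties *)

Section enumeration.
Context (R : realType) d (Omega : measurableType d) (P : probability Omega R).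
Variables (B : R.-ker Omega ~> R) (J : nat -> {RV P >-> R}).
Hypothesis enumJ : is_decreasing_enumeration B J.

Let pos : set R := `]0%R, +oo[%classic.
Let mpos : measurable pos. Proof. exact: measurable_itv. Qed.

Lemma integral_enumeration (f : R -> R) : measurable_fun setT f -> (forall x, 0 <= f x) ->
  {ae P, forall w, (\int[B w]_(x in pos) (f x)%:E = \sum_(0 <= j <oo) (f (J j w))%:E)%E}.
Proof.
move=> mf f0; have [_] := enumJ; apply: filterS => w [Jpos _ BE].
pose m : {measure set R -> \bar R} :=
  mseries (fun j => \d_(J j w) : {measure set R -> \bar R}) 0.
have -> : (\int[B w]_(x in pos) (f x)%:E = \int[m]_(x in pos) (f x)%:E)%E.
  by apply: eq_measure_integral => A mA _; exact: BE.
have mfE : measurable_fun pos (fun x => (f x)%:E).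
  by apply: measurable_funTS; exact/measurable_EFinP.
rewrite ge0_integral_measure_series//; last by move=> x _; rewrite lee_fin.
apply: eq_eseriesr => j _; rewrite integral_dirac//.
by rewrite diracE mem_set ?mul1e// /pos/= in_itv/= Jpos.
Qed.

Variables (r : R) (rho1 rho : R -> R).
Hypothesis r_gt0 : 0 < r.
Hypotheses (mrho : measurable_fun setT rho) (rho0 : forall x, 0 <= rho x).
Hypothesis levy : (\int[lebesgue_measure]_(x in pos) (Num.min x 1 * rho x)%:E < +oo)%E.
Hypothesis rhoE : forall x, 0 < x -> rho1 x = rho x.
Hypothesis BN : is_BN P r rho1 B.
Local Notation psi := (levy_exponent rho).

Let esum (f : R -> R) w : \bar R := (\sum_(0 <= j <oo) (f (J j w))%:E)%E.

Let esum_ge0 f w : (forall x, 0 <= f x) -> (0 <= esum f w)%E.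
Proof. by move=> f0; apply: nneseries_ge0 => j _ _; rewrite lee_fin. Qed.

Let measurable_esum (f : R -> R) : measurable_fun setT f -> (forall x, 0 <= f x) ->
  measurable_fun setT (esum f).
Proof.
move=> mf f0; apply: ge0_emeasurable_sum => [j w _ _|j _]; first by rewrite lee_fin.
by apply/measurable_EFinP; exact: measurableT_comp.
Qed.

(** [rho1] is the density as given by the process and [rho] a version of it that is nonnegative on
    the whole line; they agree on the half-line of integration. The sum is kept in the extended
    reals, because finiteness of the total sum is derived from this very identity. *)
Lemma laplace_esum f : testfun f ->
  (\int[P]_w expeR (- esum f w) = ((1 + psi f) `^ (- r))%:E)%E.
Proof.
move=> tf; have [mf f0 _] := tf.
have [_ /(_ f mf f0)] := BN.
have -> : (\int[lebesgue_measure]_(x in `]0%R, +oo[) ((1 - expR (- f x)) * rho1 x)%:E = (psi f)%:E)%E.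
  rewrite -(levy_exponentE mrho rho0 levy tf); apply: eq_integral => x.
  by rewrite mem_setE in_itv/= andbT => x0; rewrite rhoE.
have psi0 : 0 <= psi f by exact: (levy_exponent_ge0 rho0).
have psi1 : 0 < 1 + psi f by rewrite ltr_wpDr.
rewrite -EFinD poweR_EFin inver gt_eqF ?powR_gt0// -powRN => <-.
have mfE : measurable_fun setT (fun x => (f x)%:E) by exact/measurable_EFinP.
have mB : measurable_fun setT (fun w => \int[B w]_(x in `]0%R, +oo[) (f x)%:E)%E.
  under eq_fun do rewrite integral_mkcond.
  apply: measurable_fun_integral_kernel => [U mU|z|]; first exact: measurable_kernel.
    by rewrite patchE; case: ifP => // _; rewrite lee_fin.
  exact: measurable_patch.
have B0 w : (0 <= \int[B w]_(x in `]0%R, +oo[) (f x)%:E)%E.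
  by apply: integral_ge0 => x _; rewrite lee_fin.
apply: ge0_ae_eq_integral => //.
- by apply: measurable_expeRN => [|w]; [exact: measurable_esum|exact: esum_ge0].
- exact: measurable_expeRN.
- by move=> w _; exact: expeR_ge0.
- by move=> w _; exact: expeR_ge0.
by apply: filterS (integral_enumeration mf f0) => w -> _.
Qed.

Lemma levy_exponent_cvg0 :
  psi (fun x => m.+1%:R^-1 * `|x|) @[m --> \oo] --> (0 : R).
Proof.
pose f (m : nat) (x : R) : R := m.+1%:R^-1 * `|x|.
have tf m : testfun (f m) by apply: testfunZ; [rewrite invr_ge0|exact: testfun_norm].
pose F (m : nat) (x : R) : \bar R := ((1 - expR (- f m x)) * rho x)%:E.
have m0 m : (0 : R) < m.+1%:R by rewrite ltr0n.
have inv1 m : m.+1%:R^-1 <= 1 :> R by rewrite invf_le1// ler1n.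
have mm : measurable_fun setT (fun x : R => Num.min x 1 * rho x).
  by apply: measurable_funM => //; exact: measurable_minr.
have mF m : measurable_fun setT (F m).
  have [mfm _ _] := tf m; apply/measurable_EFinP; apply: measurable_funM => //.
  by apply: measurable_funB => //; exact: measurable_expN.
have FE m : (\int[lebesgue_measure]_(x in pos) F m x)%E = (psi (f m))%:E.
  exact: levy_exponentE.
(* The dominating function comes from [onem_expN_bound] with slope at most 1, whence the factor 1 +
   1. *)
have := @dominated_convergence _ (measurableTypeR R) R lebesgue_measure pos mpos F (cst 0%E)
  (fun x => (2 * (Num.min x 1 * rho x))%:E).
have m2 : measurable_fun pos (fun x => (2 * (Num.min x 1 * rho x))%:E).
  by apply: measurable_funTS; apply/measurable_EFinP; exact: measurable_funM.
case.
- by move=> m; exact: (measurable_funTS (mF m)).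
- exact: measurable_cst.
- apply: aeW => x _; rewrite /F /f.
  apply/cvg_EFin; first by apply: nearW.
  rewrite -(mul0r (rho x)); apply: cvgMl.
  rewrite -(subrr 1); apply: cvgB; first exact: cvg_cst.
  have : expR (- (m.+1%:R^-1 * `|x|)) @[m --> \oo] --> expR (- (0 * `|x|)).
    apply: continuous_cvg; first exact: continuous_expR.
    by apply: cvgN; apply: cvgMl; exact: cvg_harmonic.
  by rewrite mul0r oppr0 expR0.
- apply/integrableP; split=> //.
  have c2 : (0 : R) <= 2 by [].
  have mmin : measurable_fun setT (fun x : R => 2 * Num.min x 1).
    by apply: measurable_funM => //; exact: measurable_minr.
  have h0 x : 0 < x -> 0 <= 2 * Num.min x 1 :> R.
    by move=> x0; rewrite mulr_ge0// le_min (ltW x0)/=.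
  have := integral_lty_levy mrho rho0 levy mmin h0 c2 (fun x _ => lexx _).
  congr (_ < _)%E; apply: eq_integral => x; rewrite mem_setE in_itv/= andbT => x0.
  by rewrite ger0_norm ?mulrA// mulr_ge0// h0.
- apply: aeW => x m; rewrite /pos/= in_itv/= andbT => x0.
  have fx0 : 0 <= f m x by rewrite mulr_ge0// invr_ge0.
  have e0 : 0 <= 1 - expR (- f m x) by rewrite subr_ge0 -expR0 ler_expR oppr_le0.
  rewrite /F lee_fin ger0_norm ?mulr_ge0// mulrA ler_wpM2r//.
  have := @onem_expN_bound R x (f m x) 1 x0 ler01; rewrite [1 + 1](_ : _ = 2)//; apply => //.
  by rewrite /f gtr0_norm// ler_wpM2r// ltW.
move=> _ _; rewrite integral0 => /fine_cvg.
have -> : fine \o (fun n => (\int[lebesgue_measure]_(x in pos) F n x)%E) = (fun m => psi (f m)).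
  by apply/funext => m /=; rewrite FE.
exact.
Qed.

(** With S the sum of all points, e^(-S/(m+1)) vanishes where S is infinite, so its mean is at most
    the probability that S is finite. That mean is (1 + psi)^(-r) >= 1 - r psi, and psi tends to 0
    with the slope. *)
Lemma summable_points : {ae P, forall w, summable_at J w}.
Proof.
have [J0 _] := enumJ; have tn := @testfun_norm R.
pose A := [set w | summable_at J w].
have esumE w : esum (fun x => `|x|) w = (\sum_(0 <= j <oo) (J j w)%:E)%E.
  by apply: eq_eseriesr => j _; rewrite ger0_norm.
have mA : measurable A.
  have mn : measurable_fun setT (fun x : R => `|x|) by exact: normr_measurable.
  have -> : A = ~` (esum (fun x => `|x|) @^-1` [set +oo%E]).
    by apply/seteqP; split => w; rewrite /A/= esumE /summable_at ltey => /eqP.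
  apply: measurableC; rewrite -[_ @^-1` _]setTI.
  apply: (measurable_esum mn) => //; exact: emeasurable_set1.
have PA_fin : P A \is a fin_num by exact: fin_num_measure.
have bound m : 1 - r * psi (fun x => m.+1%:R^-1 * `|x|) <= fine (P A).
  have l0 : (0 : R) < m.+1%:R^-1 by rewrite invr_gt0 ltr0n.
  have tm := testfunZ (ltW l0) tn.
  set f := (fun x : R => m.+1%:R^-1 * `|x|) in tm *.
  have [mf f0 _] := tm.
  have psi0 : 0 <= psi f by exact: (levy_exponent_ge0 rho0).
  have /andP[_ ] := powRN_tangent ltr01 psi0 (ltW r_gt0).
  rewrite !powR1 mulr1 => h.
  apply: (@le_trans _ _ ((1 + psi f) `^ (- r))); first lra.
  rewrite -lee_fin fineK// -laplace_esum//.
  have -> : P A = (\int[P]_w (\1_A w)%:E)%E by rewrite integral_indic// setIT.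
  apply: ge0_le_integral => //.
  - by move=> w _; exact: expeR_ge0.
  - by apply: measurable_expeRN => [|w]; [exact: measurable_esum|exact: esum_ge0].
  - by apply/measurable_EFinP; exact: measurable_indic.
  - move=> w _; rewrite indicE.
    have fE : esum f w = (m.+1%:R^-1%:E * \sum_(0 <= j <oo) (J j w)%:E)%E.
      rewrite -nneseriesZl; last by move=> j _; rewrite lee_fin.
      by apply: eq_eseriesr => j _; rewrite /f ger0_norm.
    have [wA|wA] := boolP (w \in A).
      have := esum_ge0 w f0; case: (esum f w) => [y| |]//=.
      by rewrite !lee_fin => y0; rewrite -expR0 ler_expR oppr_le0.
    have -> : esum f w = +oo%E.
      rewrite fE; move/negP: wA => wA.
      have -> : (\sum_(0 <= j <oo) (J j w)%:E = +oo)%E.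
        apply: contrapT => h'; apply: wA; apply/mem_set.
        by rewrite /A/= /summable_at ltey; apply/eqP.
      by rewrite gt0_muley// lte_fin.
    by [].
have PA : 1 <= fine (P A).
  have c1 : 1 - r * psi (fun x => m.+1%:R^-1 * `|x|) @[m --> \oo] --> (1 - r * 0 : R).
    by apply: cvgB; [exact: cvg_cst|apply: cvgMr; exact: levy_exponent_cvg0].
  have c2 : fine (P A) @[_ --> \oo] --> fine (P A) by exact: cvg_cst.
  have : 1 - r * 0 <= fine (P A).
    by apply: (ler_cvg_to c1 c2); apply: nearW => m; exact: bound.
  by rewrite mulr0 subr0.
exists (~` A); split => //; first exact: measurableC.
rewrite probability_setC// -(fineK PA_fin) -EFinB; congr EFin; apply/eqP.
have : fine (P A) <= 1 by rewrite -lee_fin fineK// probability_le1.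
by move=> h; rewrite subr_eq0 eq_le PA h.
Qed.

Lemma laplace_points f : testfun f ->
  (\int[P]_w (expR (- psum J f w))%:E = ((1 + psi f) `^ (- r))%:E)%E.
Proof.
move=> tf; have [mf f0 _] := tf; rewrite -laplace_esum//.
apply: ge0_ae_eq_integral => //.
- by apply/measurable_EFinP; apply: measurable_expN; exact: measurable_psum.
- by apply: measurable_expeRN => [|w]; [exact: measurable_esum|exact: esum_ge0].
- by move=> w _; exact: expeR_ge0.
have [J0 _] := enumJ.
by apply: filterS summable_points => w sw _; rewrite /esum -(psumE J0 tf sw).
Qed.
End enumeration.

(** * Absence of ties *)

Section no_ties.
Context (R : realType) (rho : R -> R).
Local Notation mu := (@lebesgue_measure R).
Hypotheses (mrho : measurable_fun setT rho) (rho0 : forall x, 0 <= rho x).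
Hypothesis levy : (\int[mu]_(x in `]0%R, +oo[) (Num.min x 1 * rho x)%:E < +oo)%E.
Hypothesis rho_bounded : forall a, 0 < a -> exists K, forall x, a <= x -> rho x <= K.
Context d (Omega : measurableType d) (P : probability Omega R).
Variables (J : nat -> {RV P >-> R}) (r : R).
Hypothesis r0 : 0 <= r.
Hypothesis J0 : forall j w, 0 <= J j w.
Hypothesis J_gt0 : {ae P, forall w, forall j, 0 < J j w}.
Hypothesis sumJ : {ae P, forall w, summable_at J w}.
Local Notation psi := (levy_exponent rho).
Hypothesis laplace_functional : forall f, testfun f ->
  (\int[P]_w (expR (- psum J f w))%:E = ((1 + psi f) `^ (- r))%:E)%E.

Definition tie (i j : nat) (a b : R) : set Omega := [set w | J i w = J j w /\ a < J i w <= b].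

Let mJ j : measurable_fun setT (J j). Proof. by []. Qed.

Lemma measurable_tie i j a b : measurable (tie i j a b).
Proof.
have -> : tie i j a b = (fun w => J i w - J j w) @^-1` [set 0] `&` J i @^-1` `]a, b].
  apply/seteqP; split => w /=; rewrite in_itv/=.
    by move=> [-> ->]; rewrite subrr.
  by move=> [/eqP]; rewrite subr_eq0 => /eqP.
apply: measurableI; rewrite -[_ @^-1` _]setTI.
  by apply: measurable_funB.
by apply: mJ => //; exact: measurable_itv.
Qed.

Let psum_ge2 f w i j : testfun f -> summable_at J w -> i != j ->
  f (J i w) + f (J j w) <= psum J f w.
Proof.
move=> tf sw ij; have [_ f0 _] := tf.
pose M := (maxn i j).+1.
have iM : (i < M)%N by rewrite ltnS leq_maxl.
have jM : (j < M)%N by rewrite ltnS leq_maxr.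
rewrite -lee_fin (psumE J0 tf sw).
apply: (@le_trans _ _ (\sum_(0 <= k < M) (f (J k w))%:E)%E); last first.
  by apply: nneseries_lim_ge => k _; rewrite lee_fin.
rewrite big_mkord sumEFin lee_fin (bigD1 (Ordinal iM))//= lerD2l.
rewrite (bigD1 (Ordinal jM))/=; last by rewrite -val_eqE/= eq_sym.
by rewrite lerDl sumr_ge0.
Qed.

(* With [N] the number of points in the cell [I] and [p] its intensity, the Palm
   formula gives E[N (1 - e^(1 - N))] = r p (1 - (1 + psi)^(- r - 1)), while
   N (1 - e^(1 - N)) >= 1 as soon as [I] contains two points. *)
Lemma cell_tie i j a c K : i != j -> 0 < a -> 0 <= c -> 0 <= K ->
  (forall x, a <= x -> rho x <= K) ->
  (P (tie i j a (a + c)) <= (r * (r + 1) * (K * c) ^+ 2)%:E)%E.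
Proof.
move=> ij a0 c0 K0 rhoK.
pose I : set R := `]a, a + c]%classic.
have mI : measurable I by exact: measurable_itv.
pose g (x : R) : R := \1_I x.
have mg : measurable_fun setT g by exact: measurable_indic.
have g01 x : g x = 0 \/ (g x = 1 /\ a < x).
  rewrite /g indicE; have [/set_mem|] := boolP (x \in I); last by left.
  by rewrite /I/= in_itv/= => /andP[ax _]; right.
have g0 x : 0 <= g x by case: (g01 x) => [->|[->]].
have tg : testfun g.
  split => //; exists a^-1; first by rewrite invr_ge0 ltW.
  move=> x x0; case: (g01 x) => [->|[-> ax]]; first by rewrite mulr_ge0// invr_ge0 ltW.
  by rewrite mulrC ler_pdivlMr// mul1r ltW.
have tz : testfun (fun _ : R => 0 : R).
  by split => //; exists 0 => // x _; rewrite mul0r.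
have [N [mN PN subN]] := sumJ.
pose Z w : R := \1_(~` N) w.
have mNC : measurable (~` N) by exact: measurableC.
have mZ : measurable_fun setT Z by exact: measurable_indic.
have Z0 w : 0 <= Z w by rewrite /Z.
have sumZ w : Z w != 0 -> summable_at J w.
  rewrite /Z indicE; have [/set_mem wN _|_] := boolP (w \in ~` N); last by rewrite eqxx.
  by apply: contrapT => ns; apply: wN; exact: subN.
have Z_ae (X : Omega -> R) : measurable_fun setT X -> (forall w, 0 <= X w) ->
    (\int[P]_w (Z w * X w)%:E = \int[P]_w (X w)%:E)%E.
  move=> mX X0; apply: ge0_ae_eq_integral => //.
  - by apply/measurable_EFinP; exact: measurable_funM.
  - exact/measurable_EFinP.
  - by move=> w _; rewrite lee_fin mulr_ge0.
  - by move=> w _; rewrite lee_fin.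
  exists N; split => // w /= nw; apply: contrapT => wN; apply: nw => _.
  by rewrite /Z indicE mem_set// mul1r.
have mpsum f : testfun f -> measurable_fun setT (psum J f).
  by move=> [mf f0 _]; exact: measurable_psum.
have ZL f : testfun f ->
    (\int[P]_w (Z w * expR (- psum J f w))%:E = (1 * (1 + psi f) `^ (- r))%:E)%E.
  move=> tf; rewrite mul1r -laplace_functional// Z_ae//.
  by apply: measurable_expN; exact: mpsum.
have PD f := @palm_derivative R rho mrho rho0 levy d Omega P Z J 1 r Z0 mZ J0 mJ sumZ ler01 r0 ZL f g 1.
have g1 x : g x <= 1 by case: (g01 x) => [->|[->]].
pose I0 := (\int[mu]_(x in `]0%R, +oo[) (g x * rho x)%:E)%E.
have I0_le : (I0 <= (K * c)%:E)%E.
  have -> : I0 = (\int[mu]_(x in I) (rho x)%:E)%E.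
    rewrite /I0 integral_mkcond [RHS]integral_mkcond; apply: eq_integral => x _.
    rewrite !patchE /g indicE !mem_setE !in_itv/= andbT.
    have [ax|ax] := ltP a x; last by rewrite /= mul0r; case: ifP.
    by rewrite (lt_trans a0 ax)/=; case: (x <= a + c); rewrite ?mul1r ?mul0r.
  have -> : (K * c)%:E = (\int[mu]_(x in I) (cst K%:E x))%E.
    rewrite integral_cst//.
    suff h : lebesgue_measure (I : set R) = c%:E by rewrite EFinM; congr (_ * _)%E.
    rewrite lebesgue_measure_itv/= lte_fin ltrDl; case: ltgtP c0 => // [c0 _|<- _].
      by rewrite -EFinB addrAC subrr add0r.
    by [].
  apply: ge0_le_integral => //.
  - by move=> x _; rewrite lee_fin.
  - by apply: measurable_funTS; exact/measurable_EFinP.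
  - by move=> x; rewrite /I/= in_itv/= => /andP[ax _]; rewrite lee_fin rhoK// ltW.
have I0_ge0 : (0 <= I0)%E by apply: integral_ge0 => x _; rewrite lee_fin mulr_ge0.
pose p := fine I0.
have pE : I0 = p%:E by rewrite fineK// ge0_fin_numE// (le_lt_trans I0_le)// ltry.
have p0 : 0 <= p by rewrite -lee_fin -pE.
have pK : p <= K * c by rewrite -lee_fin -pE.
have psi0 : psi (fun=> 0) = 0.
  by rewrite levy_exponent.unlock integral0_eq// => x _; rewrite oppr0 expR0 subrr mul0r.
have psig0 : 0 <= psi g by exact: (levy_exponent_ge0 rho0).
have e0 x : 0 <= 1 - expR (- g x) by rewrite subr_ge0 -expR0 ler_expR oppr_le0.
have mgr : measurable_fun setT (fun x => g x * rho x) by exact: measurable_funM.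
have psig : psi g <= p.
  rewrite -lee_fin -pE -(levy_exponentE mrho rho0 levy tg); apply: ge0_le_integral => //.
  - by move=> x _; rewrite lee_fin mulr_ge0.
  - apply: measurable_funTS; apply/measurable_EFinP; apply: measurable_funM => //.
    by apply: measurable_funB => //; exact: measurable_expN.
  - by apply: measurable_funTS; exact/measurable_EFinP.
  - move=> x _; rewrite lee_fin ler_wpM2r//.
    by have := expR_ge1Dx (- g x); lra.
have eN : (\int[P]_w (Z w * psum J g w)%:E = (r * p)%:E)%E.
  have := PD _ tz tg ler01 g1; rewrite psi0 addr0 powR1 mulr1 mul1r => e.
  apply: etrans (etrans e _).
    apply: eq_integral => w _; congr EFin; rewrite (_ : psum J (fun=> 0) w = 0).
      by rewrite oppr0 expR0 mulr1.
    by rewrite psum.unlock eseries0.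
  rewrite EFinM -pE; congr (_ * _)%E; apply: eq_integral => x _.
  by rewrite oppr0 expR0 mulr1.
(* The Palm formula with tilt [f = g]: a point of the cell has [g = 1], so the removed point
   contributes the factor e^(-1), later compensated by [expR 1]. *)
have eNe : (\int[P]_w (Z w * (expR (- psum J g w) * psum J g w))%:E =
    (r * (1 + psi g) `^ (- r - 1) * (expR (- 1) * p))%:E)%E.
  have := PD _ tg tg ler01 g1; rewrite mul1r => e.
  apply: etrans (etrans e _).
    by apply: eq_integral => w _; rewrite mulrA.
  rewrite [RHS]EFinM; congr (_ * _)%E; rewrite EFinM -pE -ge0_integralZl//.
  - apply: eq_integral => x _; rewrite -EFinM; congr EFin.
    by case: (g01 x) => [->|[-> _]]; [rewrite !mul0r mulr0|rewrite !mul1r].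
  - by apply: measurable_funTS; exact/measurable_EFinP.
  - by move=> x _; rewrite lee_fin mulr_ge0.
have mt := measurable_tie i j a (a + c).
have psum0 w : 0 <= psum J g w by exact: psum_ge0.
have mE : measurable_fun setT (fun w => expR (- psum J g w) * psum J g w).
  by apply: measurable_funM; [apply: measurable_expN|]; exact: mpsum.
(* Pointwise, 1_tie + n e^(1-n) <= n. For n >= 2 this uses e^(-1) <= 1/2; without a tie it suffices
   that n is 0 or at least 1. *)
have key : (P (tie i j a (a + c)) +
    (expR 1)%:E * \int[P]_w (Z w * (expR (- psum J g w) * psum J g w))%:E <=
    \int[P]_w (Z w * psum J g w)%:E)%E.
  have -> : P (tie i j a (a + c)) = (\int[P]_w (Z w * \1_(tie i j a (a + c)) w)%:E)%E.
    by rewrite Z_ae// integral_indic// setIT.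
  rewrite -ge0_integralZl//; last 2 first.
  - by apply/measurable_EFinP; exact: measurable_funM.
  - by move=> w _; rewrite lee_fin mulr_ge0// mulr_ge0 ?expR_ge0.
  rewrite -ge0_integralD//; last 4 first.
  - by move=> w _; rewrite lee_fin mulr_ge0.
  - by apply/measurable_EFinP; apply: measurable_funM => //; exact: measurable_indic.
  - by move=> w _; rewrite -EFinM lee_fin mulr_ge0 ?expR_ge0// mulr_ge0// mulr_ge0 ?expR_ge0.
  - by apply/measurable_EFinP; apply: measurable_funM => //; exact: measurable_funM.
  apply: ge0_le_integral => //.
  - move=> w _; rewrite -EFinM -EFinD lee_fin addr_ge0 ?mulr_ge0 ?expR_ge0//.
  - apply: emeasurable_funD.
      by apply/measurable_EFinP; apply: measurable_funM => //; exact: measurable_indic.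
    by apply/measurable_EFinP; apply: measurable_funM => //; exact: measurable_funM.
  - by apply/measurable_EFinP; apply: measurable_funM => //; exact: mpsum.
  move=> w _; rewrite -EFinM -EFinD lee_fin.
  have [->|/sumZ sw] := eqVneq (Z w) 0; first by rewrite !mul0r mulr0 addr0.
  rewrite mulrCA -mulrDr ler_wpM2l//.
  set n := psum J g w.
  have e1 : expR 1 * expR (- n) = expR (1 - n) by rewrite -expRD.
  rewrite mulrA e1.
  have [wt|wt] := boolP (w \in tie i j a (a + c)).
    move/set_mem: wt => [Jij Ji]; rewrite indicE mem_set//.
    have n2 : 2 <= n.
      apply: le_trans (psum_ge2 tg sw ij); rewrite -Jij /g indicE mem_set//=; lra.
    have h1 : expR (1 - n) <= expR (- 1) by rewrite ler_expR; lra.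
    have h2 : expR (- 1) <= 2^-1 :> R.
      by rewrite expRN lef_pV2 ?posrE ?expR_gt0//; have := expR_ge1Dx (1 : R); lra.
    have := expR_ge0 (1 - n) => h3; rewrite /=; nra.
  rewrite indicE (negbTE wt) add0r.
  have [[k gk]|nk] := pselect (exists k, g (J k w) = 1).
    have n1 : 1 <= n by rewrite -gk; exact: psum_ge.
    have h1 : expR (1 - n) <= 1 by rewrite -[leRHS]expR0 ler_expR; lra.
    by rewrite ler_piMl//; lra.
  have -> : n = 0.
    rewrite /n psum.unlock eseries0// => k _ _.
    by case: (g01 (J k w)) => [->//|[gk _]]; case: nk; exists k.
  by rewrite mulr0.
move: key; rewrite eN eNe.
have Pf : P (tie i j a (a + c)) \is a fin_num by exact: fin_num_measure.
rewrite -(fineK Pf) -EFinM -EFinD !lee_fin.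
set t := fine _; set Q := (1 + psi g) `^ (- r - 1).
have ee : expR 1 * expR (- 1) = 1 :> R by rewrite -expRD subrr expR0.
have -> : expR 1 * (r * Q * (expR (- 1) * p)) = r * Q * p * (expR 1 * expR (- 1)) by ring.
rewrite ee mulr1 => h.
have q0 : 0 <= r + 1 by rewrite addr_ge0.
have /andP[_] := powRN_tangent ltr01 psig0 q0; rewrite !powR1 mulr1 opprD -/Q => h2.
have rp0 : 0 <= r * p by exact: mulr_ge0.
have h3 : t <= r * p * ((r + 1) * psi g) by have := ler_wpM2l rp0 h2; lra.
apply: (le_trans h3).
have h4 : r * p * ((r + 1) * psi g) <= r * p * ((r + 1) * p) by rewrite ler_wpM2l// ler_wpM2l.
apply: (le_trans h4).
have -> : r * p * ((r + 1) * p) = r * (r + 1) * p ^+ 2 by ring.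
rewrite ler_wpM2l ?mulr_ge0// ler_pXn2r ?nnegrE//; exact: mulr_ge0.
Qed.
(** Two equal points lie in the same cell of any subdivision. The bound for one cell is quadratic in
    its width, so cutting the interval into n + 1 equal cells gives a total of order 1/(n + 1). *)
Lemma tie_null i j a b : i != j -> 0 < a -> P (tie i j a b) = 0%E.
Proof.
move=> ij a0; have [K rhoK] := rho_bounded a0.
have K0 : 0 <= K by exact: le_trans (rhoK _ (lexx a)).
have cells c n : 0 <= c ->
    (P (tie i j a (a + n%:R * c)) <= (n%:R * (r * (r + 1) * (K * c) ^+ 2))%:E)%E.
  move=> c0; elim: n => [|n IH].
    rewrite !mul0r addr0 (_ : tie i j a a = set0) ?measure0//.
    by rewrite -subset0 => w [_ /andP[h1 h2]]; have := lt_le_trans h1 h2; rewrite ltxx.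
  pose a' := a + n%:R * c.
  have aa' : a <= a' by rewrite lerDl mulr_ge0.
  have e : a + n.+1%:R * c = a' + c by rewrite /a' -natr1; ring.
  have sub : tie i j a (a + n.+1%:R * c) `<=` tie i j a a' `|` tie i j a' (a' + c).
    rewrite e => w [Jij /andP[h1 h2]]; have [h3|h3] := leP (J i w) a'; [left|right];
      by split => //; rewrite ?h1 ?h3.
  apply: (@le_trans _ _ (P (tie i j a a' `|` tie i j a' (a' + c)))).
    apply: le_measure => //; rewrite inE; first exact: measurable_tie.
    by apply: measurableU; exact: measurable_tie.
  apply: (@le_trans _ _ (P (tie i j a a') + P (tie i j a' (a' + c)))%E).
    by apply: measureU2; exact: measurable_tie.
  rewrite -[n.+1%:R]natr1 mulrDl mul1r EFinD; apply: leeD => //.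
  apply: cell_tie => //; first exact: lt_le_trans aa'.
  by move=> x a'x; apply: rhoK; exact: le_trans a'x.
have [ab|ab] := ltP a b; last first.
  rewrite (_ : tie i j a b = set0) ?measure0//.
  by rewrite -subset0 => w [_ /andP[h1 h2]]; have := lt_le_trans h1 (le_trans h2 ab); rewrite ltxx.
pose D := r * (r + 1) * (K * (b - a)) ^+ 2.
have D0 : 0 <= D by rewrite mulr_ge0 ?exprn_even_ge0// mulr_ge0// addr_ge0.
have bound n : fine (P (tie i j a b)) <= n.+1%:R^-1 * D.
  have n0 : (0 : R) < n.+1%:R by rewrite ltr0n.
  have c0 : 0 <= (b - a) / n.+1%:R by rewrite divr_ge0// subr_ge0 ltW.
  rewrite -lee_fin fineK; last by apply: fin_num_measure; exact: measurable_tie.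
  have := cells _ n.+1 c0.
  have -> : a + n.+1%:R * ((b - a) / n.+1%:R) = b by field; rewrite gt_eqF.
  move/le_trans; apply; rewrite lee_fin le_eqVlt; apply/orP; left; apply/eqP.
  by rewrite /D; field; rewrite gt_eqF.
have t0 : 0 <= fine (P (tie i j a b)) by exact: fine_ge0.
suff -> : P (tie i j a b) = (fine (P (tie i j a b)))%:E.
  congr EFin; apply/eqP; rewrite eq_le t0 andbT.
  have c1 : n.+1%:R^-1 * D @[n --> \oo] --> 0 * D by apply: cvgMl; exact: cvg_harmonic.
  have c2 : fine (P (tie i j a b)) @[_ --> \oo] --> fine (P (tie i j a b)) by exact: cvg_cst.
  rewrite -(mul0r D); apply: (ler_cvg_to c2 c1); apply: nearW => n; exact: bound.
by rewrite fineK//; apply: fin_num_measure; exact: measurable_tie.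
Qed.

Lemma simple_points_ae : {ae P, forall w, simple_points J w}.
Proof.
(* Countably many null events: all pairs of distinct indices, and intervals from 1/(m+1) to m+1 that
   exhaust the positive axis. *)
pose A (m : nat * nat * nat) : set Omega :=
  if m.1.1 == m.1.2 then set0 else tie m.1.1 m.1.2 (m.2.+1%:R^-1) (m.2.+1%:R).
have A_null m : P (A m) = 0%E.
  rewrite /A; case: eqP => [_|/eqP ij]; first exact: measure0.
  by apply: tie_null => //; rewrite invr_gt0 ltr0n.
have mA m : measurable (A m).
  by rewrite /A; case: eqP => // _; exact: measurable_tie.
have noA : {ae P, forall w, forall i j m, ~ A ((i, j), m) w}.
  apply: ae_foralln => i; apply: ae_foralln => j; apply: ae_foralln => m.
  exists (A ((i, j), m)); split; [exact: mA|exact: A_null|].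
  by move=> w /= /contrapT.
apply: filterS3 J_gt0 sumJ noA => w Jpos sw nA; split => // i j Jij.
apply/eqP; apply: contrapT => /negP ij.
have Ji := Jpos i.
pose m := maxn (Num.truncn (J i w)^-1) (Num.truncn (J i w)).
apply: (nA i j m).
rewrite /A/= (negbTE ij); split => //; apply/andP; split.
  by rewrite invf_plt ?posrE// -truncn_le_nat leq_maxl.
by rewrite ltW// -truncn_le_nat leq_maxr.
Qed.
End no_ties.

(** * Stick-breaking and deduction of the theorem *)

Lemma stick_breaking_ae (R : realType) d (Omega : measurableType d) (P : probability Omega R)
    (J Jt : nat -> {RV P >-> R}) :
  (forall j w, 0 <= J j w) -> {ae P, forall w, simple_points J w} ->
  is_size_biased_picks J Jt -> stick_breaking P J Jt.
Proof.
move=> J0 simple_ae picks.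
have hits : {ae P, forall w, forall n k, (k < n)%N -> pick_hits J Jt k w}.
  by apply: ae_foralln => n; exact: hits_ae.
apply: filterS2 simple_ae hits => w sw hw n.
by apply: stick_breaking_at => // k; exact: (hw k.+1).
Qed.

Section negative_binomial.
Context (R : realType) (r : R) (r_gt0 : 0 < r).
Context d (Omega : measurableType d) (P : probability Omega R).
Variables (B : R.-ker Omega ~> R) (J : nat -> {RV P >-> R}) (W : nat -> Omega -> R).
Variables (rho1 rho : R -> R).
Hypotheses (mrho : measurable_fun setT rho) (rho0 : forall x, 0 <= rho x).
Hypothesis levy :
  (\int[lebesgue_measure]_(x in `]0%R, +oo[) (Num.min x 1 * rho x)%:E < +oo)%E.
Hypothesis rho_bounded : forall a, 0 < a -> exists K, forall x, a <= x -> rho x <= K.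
Hypothesis rhoE : forall x, 0 < x -> rho1 x = rho x.
Hypothesis PK : PK_construction r rho1 B J W.

Lemma PK_laplace f : testfun f ->
  (\int[P]_w (expR (- psum J f w))%:E = ((1 + levy_exponent rho f) `^ (- r))%:E)%E.
Proof.
exact: (laplace_points (PK_points PK) r_gt0 mrho rho0 levy rhoE (PK_process PK)).
Qed.

Lemma PK_simple_points : {ae P, forall w, simple_points J w}.
Proof.
have [J0 enumJ] := PK_points PK.
apply: (simple_points_ae mrho rho0 levy rho_bounded (ltW r_gt0) J0 _ _ PK_laplace).
  by apply: filterS enumJ => w [].
exact: (summable_points (PK_points PK) r_gt0 mrho rho0 levy rhoE (PK_process PK)).
Qed.
End negative_binomial.

Theorem theorem4p1 (R : realType) (r : R) (r_gt0 : 0 < r)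
    (d : measure_display) (Omega : measurableType d) (P : probability Omega R)
    (B : R.-ker Omega ~> R) (J Jt : nat -> {RV P >-> R})
    (W : nat -> Omega -> R) :
  (forall theta : R, 0 < theta ->
     PK_construction r (fun x => theta * expR (- x) / x) B J W ->
     is_size_biased_picks J Jt ->
     stick_breaking P J Jt /\
     forall (d' : measure_display) (Omega' : measurableType d')
            (P' : probability Omega' R)
            (Gamma_r : {RV P' >-> R}) (Y : nat -> {RV P' >-> R}),
       has_law P' Gamma_r (gamma_law r) ->
       cond_iid Gamma_r Y (fun v => beta_law (v * theta) 1) ->
       seq_eq_in_law P P' (residual_fraction J Jt) Y)
  /\
  (forall alpha C : R, 0 < alpha -> alpha < 1 -> 0 < C ->
     PK_construction r (fun x => C * alpha * x `^ (- alpha - 1)) B J W ->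
     is_size_biased_picks J Jt ->
     stick_breaking P J Jt /\
     forall i : nat, (1 <= i)%N ->
       has_law P (residual_fraction J Jt i.-1)
         (beta_law (i%:R * alpha) (1 - alpha))).
Proof.
split.
- move=> theta theta_gt0 PK picks; have [J0 _] := PK_points PK.
  (* The density of the statement is negative for negative x; it is exchanged for a version
     nonnegative everywhere that agrees with it on the half-line carrying the Levy measure. *)
  have rhoE x : 0 < x -> theta * expR (- x) / x = gamma_density theta x.
    by move=> x0; rewrite gamma_densityE.
  have simple_ae := PK_simple_points r_gt0 (measurable_gamma_density theta)
    (gamma_density_ge0 theta_gt0) (gamma_density_levy theta_gt0)
    (gamma_density_bounded theta_gt0) rhoE PK.
  have laplace := PK_laplace r_gt0 (measurable_gamma_density theta)
    (gamma_density_ge0 theta_gt0) (gamma_density_levy theta_gt0) rhoE PK.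
  split; first exact: stick_breaking_ae.
  move=> d' Omega' P' V Y lawV iidY.
  exact: (gamma_residual_law theta_gt0 r_gt0 J0 simple_ae picks laplace lawV iidY).
- move=> alpha C alpha_gt0 alpha_lt1 C_gt0 PK picks; have [J0 _] := PK_points PK.
  have simple_ae := PK_simple_points r_gt0 (@measurable_stable_density R alpha C)
    (stable_density_ge0 alpha_gt0 C_gt0) (stable_density_levy alpha_gt0 alpha_lt1 C_gt0)
    (stable_density_bounded alpha_gt0 C_gt0) (fun x _ => erefl) PK.
  have laplace := PK_laplace r_gt0 (@measurable_stable_density R alpha C)
    (stable_density_ge0 alpha_gt0 C_gt0) (stable_density_levy alpha_gt0 alpha_lt1 C_gt0)
    (fun x _ => erefl) PK.
  split; first exact: stick_breaking_ae.
  case=> // i _.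
  exact: (stable_residual_law alpha_gt0 alpha_lt1 C_gt0 (ltW r_gt0) J0 simple_ae picks laplace).
Qed.
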